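(* For every $m\in\mathbb{N}$, the entire function $\xi_1$ belongs to $APF_m$; that is, the sequence of Maclaurin coefficients of $\xi_1$ is asymptotically $m$-times positive.
   Context: The Riemann $\xi$-function is the entire function $\xi(s)=\frac{1}{2}s(s-1)\pi^{-s/2}\Gamma(s/2)\zeta(s)$, where $\zeta$ is the Riemann zeta-function. It satisfies $\xi(1-s)=\xi(s)$, so $\xi(s+1/2)$ is an even entire function, $\xi(s+1/2)=\sum_{k=0}^\infty b_k s^{2k}$ with real $b_k$. Define the entire function $\xi_1(z)=\xi(\sqrt{z}+1/2)=\sum_{k=0}^\infty b_k z^k$. For a positive integer $m$, a real sequence $\{a_k\}_{k=0}^\infty$ is called asymptotically $m$-times positive if there exists a positive integer $N$ such that all minors of the matrix $A_N=(a_{N+j-l})$, with rows $l=0,1,\ldots,m-1$ and columns $j=0,1,2,\ldots$ (where $a_k=0$ for $k<0$), are non-negative. $APF_m$ denotes the class of all asymptotically $m$-times positive sequences, and also the class of the corresponding generating functions $f(z)=\sum_{k=0}^\infty a_kz^k$. *)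

(* Defs.v *)
From HB Require Import structures.
From mathcomp Require Import all_boot all_order all_algebra.
From mathcomp Require Import complex.
From mathcomp Require Import all_classical all_reals all_analysis.

Set Implicit Arguments.
Unset Strict Implicit.
Unset Printing Implicit Defensive.

Import Order.TTheory GRing.Theory Num.Theory.
Import numFieldNormedType.Exports.

Local Open Scope classical_set_scope.
Local Open Scope ring_scope.
Local Open Scope complex_scope.

Section ComplexFunctions.
Variable R : realType.

(* [R[i]^o] is the type carrying the topology given by the complex modulus. *)
Definition cvgC (u : nat -> R[i]) (l : R[i]) : Prop :=
  (u : nat -> R[i]^o) @ \oo --> (l : R[i]^o).

(* The derivative is the limit of a difference quotient over complex
   increments. *)
Definition holomorphic_on (D : set R[i]) (f : R[i] -> R[i]) : Prop :=
  forall s, D s -> derivable (f : R[i]^o -> R[i]^o) s 1.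

Definition entire (f : R[i] -> R[i]) : Prop := holomorphic_on setT f.

Definition cexp (z : R[i]) : R[i] :=
  (expR (complex.Re z) * cos (complex.Im z)) +i*
  (expR (complex.Re z) * sin (complex.Im z)).

(* [x ^ s] for real [x > 0] (the value is junk for [x <= 0]). *)
Definition cpow (x : R) (s : R[i]) : R[i] := cexp (s * (ln x)%:C).

Definition Gamma_integrand (s : R[i]) (t : R) : R[i] :=
  cpow t (s - 1) * (expR (- t))%:C.

Definition Gamma_integral (s : R[i]) : R[i] :=
  (\int[lebesgue_measure]_(t in `]0, +oo[)
     complex.Re (Gamma_integrand s t)) +i*
  (\int[lebesgue_measure]_(t in `]0, +oo[)
     complex.Im (Gamma_integrand s t)).

Definition Gamma_pole (s : R[i]) : Prop := exists n : nat, s = - n%:R.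

(* Euler's Gamma function: the analytic continuation of the Euler integral;
   its values at the poles are unconstrained. *)
Definition is_Gamma (G : R[i] -> R[i]) : Prop :=
  holomorphic_on [set s | ~ Gamma_pole s] G /\
  (forall s, 0 < complex.Re s -> G s = Gamma_integral s).

(* The Riemann zeta function: the analytic continuation of the Dirichlet
   series; its value at the pole [s = 1] is unconstrained. *)
Definition is_zeta (zeta : R[i] -> R[i]) : Prop :=
  holomorphic_on [set s | s <> 1] zeta /\
  (forall s, 1 < complex.Re s ->
     cvgC (fun n => \sum_(1 <= k < n) cpow k%:R (- s)) (zeta s)).

(* The formula for xi is meaningful away from the pole of zeta and the poles of
   [Gamma (s / 2)]; these singularities of the product are removable and [xi]
   is the resulting entire function. *)
Definition is_xi (G zeta xi : R[i] -> R[i]) : Prop :=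
  entire xi /\
  (forall s, s <> 1 -> ~ Gamma_pole (s / 2%:R) ->
     xi s = 2%:R^-1 * s * (s - 1) * cpow pi (- (s / 2%:R))
            * G (s / 2%:R) * zeta s).

(* The choice of the square root is immaterial, [fun s => xi (s + 1/2)] being
   even. *)
Definition xi1 (xi : R[i] -> R[i]) (z : R[i]) : R[i] :=
  xi (sqrtC z + 2%:R^-1).

Definition generating_function (a : nat -> R) (f : R[i] -> R[i]) : Prop :=
  forall z, cvgC (fun n => \sum_(0 <= k < n) (a k)%:C * z ^+ k) (f z).

End ComplexFunctions.

Section MultiplePositivity.
Variable R : realType.

(* Entry [a_{N+j-l}] in row [l] and column [j], with [a_k = 0] for [k < 0]. *)
Definition shift_matrix (a : nat -> R) (N l j : nat) : R :=
  if (l <= N + j)%N then a (N + j - l)%N else 0.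

(* A minor of order [r] of the [m x oo] matrix is given by [r] rows and [r]
   columns, both listed increasingly (so necessarily [r <= m]). *)
Definition asymptotically_positive (m : nat) (a : nat -> R) : Prop :=
  exists2 N : nat, (0 < N)%N &
    forall (r : nat) (row : 'I_r -> 'I_m) (col : 'I_r -> nat),
      {homo row : i j / (i < j)%N} ->
      {homo col : i j / (i < j)%N} ->
      0 <= \det (\matrix_(i < r, j < r) shift_matrix a N (row i) (col j)).

Definition APF (m : nat) (f : R[i] -> R[i]) : Prop :=
  exists2 a : nat -> R, generating_function a f & asymptotically_positive m a.

End MultiplePositivity.

(* Main.v *)
Require Import Defs.
From mathcomp Require Import all_boot all_order all_fingroup all_algebra.
From mathcomp Require Import complex.
From mathcomp Require Import all_classical all_reals all_analysis.
From mathcomp Require Import measurable_realfun.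
From mathcomp Require Import zify ring lra.

(* With theta(x) = sum exp(- pi n^2 x), Riemann's Mellin transform gives on the
   reals xi(u + 1/2) = 1/2 + (u^2 - 1/4)/2 * sum_k alpha_k u^(2k), where alpha_k
   is 2/(4^k (2k)!) times the moment
   mu_k = int_1^oo (sum_(n >= 1) exp(- pi n^2 x)) x^(-3/4) (ln x)^(2k) dx;
   unique continuation from a real half line turns this into the Maclaurin
   series of xi_1.  Laplace's method at the saddle point pi X ln X = 2N shows that,
   after a rescaling a_k -> c rho^k a_k that does not affect signs of minors, the
   p-th finite differences of the coefficients near N are N^(-p/2) times the p-th
   derivative of exp(- x^2) at 0, up to a vanishing relative error; only the factor
   1/(2k)! contributes.  Newton's formula turns a Toeplitz determinant into a
   determinant of such differences, whose limit is a Gram determinant of Hermite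
   type and is positive.  So all sufficiently late minors with consecutive rows and
   columns are positive, hence all minors by Fekete's criterion. *)

Set Implicit Arguments.
Unset Strict Implicit.
Unset Printing Implicit Defensive.

Import Order.TTheory GRing.Theory Num.Theory.
Import numFieldNormedType.Exports.
Local Open Scope classical_set_scope.
Local Open Scope ring_scope.

(** * Total positivity *)

(** Infinitely many minors must be non-negative at once, and no asymptotic formula is uniform over
    arbitrary columns. Once only consecutive rows and columns remain, the Toeplitz structure leaves
    the order r <= m and a single index d, so that finitely many limits decide everything. Fekete's
    criterion asks for strict positivity, which the Hermite limit supplies. Why 1/(2k)! dominates:
    near N its logarithm has second difference about - 2 / N, so it looks like a Gaussian of width
    sqrt N. The p-th differences of the rescaled moments are O((2 N ln X)^(- p / 2)), smaller than
    N^(- p / 2) by a power of ln X, which tends to infinity. Laplace's method therefore enters only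
    up to constant factors: an upper bound for the differences and a lower bound for mu_N. The
    factor (u^2 - 1/4)/2 mixes neighbouring alpha_k, which is harmless because alpha_(k+1) / alpha_k
    tends to 0. On the analytic side all integrands are nonnegative: sums and integrals are
    exchanged in the extended reals, and the finiteness of the moments is read off afterwards from
    the convergence of the zeta series. *)

Section Minors.
Variable R : realFieldType.
Implicit Types (w : nat -> nat -> R) (rs cs s : seq nat).

(** Rows and columns are lists in any order, possibly with repetitions, because the exchange
    relations below permute and duplicate them. *)
Definition minor w n rs cs : R :=
  \det (\matrix_(i < n, j < n) w (nth 0%N rs i) (nth 0%N cs j)).

Lemma minor_tr w n rs cs : minor w n rs cs = minor (fun i j => w j i) n cs rs.
Proof. by rewrite /minor -det_tr; congr (\det _); apply/matrixP => i j; rewrite !mxE. Qed.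

Definition skip i s := take i s ++ drop i.+1 s.

Lemma nth_skip (i j : nat) s : (i <= size s)%N ->
  nth 0%N (skip i s) j = nth 0%N s (bump i j).
Proof.
move=> his; rewrite /skip nth_cat size_takel // /bump.
by case: ltnP => h; [rewrite nth_take // | rewrite nth_drop; congr nth; lia].
Qed.

Lemma minor_expand_row w n ra rs cs : size cs = n.+1 ->
  minor w n.+1 (ra :: rs) cs =
    \sum_(i < n.+1) (-1) ^+ i * w ra (nth 0%N cs i) * minor w n rs (skip i cs).
Proof.
move=> szc; rewrite /minor (expand_det_row _ ord0); apply: eq_bigr => i _.
rewrite !mxE /= /cofactor add0n mulrCA -mulrA; congr (_ * (_ * _)).
congr (\det _); apply/matrixP => a b; rewrite !mxE /= nth_skip //.
by rewrite szc ltnW.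
Qed.

Lemma minor_expand_col w n x rs cs : size rs = n.+1 ->
  minor w n.+1 rs (x :: cs) =
    \sum_(i < n.+1) (-1) ^+ i * w (nth 0%N rs i) x * minor w n (skip i rs) cs.
Proof.
move=> szr; rewrite minor_tr minor_expand_row //; apply: eq_bigr => i _.
by rewrite [in RHS]minor_tr.
Qed.

Lemma minor_dup_row w n rs cs (i1 i2 : 'I_n) : i1 != i2 ->
  nth 0%N rs i1 = nth 0%N rs i2 -> minor w n rs cs = 0.
Proof.
move=> ne e; rewrite /minor; apply: (determinant_alternate ne) => j.
by rewrite !mxE e.
Qed.

Lemma minor_dup_head w n x rs cs : x \in rs -> size rs = n ->
  minor w n.+1 (x :: rs) cs = 0.
Proof.
move=> xr szr; have hi : (index x rs < n)%N by rewrite -szr index_mem.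
apply: (@minor_dup_row _ _ _ _ ord0 (lift ord0 (Ordinal hi))) => //=.
by rewrite nth_index.
Qed.

(* Pairing the linear relation between [n + 3] columns of height [n + 2] with
   the functional [x |-> minor w n.+1 rs (x :: J)] kills all but three terms. *)
Lemma minor_plucker w n r0 rs j1 t jl J : size rs = n.+1 -> size J = n ->
  minor w n.+2 (r0 :: rs) (j1 :: jl :: J) * minor w n.+1 rs (t :: J) =
  minor w n.+2 (r0 :: rs) (t :: jl :: J) * minor w n.+1 rs (j1 :: J) +
  minor w n.+2 (r0 :: rs) (j1 :: t :: J) * minor w n.+1 rs (jl :: J).
Proof.
move=> szr szJ; pose cs := [:: j1, t, jl & J].
have szc : size cs = n.+3 by rewrite /= szJ.
have : \sum_(i < n.+3) (-1) ^+ i * minor w n.+2 (r0 :: rs) (skip i cs)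
    * minor w n.+1 rs (nth 0%N cs i :: J) = 0.
  under eq_bigr => i _ do rewrite minor_expand_col // big_distrr /=.
  rewrite exchange_big big1 //= => a _.
  (* After expanding the second minor along its first column and exchanging the sums, the inner sum
     is the first-row expansion of a minor of order n + 3 whose first row occurs again further
     down. *)
  transitivity ((-1) ^+ a * minor w n (skip a rs) J
      * minor w n.+3 (nth 0%N rs a :: r0 :: rs) cs).
    rewrite minor_expand_row // big_distrr /=; apply: eq_bigr => i _; ring.
  rewrite minor_dup_head ?mulr0 //= ?szr //.
  by rewrite inE mem_nth ?orbT // szr.
rewrite big_ord_recl big_ord_recl big_ord_recl /= big1 ?addr0 => [|i _].
  rewrite /skip /= ?take0 ?drop0 ?expr0 ?expr1 ?expr2 => h; lra.
have -> : minor w n.+1 rs (nth 0%N cs (lift ord0 (lift ord0 (lift ord0 i))) :: J) = 0.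
  rewrite minor_tr minor_dup_head //=; apply: mem_nth.
  by rewrite szJ; exact: ltn_ord.
by rewrite mulr0.
Qed.

Lemma minor_swap w n rs s1 x y s2 : ((size s1).+1 < n)%N ->
  minor w n rs (s1 ++ x :: y :: s2) = - minor w n rs (s1 ++ y :: x :: s2).
Proof.
move=> hs; have hs' : (size s1 < n)%N by apply: ltn_trans hs.
pose i := Ordinal hs'; pose j := Ordinal hs.
have nij : i != j by rewrite -val_eqE /= neq_ltn ltnSn.
rewrite /minor.
set M := (X in _ = - \det X).
transitivity (\det (col_perm (tperm i j) M)).
  congr (\det _); apply/matrixP => a b; rewrite !mxE; congr (w _ _).
  rewrite !nth_cat; case: tpermP => [->|->|nbi nbj] /=.
  - by rewrite ltnn ltnNge leqnSn subnn subSnn.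
  - by rewrite ltnn ltnNge leqnSn subnn subSnn.
  case: ltnP => // hb.
  have {}nbi : (b : nat) <> size s1 by move=> e; apply: nbi; apply: val_inj.
  have {}nbj : (b : nat) <> (size s1).+1 by move=> e; apply: nbj; apply: val_inj.
  by have -> : (b - size s1 = (b - size s1).-2.+2)%N by lia.
by rewrite col_permE det_mulmx det_perm odd_permV odd_tperm nij expr1 mulrN1.
Qed.

Lemma minor_move w n rs s1 x s2 s3 : (size s1 + size s2 < n)%N ->
  minor w n rs (s1 ++ x :: s2 ++ s3) =
  (-1) ^+ size s2 * minor w n rs (s1 ++ s2 ++ x :: s3).
Proof.
elim: s2 s1 => [|y s2 IH] s1 /= h; first by rewrite expr0 mul1r.
rewrite minor_swap; last by move: h; lia.
have := IH (rcons s1 y); rewrite !cat_rcons size_rcons => ->; last by lia.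
by rewrite exprS mulN1r mulNr.
Qed.

(** When j1 < J1 < t < J2 < jl all six column lists are increasing and every sign has cancelled, so
    positivity of the other five minors forces that of the first. *)
Lemma minor_plucker_sorted w n r0 rs j1 J1 t J2 jl :
    size rs = n.+1 -> size (J1 ++ J2) = n ->
  minor w n.+2 (r0 :: rs) (j1 :: J1 ++ J2 ++ [:: jl])
    * minor w n.+1 rs (J1 ++ t :: J2) =
  minor w n.+2 (r0 :: rs) (J1 ++ t :: J2 ++ [:: jl])
    * minor w n.+1 rs (j1 :: J1 ++ J2) +
  minor w n.+2 (r0 :: rs) (j1 :: J1 ++ t :: J2)
    * minor w n.+1 rs (J1 ++ J2 ++ [:: jl]).
Proof.
move=> szr szJ; have := minor_plucker w r0 j1 t jl szr szJ.
move: (szJ); rewrite size_cat => szJ'.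
have := @minor_move w n.+2 (r0 :: rs) [:: j1] jl (J1 ++ J2) [::].
rewrite /= cats0 => ->; last by rewrite szJ; lia.
have := @minor_move w n.+1 rs [::] t J1 J2.
rewrite /= => ->; last by lia.
have := @minor_move w n.+2 (r0 :: rs) [:: t] jl (J1 ++ J2) [::].
rewrite /= cats0 => ->; last by rewrite szJ; lia.
have := @minor_move w n.+2 (r0 :: rs) [::] t J1 (J2 ++ [:: jl]).
rewrite /= -catA => ->; last by lia.
have := @minor_move w n.+2 (r0 :: rs) [:: j1] t J1 J2.
rewrite /= => ->; last by lia.
have := @minor_move w n.+1 rs [::] jl (J1 ++ J2) [::].
rewrite /= cats0 -catA => ->; last by rewrite szJ; lia.
rewrite szJ => e.
apply: (@mulfI _ ((-1) ^+ n * (-1) ^+ size J1)).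
  by rewrite mulf_neq0 // signr_eq0.
lra.
Qed.

Lemma sorted_no_gap s x : sorted ltn (x :: s) ->
  (forall t, (x < t < last x s)%N -> t \in s) -> x :: s = iota x (size s).+1.
Proof.
elim: s x => [|y s IH] x //= /andP[xy sy] gap.
have ey : y = x.+1.
  apply/eqP; rewrite eqn_leq xy andbT leqNgt; apply/negP => hy.
  have yl : (y <= last y s)%N.
    have := @order_path_min _ ltn y s ltn_trans sy => /allP yall.
    have := mem_last y s; rewrite inE => /orP[/eqP->//|/yall]; exact: ltnW.
  have := gap x.+1; rewrite ltnSn (leq_trans hy yl) /= inE => /(_ isT).
  rewrite ltn_eqF //= => xs.
  have := @order_path_min _ ltn y s ltn_trans sy => /allP /(_ _ xs) /=; lia.
rewrite {1}IH //= ?ey // => t /andP[yt tl].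
have := gap t; rewrite ey tl (ltn_trans (ltnSn x) yt) inE /= => /(_ isT).
by rewrite gtn_eqF.
Qed.

Lemma sorted_split t s : sorted ltn s -> t \notin s ->
  s = [seq x <- s | (x < t)%N] ++ [seq x <- s | (t < x)%N].
Proof.
elim: s => [|y s IH] //= ys; rewrite inE negb_or => /andP[ty ts].
have sy : sorted ltn s by apply: path_sorted ys.
have /allP yall := @order_path_min _ ltn y s ltn_trans ys.
case: (ltngtP y t) ty => [yt _|ty _|->]; last by rewrite ?eqxx.
  by rewrite /= -IH.
rewrite (_ : [seq x <- s | (x < t)%N] = [::]); last first.
  apply/eqP; rewrite -(negbK (_ == _)) -has_filter; apply/negP => /hasP[x /yall /=].
  by move=> yx xt; have := ltn_trans ty (ltn_trans yx xt); rewrite ltnn.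
rewrite /= (_ : [seq x <- s | (t < x)%N] = s) //.
by apply/all_filterP/allP => x /yall /=; exact: ltn_trans.
Qed.

(** Induction on the spread of the columns, last minus first. If some t is skipped, the three-term
    relation with t inserted expresses the minor through two minors of the same order and smaller
    spread, and through minors of lower order on the rows [behead rs]. If nothing is skipped, the
    columns are consecutive. The bound [b] allows the lemma to be transposed to the rows, which are
    limited to indices below m. *)
Lemma pos_minors_fixed_rows w n b rs : size rs = n.+2 ->
  (forall cs, sorted ltn cs -> size cs = n.+1 -> all (ltn^~ b) cs ->
     0 < minor w n.+1 (behead rs) cs) ->
  (forall c, (c + n.+2 <= b)%N -> 0 < minor w n.+2 rs (iota c n.+2)) ->
  forall cs, sorted ltn cs -> size cs = n.+2 -> all (ltn^~ b) cs ->
     0 < minor w n.+2 rs cs.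
Proof.
case: rs => [//|r0 rs] [szr] /= H1 H2 cs.
have [d] := ubnP (last 0%N cs - head 0%N cs)%N.
elim: d cs => [//|d IH] cs hd scs szc /allP bcs.
case: cs => [//|j1 cs] in hd scs szc bcs *.
case/lastP: cs => [//|cs jl] in hd scs szc bcs *.
rewrite /= last_rcons in hd.
have [gap|] := boolP (all (fun t => t \in rcons cs jl) (iota j1.+1 (jl - j1.+1))).
  have e : j1 :: rcons cs jl = iota j1 (size (rcons cs jl)).+1.
    apply: sorted_no_gap => // t; rewrite last_rcons => /andP[h1 h2].
    by move/allP: gap => /(_ t); apply; rewrite mem_iota; lia.
  have [sz'] := szc; rewrite sz' in e; rewrite e.
  apply: H2; have := bcs (j1 + n.+1)%N; rewrite e mem_iota /= => h.
  by rewrite addnS; apply: h; lia.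
move=> /allPn[t]; rewrite mem_iota => ht tnin.
have hj1t : (j1 < t)%N by lia.
have htjl : (t < jl)%N by lia.
have tn' : t \notin j1 :: rcons cs jl.
  by rewrite inE negb_or tnin andbT gtn_eqF.
have := sorted_split scs tn' => /=; rewrite hj1t ltnNge ltnW //=.
rewrite !filter_rcons htjl ltnNge ltnW //=.
set J1 := [seq x <- cs | (x < t)%N]; set J2 := [seq x <- cs | (t < x)%N].
rewrite -rcons_cat => -[] /rcons_inj [ecs].
have trans := ltn_trans.
have szJ : size (J1 ++ J2) = n by rewrite -ecs; move: szc => /=; rewrite size_rcons => -[].
have J1t x : x \in J1 -> (x < t)%N by rewrite mem_filter => /andP[].
have J2t x : x \in J2 -> (t < x)%N by rewrite mem_filter => /andP[].
rewrite ecs -cats1 in scs bcs *.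
have scsA : sorted ltn (j1 :: J1 ++ J2 ++ [:: jl]) by rewrite catA.
have bcs' x : x \in (j1 :: J1 ++ t :: J2 ++ [:: jl]) -> (x < b)%N.
  have tb : (t < b)%N.
    apply: ltn_trans htjl _; apply: bcs.
    by rewrite inE mem_cat mem_seq1 eqxx !orbT.
  move=> hx; have [->//|nxt] := eqVneq x t.
  by apply: bcs; move: hx; rewrite !(inE, mem_cat) (negPf nxt) /= -?orbA.
have st : sorted ltn (j1 :: J1 ++ t :: J2 ++ [:: jl]).
  have pw s := @sorted_pairwise _ ltn ltn_trans s.
  move: scsA; rewrite !pw /= !pairwise_cat /= !all_cat /= !allrel_consr /=.
  rewrite !pairwise_cat /= !all_cat /= !allrel_consr /=.
  move=> /and5P[/and4P[-> -> -> _] -> -> -> /andP[-> _]] /=.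
  rewrite hj1t htjl !andbT /=.
  by apply/andP; split; apply/allP => x; [exact: J1t | exact: J2t].
have sub s : subseq s (j1 :: J1 ++ t :: J2 ++ [:: jl]) -> sorted ltn s /\ all (ltn^~ b) s.
  move=> ss; split; first exact: subseq_sorted ss st.
  by apply/allP => x xs; apply: bcs'; exact: (mem_subseq ss).
have := minor_plucker_sorted w r0 j1 t jl szr szJ.
rewrite -catA => e.
have pos1 s : subseq s (j1 :: J1 ++ t :: J2 ++ [:: jl]) -> size s = n.+1 ->
    0 < minor w n.+1 rs s.
  by move=> /sub[? ?] ?; apply: H1.
move: szJ; rewrite size_cat => szJ.
have ss0 : subseq (j1 :: J1 ++ J2 ++ [:: jl]) (j1 :: J1 ++ t :: J2 ++ [:: jl]).
  by rewrite /= eqxx cat_subseq // subseq_cons.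
have pA : 0 < minor w n.+1 rs (J1 ++ t :: J2).
  apply: pos1; last by rewrite size_cat /= addnS szJ.
  apply: (@subseq_trans _ (J1 ++ t :: J2 ++ [:: jl])); last exact: subseq_cons.
  by rewrite cat_subseq //= eqxx prefix_subseq.
have pB : 0 < minor w n.+1 rs (j1 :: J1 ++ J2).
  apply: pos1; last by rewrite /= size_cat /= szJ.
  apply: subseq_trans ss0; rewrite /= eqxx catA; exact: prefix_subseq.
have pC : 0 < minor w n.+1 rs (J1 ++ J2 ++ [:: jl]).
  apply: pos1; last by rewrite catA size_cat /= size_cat szJ addn1.
  apply: subseq_trans ss0; exact: subseq_cons.
have ssD : subseq (J1 ++ t :: J2 ++ [:: jl]) (j1 :: J1 ++ t :: J2 ++ [:: jl]).
  exact: subseq_cons.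
have j1jl : (j1 < jl)%N by apply: ltn_trans htjl.
have hd' : (jl - j1 <= d)%N by rewrite -ltnS.
have pD : 0 < minor w n.+2 (r0 :: rs) (J1 ++ t :: J2 ++ [:: jl]).
  have [sD bD] := sub _ ssD.
  apply: IH sD _ bD; last by rewrite size_cat /= size_cat /= addn1 !addnS szJ.
  have -> : last 0%N (J1 ++ t :: J2 ++ [:: jl]) = jl by rewrite last_cat /= last_cat.
  have : (j1 < head 0%N (J1 ++ t :: J2 ++ [:: jl]))%N.
    by move: st => /=; case: (J1) => [|z ?] /= /andP[].
  by move: hd' j1jl; clear; lia.
have ssE : subseq (j1 :: J1 ++ t :: J2) (j1 :: J1 ++ t :: J2 ++ [:: jl]).
  rewrite /= eqxx cat_subseq //= eqxx; exact: prefix_subseq.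
have pE : 0 < minor w n.+2 (r0 :: rs) (j1 :: J1 ++ t :: J2).
  have [sE bE] := sub _ ssE.
  apply: IH sE _ bE; last by rewrite /= size_cat /= addnS szJ.
  have : (last 0%N (j1 :: J1 ++ t :: J2) < jl)%N.
    move: st; rewrite (_ : _ ++ _ = rcons (J1 ++ t :: J2) jl); last first.
      by rewrite -cats1 -catA.
    by rewrite /= rcons_path => /andP[].
  by move: hd' j1jl; rewrite [head _ _]/=; clear; lia.
rewrite -(pmulr_lgt0 _ pA) e.
by rewrite addr_gt0 // mulr_gt0.
Qed.

(** Induction on the order. Consecutive rows with arbitrary columns come first ([Hiota]); the
    transposed argument then frees the rows. *)
Theorem Fekete w m :
  (forall n i c, (i + n <= m)%N -> 0 < minor w n (iota i n) (iota c n)) ->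
  forall n rs cs, sorted ltn rs -> all (ltn^~ m) rs -> size rs = n ->
    sorted ltn cs -> size cs = n -> 0 < minor w n rs cs.
Proof.
move=> H; elim=> [|n IH] rs cs srs mrs szr scs szc.
  by rewrite /minor det_mx00.
case: n IH szr szc => [|n] IH szr szc.
  move: rs cs szr szc {scs srs} mrs => [//|r [|//]] [//|c [|//]] _ _ /= /andP[rm _].
  by apply: (H 1%N r c); rewrite addn1.
have bound s : exists b, all (ltn^~ b) s.
  elim: s => [|x s [b hb]]; first by exists 0%N.
  exists (maxn x.+1 b); rewrite /= leq_max ltnSn /=.
  by apply/allP => y /(allP hb) /=; rewrite leq_max => ->; rewrite orbT.
have Hiota i cs' : (i + n.+2 <= m)%N -> sorted ltn cs' -> size cs' = n.+2 ->
    0 < minor w n.+2 (iota i n.+2) cs'.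
  move=> him scs' szc'; have [b hb] := bound cs'.
  apply: (@pos_minors_fixed_rows _ _ b) => //; first by rewrite size_iota.
  - move=> cs'' s1 s2 _; apply: IH => //=.
    + by have := iota_ltn_sorted i.+1 n.+1.
    + have : all (ltn^~ m) (iota i.+1 n.+1) by apply/allP => x; rewrite mem_iota /=; move: him; clear; lia.
      by [].
    + by rewrite size_iota.
  - by move=> c _; apply: H.
rewrite minor_tr; apply: (@pos_minors_fixed_rows _ _ m) => //.
- move=> rs' s1 s2 s3; rewrite -minor_tr; apply: IH => //.
    by move: scs; case: (cs) => //= ? ?; exact: path_sorted.
  by rewrite size_behead szc.
- by move=> i hi; rewrite -minor_tr; apply: Hiota.
Qed.

End Minors.

(** * Toeplitz determinants and finite differences *)

Section Differences.
Variable R : numDomainType.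
Implicit Types (f g : nat -> R).

Definition fdiff f k := f k.+1 - f k.

Lemma iter_fdiffS p f k :
  iter p.+1 fdiff f k = iter p fdiff f k.+1 - iter p fdiff f k.
Proof. by []. Qed.

Lemma newton_forward f k j N : (j < N)%N ->
  f (k + j)%N = \sum_(q < N) 'C(j, q)%:R * iter q fdiff f k.
Proof.
move=> jN; transitivity (\sum_(q < j.+1) 'C(j, q)%:R * iter q fdiff f k).
  elim: j k {jN} => [|j IH] k; first by rewrite big_ord1 addn0 mul1r.
  rewrite addnS -addSn IH [RHS]big_ord_recl /= !bin0.
  transitivity (\sum_(q < j.+1) ('C(j, q)%:R * iter q fdiff f k +
                                 'C(j, q)%:R * iter q.+1 fdiff f k)).
    by apply: eq_bigr => q _; rewrite iter_fdiffS; ring.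
  rewrite big_split /= big_ord_recl /= bin0 -addrA; congr (_ + _).
  rewrite [in RHS](eq_bigr (fun q : 'I_j.+1 => 'C(j, q.+1)%:R * iter q.+1 fdiff f k
       + 'C(j, q)%:R * iter q.+1 fdiff f k)); last first.
    by move=> q _; rewrite /bump /= add1n binS natrD mulrDl.
  rewrite big_split /=; congr (_ + _).
  by rewrite big_ord_recr /= bin_small // mul0r addr0.
rewrite [RHS](bigID (fun q : 'I_N => (q < j.+1)%N)) /= [X in _ = _ + X]big1 ?addr0.
  by rewrite (big_ord_widen N (fun q => 'C(j, q)%:R * iter q fdiff f k)).
by move=> q; rewrite -leqNgt => h; rewrite bin_small // mul0r.
Qed.

Lemma iter_fdiff_rev f c p i : (i + p <= c)%N ->
  iter p fdiff (fun k => f (c - k)%N) i = (-1) ^+ p * iter p fdiff f (c - i - p)%N.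
Proof.
elim: p i => [|p IH] i h; first by rewrite expr0 mul1r subn0.
rewrite iter_fdiffS !IH; [|by lia..].
rewrite iter_fdiffS exprS mulN1r.
have -> : (c - i.+1 - p = c - i - p.+1)%N by lia.
have -> : ((c - i - p.+1).+1 = c - i - p)%N by lia.
ring.
Qed.

(** Newton's formula for the reversed sequence; [N <= c.+1] keeps the subtraction [c - p] from
    truncating. *)
Lemma newton_backward f c i N : (i < N)%N -> (N <= c.+1)%N ->
  f (c - i)%N = \sum_(p < N) 'C(i, p)%:R * ((-1) ^+ p * iter p fdiff f (c - p)%N).
Proof.
move=> iN Nc; have := newton_forward (fun k => f (c - k)%N) 0 iN.
rewrite add0n => ->; apply: eq_bigr => p _.
by rewrite iter_fdiff_rev ?subn0 // add0n -ltnS (leq_trans _ Nc).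
Qed.

(** Newton's formula forwards along the columns and backwards along the rows factors the Toeplitz
    matrix as B S B^T, with B the unipotent Pascal matrix and S the matrix of differences. *)
Lemma det_toeplitz_fdiff f c r : (r <= c.+1)%N ->
  \det (\matrix_(i < r, j < r) f (c - i + j)%N) =
  \det (\matrix_(p < r, q < r) ((-1) ^+ p * iter (p + q) fdiff f (c - p)%N)).
Proof.
move=> rc; pose B : 'M[R]_r := \matrix_(i, p) 'C(i, p)%:R.
set S := (X in _ = \det X).
have -> : \matrix_(i < r, j < r) f (c - i + j)%N = B *m S *m B^T.
  apply/matrixP => i j; rewrite !mxE (newton_forward _ _ (ltn_ord j)).
  apply: eq_bigr => q _; rewrite !mxE mulrC; congr (_ * _).
  rewrite (newton_backward _ (ltn_ord i) rc); apply: eq_bigr => p _.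
  by rewrite !mxE iterD.
have detB : \det B = 1.
  rewrite det_trig; last first.
    by apply/is_trig_mxP => i j ij; rewrite mxE bin_small.
  by apply: big1 => i _; rewrite mxE binn.
by rewrite !det_mulmx det_tr detB mul1r mulr1.
Qed.

Lemma det_scale n (x y : 'I_n -> R) (M : 'M[R]_n) :
  \det (\matrix_(i, j) (x i * M i j * y j)) =
  (\prod_i x i) * \det M * \prod_j y j.
Proof.
have -> : \matrix_(i, j) (x i * M i j * y j) =
    diag_mx (\row_i x i) *m M *m diag_mx (\row_j y j).
  by rewrite mul_mx_diag mul_diag_mx; apply/matrixP => i j; rewrite !mxE.
rewrite !det_mulmx !det_diag; congr (_ * _ * _); apply: eq_bigr => i _;
  by rewrite !mxE.
Qed.

End Differences.

(** * The limit determinant: derivatives of exp(- x^2) at 0 *)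

Section Hermite.
Variable R : numDomainType.

(* [hermL p j] is [1 / j!] times the [p]-th derivative of [x ^ j exp (- x ^ 2)] at [0]. *)
Fixpoint hermL (p j : nat) : R :=
  if p is p'.+1 then
    (if j is j'.+1 then hermL p' j' else 0) - 2 * j.+1%:R * hermL p' j.+1
  else (j == 0%N)%:R.

Definition hermite0 p := hermL p 0.

Lemma hermL_small p j : (p < j)%N -> hermL p j = 0.
Proof.
elim: p j => [|p IH] [|j] //= pj.
by rewrite !IH ?mulr0 ?subr0 //; lia.
Qed.

Lemma hermL_diag p : hermL p p = 1.
Proof. by elim: p => [|p IH] //=; rewrite IH hermL_small ?mulr0 ?subr0. Qed.

(** In terms of derivatives this is (x g)^(p+1)(0) = (p + 1) g^(p)(0) with g = x^j exp(- x^2). *)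
Lemma hermL_shift p j : j.+1%:R * hermL p.+1 j.+1 = p.+1%:R * hermL p j.
Proof.
elim: p j => [|p IH] j.
  rewrite [hermL 1 _]/= !mulr0 subr0 mul1r /=.
  by case: j => [|j]; rewrite ?mulr1 ?mulr0.
have e1 : hermL p.+2 j.+1 = hermL p.+1 j - 2 * j.+2%:R * hermL p.+1 j.+2 by [].
have e2 : hermL p.+1 j = (if j is j'.+1 then hermL p j' else 0) - 2 * j.+1%:R * hermL p j.+1.
  by [].
have e3 : p.+1%:R * (if j is j'.+1 then hermL p j' else 0) = j%:R * hermL p.+1 j.
  by case: (j) => [|j']; rewrite ?mulr0 ?mul0r // IH.
have e4 := IH j.+1.
rewrite e1 mulrBr.
have -> : j.+1%:R * (2 * j.+2%:R * hermL p.+1 j.+2) = 2 * j.+1%:R * (j.+2%:R * hermL p.+1 j.+2) :> R by ring.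
rewrite e4.
have : p.+1%:R * hermL p.+1 j = j%:R * hermL p.+1 j - p.+1%:R * (2 * j.+1%:R * hermL p j.+1).
  by rewrite {1}e2 mulrBr e3.
move=> e5; have -> : p.+2%:R = p.+1%:R + 1 :> R by rewrite natr1.
by rewrite [RHS]mulrDl mul1r e5; ring.
Qed.

Lemma hermite00 : hermite0 0 = 1. Proof. by []. Qed.
Lemma hermite01 : hermite0 1 = 0. Proof. by rewrite /hermite0 /= mulr0 subr0. Qed.
Lemma hermite0SS p : hermite0 p.+2 = - (2 * p.+1%:R) * hermite0 p.
Proof.
have -> : hermite0 p.+2 = 0 - 2 * 1 * hermL p.+1 1 by [].
have := hermL_shift p 0; rewrite mul1r => ->.
by rewrite sub0r mulr1 mulrA mulNr.
Qed.

Let d j : R := (-2) ^+ j * j`!%:R.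

(** Differentiate exp(- (x + y)^2) = exp(- x^2) exp(- y^2) sum_j (- 2 x y)^j / j! p times in x and q
    times in y at the origin; this is also the origin of the weights [d j]. *)
Lemma hermite0_gram p q N : (p + q < N)%N ->
  hermite0 (p + q) = \sum_(j < N) hermL p j * d j * hermL q j.
Proof.
elim: p q => [|p IH] q h.
  case: N h => // N h; rewrite big_ord_recl /= /d mul1r expr0 mul1r mul1r.
  by rewrite big1 ?addr0 // => i _; rewrite mul0r mul0r.
rewrite addSnnS IH ?addnS //; case: N {IH} h => // N h.
pose s (a b : nat) : R := \sum_(j < N.+1) hermL a j * d j * hermL b j.
(* The right-hand side is symmetric in a and b, so a derivative may be moved from one factor to the
   other, which is the induction step. *)
have key a b : (a < N)%N -> (b <= N)%N -> s a.+1 b =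
    \sum_(j < N) d j.+1 * (hermL a j * hermL b j.+1 + hermL a j.+1 * hermL b j).
  move=> aN bN; rewrite /s.
  transitivity (\sum_(j < N.+1) (if j : nat is j'.+1 then hermL a j' * d j * hermL b j else 0)
    + \sum_(j < N.+1) d j.+1 * (hermL a j.+1 * hermL b j)).
    rewrite -big_split /=; apply: eq_bigr => j _.
    have -> : d j.+1 = - (2 * j.+1%:R) * d j by rewrite /d exprS factS natrM; ring.
    by case: (nat_of_ord j) => [|j']; ring.
  rewrite big_ord_recl add0r [X in _ + X]big_ord_recr /= (hermL_small (j := N.+1)); last by lia.
  rewrite mul0r mulr0 addr0 -big_split /=; apply: eq_bigr => j _.
  by rewrite /bump /= add1n; ring.
change (s p q.+1 = s p.+1 q).
have -> : s p q.+1 = s q.+1 p by apply: eq_bigr => j _; ring.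
rewrite !key; try lia.
by apply: eq_bigr => j _; ring.
Qed.

(** The signs (-1)^p of the backward differences cancel those of the weights (-2)^j j!: the
    determinant is the product of the 2^j j!. *)
Lemma det_hermite0_gt0 r :
  0 < \det (\matrix_(p < r, q < r) ((-1) ^+ p * hermite0 (p + q))).
Proof.
pose L : 'M[R]_r := \matrix_(p, j) hermL p j.
have -> : \matrix_(p < r, q < r) ((-1) ^+ p * hermite0 (p + q)) =
    diag_mx (\row_(p < r) (-1) ^+ p) *m (L *m diag_mx (\row_(j < r) d j) *m L^T).
  rewrite mul_mx_diag mul_diag_mx; apply/matrixP => p q; rewrite !mxE.
  congr (_ * _); rewrite (@hermite0_gram p q (r + r)%N); last first.
    by have := ltn_ord p; have := ltn_ord q; lia.
  rewrite big_split_ord /= [X in _ + X]big1 ?addr0 => [|j _]; last first.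
    by rewrite hermL_small ?mul0r // ltn_addr.
  by apply: eq_bigr => j _; rewrite !mxE.
have detL : \det L = 1.
  rewrite det_trig; first by apply: big1 => i _; rewrite mxE hermL_diag.
  by apply/is_trig_mxP => i j ij; rewrite mxE hermL_small.
rewrite !det_mulmx det_tr detL mul1r mulr1 !det_diag -big_split /=.
apply: prodr_gt0 => j _; rewrite !mxE /d mulrA -exprMn mulrNN mul1r.
by rewrite mulr_gt0 ?exprn_gt0 ?ltr0n ?fact_gt0.
Qed.

End Hermite.

Section ToeplitzPositive.
Variable R : realType.

Lemma cvg_det (r : nat) (M : nat -> 'M[R]_r) (L : 'M[R]_r) :
  (forall i j, (fun n => M n i j) @ \oo --> L i j) ->
  (fun n => \det (M n)) @ \oo --> \det L.
Proof.
move=> ML; rewrite /determinant; apply: cvg_big => [|s _]; first exact: add_continuous.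
apply: cvgM; first exact: cvg_cst.
by apply: cvg_big => //; exact: mul_continuous.
Qed.

(** Multiplying row p by s^p and column q by s^q preserves the sign of the determinant and makes the
    matrix of differences converge to the Hermite matrix. *)
Lemma toeplitz_pos (u : nat -> nat -> R) (s : nat -> R) :
  (forall n, 0 < s n) ->
  (forall p k, (fun n => s n ^+ p * iter p (@fdiff R) (u n) k) @ \oo --> hermite0 R p) ->
  forall r c, (r <= c.+1)%N ->
  \forall n \near \oo, 0 < \det (\matrix_(i < r, j < r) u n (c - i + j)%N).
Proof.
move=> s0 hu r c rc.
have : (fun n => \det (\matrix_(p < r, q < r)
       (s n ^+ p * ((-1) ^+ p * iter (p + q)%N (@fdiff R) (u n) (c - p)%N) * s n ^+ q)))
    @ \oo --> \det (\matrix_(p < r, q < r) ((-1) ^+ p * hermite0 R (p + q)%N)).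
  apply: cvg_det => p q; rewrite mxE.
  have e : (fun n => (\matrix_(p < r, q < r)
      (s n ^+ p * ((-1) ^+ p * iter (p + q)%N (@fdiff R) (u n) (c - p)%N) * s n ^+ q)) p q) =
     (fun n => (-1) ^+ p * (s n ^+ (p + q)%N * iter (p + q)%N (@fdiff R) (u n) (c - p)%N)).
    by apply/funext => n; rewrite !mxE exprD; ring.
  by rewrite e; apply: cvgM; [exact: cvg_cst | exact: hu].
move=> /cvgr_gt /(_ _ (det_hermite0_gt0 R r)).
apply: filterS => n.
rewrite (_ : \matrix_(p, q) _ = \matrix_(p < r, q < r) (s n ^+ p * (\matrix_(p < r, q < r) ((-1) ^+ p * iter (p + q)%N (@fdiff R) (u n) (c - p)%N)) p q * s n ^+ q)); last first.
  by apply/matrixP => p q; rewrite !mxE.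
rewrite det_scale det_toeplitz_fdiff // pmulr_lgt0; last first.
  by apply: prodr_gt0 => i _; exact: exprn_gt0.
by rewrite pmulr_rgt0 //; apply: prodr_gt0 => i _; exact: exprn_gt0.
Qed.

End ToeplitzPositive.

Lemma iter_fdiffM (R : numDomainType) (f g : nat -> R) p k :
  iter p (@fdiff R) (fun k => f k * g k) k =
  \sum_(j < p.+1) 'C(p, j)%:R * iter j (@fdiff R) f k * iter (p - j)%N (@fdiff R) g (k + j)%N.
Proof.
elim: p k => [|p IH] k.
  by rewrite big_ord1 /= bin0 mul1r addn0.
rewrite iter_fdiffS !IH.
transitivity (\sum_(j < p.+1) 'C(p, j)%:R * (iter j (@fdiff R) f k * iter (p.+1 - j)%N (@fdiff R) g (k + j)%N
    + iter j.+1 (@fdiff R) f k * iter (p - j)%N (@fdiff R) g (k + j.+1)%N)).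
  rewrite -sumrB; apply: eq_bigr => j _.
  have jp : (j <= p)%N by rewrite -ltnS.
  rewrite (subSn jp) !iter_fdiffS addSn addnS.
  by move: (iter _ _ _ _) (iter _ _ _ _) (iter _ _ _ _) (iter _ _ _ _) => a b c d; ring.
under eq_bigr => j _ do rewrite mulrDr !mulrA.
rewrite big_split /= [RHS]big_ord_recl [X in X + _ = _]big_ord_recl /= !bin0 -addrA; congr (_ + _).
rewrite [in RHS](eq_bigr (fun j : 'I_p.+1 =>
    'C(p, j.+1)%:R * iter j.+1 (@fdiff R) f k * iter (p - j)%N (@fdiff R) g (k + j.+1)%N +
    'C(p, j)%:R * iter j.+1 (@fdiff R) f k * iter (p - j)%N (@fdiff R) g (k + j.+1)%N)); last first.
  by move=> j _; rewrite /bump /= add1n binS natrD subSS; ring.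
rewrite big_split /=; congr (_ + _).
rewrite [RHS]big_ord_recr /= bin_small // !mul0r addr0.
by apply: eq_bigr => j _; rewrite /bump /= add1n subSS.
Qed.

(** * Finite differences at the scale sqrt N *)

Section ScaledDifferences.
Variable R : realType.
Local Notation D := (@fdiff R).

(** With the index measured in units of [s n], the sequences [u n] approach a function whose
    derivatives at 0 are the [h p]. The limit is the same for every k: a fixed shift is invisible at
    a scale tending to infinity. *)
Definition scaled_cvg (s : nat -> R) (u : nat -> nat -> R) (h : nat -> R) :=
  forall p k, (fun n => s n ^+ p * iter p D (u n) k) @ \oo --> h p.

(** The hypothesis on [v] says that it looks like the constant 1 at this scale, so in the Leibniz
    formula only the undifferentiated [v] survives. *)
Lemma scaled_cvgM s u v h : scaled_cvg s u h ->
  scaled_cvg s v (fun p => (p == 0%N)%:R) ->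
  scaled_cvg s (fun n k => v n k * u n k) h.
Proof.
move=> hu hv p k.
have -> : h p = \sum_(j < p.+1) 'C(p, j)%:R * (j == 0%N :> nat)%:R * h (p - j)%N.
  rewrite big_ord_recl /= bin0 !mul1r subn0 big1 ?addr0 // => i _.
  by rewrite mulr0 mul0r.
have -> : (fun n => s n ^+ p * iter p D (fun k => v n k * u n k) k) =
    (fun n => \sum_(j < p.+1) 'C(p, j)%:R * (s n ^+ j * iter j D (v n) k) *
        (s n ^+ (p - j)%N * iter (p - j)%N D (u n) (k + j)%N)).
  apply/funext => n; rewrite iter_fdiffM big_distrr /=; apply: eq_bigr => j _.
  have jp : (j <= p)%N by rewrite -ltnS.
  rewrite -{1}(subnKC jp) exprD.
  by move: (iter _ _ _ _) (iter _ _ _ _) => a b; ring.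
apply: cvg_big => [|j _]; first exact: add_continuous.
apply: cvgM; last exact: hu.
by apply: cvgM; [exact: cvg_cst | exact: hv].
Qed.

Lemma iter_fdiff_comb (f : nat -> R) c p k :
  iter p D (fun k => f k - c * f k.+1) k = iter p D f k - c * iter p D f k.+1.
Proof. by elim: p k => [//|p IH] k; rewrite !iter_fdiffS !IH; ring. Qed.

Lemma scaled_cvg_comb s u h (r : nat -> R) : scaled_cvg s u h ->
  r @ \oo --> 0 ->
  scaled_cvg s (fun n k => u n k - r n * u n k.+1) h.
Proof.
move=> hu hr p k.
have -> : h p = h p - 0 * h p by rewrite mul0r subr0.
have -> : (fun n => s n ^+ p * iter p D (fun k => u n k - r n * u n k.+1) k) =
    (fun n => s n ^+ p * iter p D (u n) k - r n * (s n ^+ p * iter p D (u n) k.+1)).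
  by apply/funext => n; rewrite iter_fdiff_comb; ring.
by apply: cvgB; [exact: hu | apply: cvgM => //; exact: hu].
Qed.

(* The index is shifted, [N = n + 1], so that the base [2 N] is never 0. *)
Definition factF (n k : nat) : R :=
  (2 * n.+1)`!%:R * (2 * n.+1)%:R ^+ (2 * k) / (2 * n.+1 + 2 * k)`!%:R.

(** [1 + factc n k] is the quotient of [factF n k] by [factF n k.+1], that is (1 + (2k + 1) e) (1 +
    (2k + 2) e). *)
Definition factc (n k : nat) : R := let e := (2 * n.+1)%:R^-1 in
  (4 * k%:R + 3) * e + (2 * k%:R + 1) * (2 * k%:R + 2) * e ^+ 2.

(** The discrete form of the equation f' = - 2 x f satisfied by exp(- x^2). *)
Lemma fdiff_factF n : D (factF n) = (fun k => - (factc n k * factF n k.+1)).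
Proof.
apply/funext => k; rewrite /fdiff /factF /factc.
have -> : (2 * n.+1 + 2 * k.+1 = (2 * n.+1 + 2 * k).+2)%N by lia.
have -> : (2 * k.+1 = (2 * k).+2)%N by lia.
have eq : 2 * k%:R = (2 * k)%:R :> R by rewrite natrM.
have eq4 : 4 * k%:R = 2 * (2 * k)%:R :> R by rewrite natrM; ring.
have m0 : (2 * n.+1)%:R != 0 :> R by rewrite pnatr_eq0.
rewrite eq eq4; move: (2 * n.+1)%N (2 * k)%N m0 => m q m0.
have f0 : (m + q)`!%:R != 0 :> R by rewrite pnatr_eq0 -lt0n fact_gt0.
have a0 : (m + q).+1%:R != 0 :> R by rewrite pnatr_eq0.
have b0 : (m + q).+2%:R != 0 :> R by rewrite pnatr_eq0.
have -> : (m + q).+2`! = ((m + q).+2 * (m + q).+1 * (m + q)`!)%N by rewrite !factS mulnA.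
rewrite !natrM !exprS.
move: ((m + q)`!%:R) (m`!%:R) f0 => f g f0.
move: a0 b0; rewrite -[(m + q).+2%:R]natr1 -[(m + q).+1%:R]natr1 natrD => a0 b0.
field.
by rewrite f0 a0 b0 m0.
Qed.

Definition rootS (n : nat) : R := Num.sqrt n.+1%:R.

Lemma rootS_gt0 n : 0 < rootS n. Proof. by rewrite sqrtr_gt0 ltr0n. Qed.

Lemma cvg_rootSV : (fun n => (rootS n)^-1) @ \oo --> 0.
Proof.
have -> : (fun n => (rootS n)^-1) = (fun n => Num.sqrt (@harmonic R n)).
  by apply/funext => n; rewrite /rootS /harmonic /= sqrtrV.
have -> : 0 = Num.sqrt 0 :> R by rewrite sqrtr0.
by apply: continuous_cvg; [exact: sqrt_continuous | exact: cvg_harmonic].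
Qed.

(** With N = n + 1, [factc n k] is about 2 k / N, which is 2 x / sqrt N for x = k / sqrt N. The
    extra power of [rootS] removes this 1 / sqrt N, and the limits are the derivatives of 2 x at
    0. *)
Lemma factc_scaled j k :
  (fun n => rootS n ^+ j.+1 * iter j D (factc n) k) @ \oo --> (if j == 1%N then 2 else 0 : R).
Proof.
pose i n := (rootS n)^-1.
have i0 n : i n != 0 by rewrite invr_neq0 // gt_eqF // rootS_gt0.
have ie n : (2 * n.+1)%:R^-1 = i n ^+ 2 / 2 :> R.
  by rewrite /i exprVn sqr_sqrtr // natrM invfM mulrC.
have si n : rootS n = (i n)^-1 by rewrite /i invrK.
have ci : i @ \oo --> 0 := cvg_rootSV.
have cpoly (a b c : R) : (fun n => a + b * i n + c * i n * i n) @ \oo --> a.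
  rewrite -[X in _ --> X]addr0 -[X in _ --> _ + X](mulr0 (c * 0)).
  rewrite -[X in _ --> X + _]addr0 -[X in _ --> _ + X + _](mulr0 b).
  apply: cvgD; first (apply: cvgD; first exact: cvg_cst).
    by apply: cvgM => //; exact: cvg_cst.
  by apply: cvgM => //; apply: cvgM => //; exact: cvg_cst.
have e0 n a : factc n a = (4 * a%:R + 3) * (i n ^+ 2 / 2) + (2 * a%:R + 1) * (2 * a%:R + 2) * (i n ^+ 2 / 2) ^+ 2.
  by rewrite /factc ie.
have e1 n a : D (factc n) a = 4 * (i n ^+ 2 / 2) + (8 * a%:R + 10) * (i n ^+ 2 / 2) ^+ 2.
  by rewrite /fdiff !e0 -natr1; ring.
have e2 n a : D (D (factc n)) a = 8 * (i n ^+ 2 / 2) ^+ 2.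
  by rewrite {1}/fdiff !e1 -natr1; ring.
have e3 n : D (D (D (factc n))) = fun=> 0.
  by apply/funext => m; rewrite {1}/fdiff !e2 subrr.
case: j => [|[|[|j]]] /=.
- have -> : (fun n => rootS n ^+ 1 * factc n k) = (fun n => i n * (((4 * k%:R + 3) / 2) + 0 * i n +
     ((2 * k%:R + 1) * (2 * k%:R + 2) / 4) * i n * i n)).
    by apply/funext => n; rewrite e0 si; field; rewrite i0.
  rewrite -[X in _ --> X](mul0r ((4 * k%:R + 3) / 2)).
  by apply: cvgM => //; exact: cpoly.
- have -> : (fun n => rootS n ^+ 2 * D (factc n) k) = (fun n => 2 + 0 * i n + ((8 * k%:R + 10) / 4) * i n * i n).
    by apply/funext => n; rewrite e1 si; field; rewrite i0.
  exact: cpoly.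
- have -> : (fun n => rootS n ^+ 3 * D (D (factc n)) k) = (fun n => 0 + 2 * i n + 0 * i n * i n).
    by apply/funext => n; rewrite e2 si; field; rewrite i0.
  exact: cpoly.
have -> : (fun n => rootS n ^+ j.+4 * D (D (D (iter j D (factc n)))) k) = fun=> 0.
  apply/funext => n; rewrite -!iterS -[j.+3]addn3 iterD /= e3.
  have : forall m, iter j D (fun=> 0) m = 0.
    elim: j => [//|j IH] m; by rewrite iter_fdiffS !IH subrr.
  by move=> ->; rewrite mulr0.
exact: cvg_cst.
Qed.

(** Strong induction on p. For p = 0, [factF n 0] is 1 and consecutive quotients tend to 1. For p +
    1, the Leibniz rule in [fdiff_factF] keeps only the first difference of [factc] in the limit and
    yields the recursion H_(p+1) = - 2 p H_(p-1). *)
Lemma factF_scaled : scaled_cvg rootS factF (hermite0 R).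
Proof.
move=> p; have [N] := ubnP p; elim: N p => // N IH [_|p pN] k.
  rewrite hermite00.
  have -> : (fun n => rootS n ^+ 0 * iter 0 D (factF n) k) = (fun n => factF n k).
    by apply/funext => n; rewrite mul1r.
  elim: k => [|k IHk].
    have -> : (fun n => factF n 0) = fun=> 1.
      by apply/funext => n; rewrite /factF muln0 addn0 expr0 mulr1 divff //.
    exact: cvg_cst.
  have cpos n : 0 <= factc n k by rewrite /factc addr_ge0 ?mulr_ge0 ?addr_ge0 ?mulr_ge0 ?exprn_ge0 ?invr_ge0 ?ler0n.
  have -> : (fun n => factF n k.+1) = (fun n => factF n k * (1 + factc n k)^-1).
    apply/funext => n; have := congr1 (fun f => f k) (fdiff_factF n).
    rewrite /fdiff /= => e.
    have -> : factF n k = factF n k.+1 * (1 + factc n k) by lra.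
    by rewrite mulfK //; have := cpos n; lra.
  rewrite [X in _ --> X](_ : _ = 1 * (1 + 0)^-1 :> R); last by rewrite addr0 invr1 mulr1.
  apply: cvgM => //; apply: cvgV; first by rewrite addr0 oner_neq0.
  apply: cvgD; first exact: cvg_cst.
  have -> : (fun n => factc n k) = (fun n => (rootS n)^-1 * (rootS n ^+ 1 * factc n k)).
    by apply/funext => n; rewrite expr1 mulKf // gt_eqF // rootS_gt0.
  rewrite -[X in _ --> X](mulr0 0).
  by apply: cvgM; [exact: cvg_rootSV | exact: (@factc_scaled 0 k)].
have -> : (fun n => rootS n ^+ p.+1 * iter p.+1 D (factF n) k) =
  (fun n => \sum_(j < p.+1) (- 'C(p, j)%:R) * (rootS n ^+ j.+1 * iter j D (factc n) k) *
    (rootS n ^+ (p - j)%N * iter (p - j)%N D (factF n) (k + j).+1)).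
  apply/funext => n; rewrite iterSr fdiff_factF.
  have eN (f : nat -> R) q m : iter q D (fun k => - f k) m = - iter q D f m.
    by elim: q m => [//|q IHq] m; rewrite !iter_fdiffS !IHq; ring.
  have eS (f : nat -> R) q m : iter q D (fun k => f k.+1) m = iter q D f m.+1.
    by elim: q m => [//|q IHq] m; rewrite !iter_fdiffS !IHq.
  rewrite eN iter_fdiffM mulrN -mulNr big_distrr /=; apply: eq_bigr => j _.
  have jp : (j <= p)%N by rewrite -ltnS.
  rewrite eS -{1}(subnKC jp) -addSn exprD.
  by move: (iter _ _ _ _) (iter _ _ _ _) => a b; ring.
have -> : hermite0 R p.+1 = \sum_(j < p.+1) (- 'C(p, j)%:R) * (if j == 1%N :> nat then 2 else 0) * hermite0 R (p - j).
  case: p {pN} => [|p]; first by rewrite big_ord1 hermite01 /= mulr0 mul0r.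
  rewrite big_ord_recl big_ord_recl /= mulr0 mul0r add0r big1 ?addr0; last first.
    by move=> i _; rewrite mulr0 mul0r.
  by rewrite /bump /= bin1 subn1 /= hermite0SS; ring.
apply: cvg_big => [|j _]; first exact: add_continuous.
apply: cvgM; last by apply: IH; lia.
by apply: cvgM; [exact: cvg_cst | exact: factc_scaled].
Qed.

End ScaledDifferences.

(** * Entire functions *)

Section Goursat.
Variable R : realType.
Implicit Types (f g : R -> R) (A B : R -> R -> R).
Local Notation mu := (@lebesgue_measure R).

Lemma quarter_le (c x y z w : R) : c <= (x + y) + (z + w) ->
  [\/ c <= 4 * x, c <= 4 * y, c <= 4 * z | c <= 4 * w].
Proof.
move=> h; have [h1|h1] := leP c (4 * x); first by constructor 1.
have [h2|h2] := leP c (4 * y); first by constructor 2.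
have [h3|h3] := leP c (4 * z); first by constructor 3.
by constructor 4; lra.
Qed.

Definition segint f a b : R := \int[mu]_(x in `[a, b]) f x.

Lemma continuous_segint f a b : continuous f -> mu.-integrable `[a, b] (EFin \o f).
Proof.
move=> cf; apply: continuous_compact_integrable; first exact: segment_compact.
exact: continuous_subspaceT.
Qed.

Lemma segint_cat f a b c : continuous f -> a <= b -> b <= c ->
  segint f a c = segint f a b + segint f b c.
Proof.
move=> cf ab bc; rewrite /segint.
have h := @Rintegral_itvB R f (BLeft a) (BRight c) b (continuous_segint a c cf).
rewrite -[X in _ = _ + X]Rintegral_itv_obnd_cbnd; last first.
  apply: integrableS (continuous_segint b c cf) => //.
  exact: subset_itv_oc_cc.
by rewrite -h ?bnd_simp //; ring.
Qed.

Lemma segintD f g a b : continuous f -> continuous g ->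
  segint (fun x => f x + g x) a b = segint f a b + segint g a b.
Proof. by move=> cf cg; apply: RintegralD => //; exact: continuous_segint. Qed.

Lemma segintB f g a b : continuous f -> continuous g ->
  segint (fun x => f x - g x) a b = segint f a b - segint g a b.
Proof. by move=> cf cg; apply: RintegralB => //; exact: continuous_segint. Qed.

Lemma eq_segint f g a b : (forall x, a <= x <= b -> f x = g x) -> segint f a b = segint g a b.
Proof. by move=> e; apply: eq_Rintegral => x; rewrite inE /= in_itv /= => /e. Qed.

Lemma segint_cst (r a b : R) : a <= b -> segint (fun=> r) a b = r * (b - a).
Proof.
move=> ab; rewrite /segint Rintegral_cst; last exact: measurable_itv.
congr (_ * _); have := @lebesgue_measure_itv R `[a, b]; rewrite /= lte_fin => ->.
case: ltP => //= ba; have -> : b = a by apply/eqP; rewrite eq_le ab ba.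
by rewrite subrr.
Qed.

Lemma segint_bound f a b M : continuous f -> a <= b ->
  (forall x, a <= x <= b -> `|f x| <= M) -> `|segint f a b| <= M * (b - a).
Proof.
move=> cf ab fM; rewrite -(segint_cst M ab).
apply: le_trans (le_normr_Rintegral _ (continuous_segint a b cf)) _ => //.
apply: le_Rintegral => //.
- by apply/integrable_norm/continuous_segint.
- by apply: continuous_segint => x; exact: cvg_cst.
Qed.

Lemma segint_approx f a b k e : continuous f -> a <= b ->
  (forall x, a <= x <= b -> `|f x - k| <= e) ->
  `|segint f a b - k * (b - a)| <= e * (b - a).
Proof.
move=> cf ab h; rewrite -(segint_cst k ab) -segintB //; last by move=> x; exact: cvg_cst.
apply: segint_bound => // x; apply: continuousB; [exact: cf | exact: cvg_cst].
Qed.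

Definition has_diff2 A u v a b := forall e, 0 < e -> exists2 d, 0 < d &
  forall du dv, `|du| < d -> `|dv| < d ->
    `|A (u + du) (v + dv) - A u v - (a * du + b * dv)| <= e * (`|du| + `|dv|).

(* The integral of the form [A du + B dv] along the boundary of a rectangle. *)
Definition circulation A B u0 u1 v0 v1 : R :=
  segint (fun u => A u v0 - A u v1) u0 u1 + segint (fun v => B u1 v - B u0 v) v0 v1.

Lemma has_diff2_cts A : (forall u v, exists a b, has_diff2 A u v a b) ->
  (forall v, continuous (fun u => A u v)) /\ (forall u, continuous (A u)).
Proof.
move=> hA; have key u v (e : R) : 0 < e -> exists2 d, 0 < d &
    forall du dv, `|du| < d -> `|dv| < d -> `|A (u + du) (v + dv) - A u v| < e.
  move=> e0; have [a [b /(_ 1 ltr01)[d d0 hd]]] := hA u v.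
  pose K := `|a| + `|b| + 2 * 1.
  have K0 : 0 < K by rewrite /K; have := normr_ge0 a; have := normr_ge0 b; lra.
  exists (Num.min d (e / (2 * K))); first by rewrite lt_min d0 divr_gt0 // mulr_gt0.
  move=> du dv; rewrite !lt_min => /andP[h1 h2] /andP[h3 h4].
  have := hd du dv h1 h3; rewrite mul1r => h.
  have : `|A (u + du) (v + dv) - A u v| <=
      `|A (u + du) (v + dv) - A u v - (a * du + b * dv)| + (`|a| * `|du| + `|b| * `|dv|).
    rewrite -{1}[A (u + du) (v + dv) - A u v](subrK (a * du + b * dv)).
    apply: le_trans (ler_normD _ _) _; rewrite lerD2l -!normrM; exact: ler_normD.
  move=> h'.
  have h5 : K * `|du| < e / 2.
    by rewrite mulrC -ltr_pdivlMr // -mulrA -invfM.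
  have h6 : K * `|dv| < e / 2.
    by rewrite mulrC -ltr_pdivlMr // -mulrA -invfM.
  have := normr_ge0 a; have := normr_ge0 b; have := normr_ge0 du; have := normr_ge0 dv.
  rewrite /K in h5 h6; nra.
split=> w; move=> x; apply/cvgrPdist_lt => e e0.
  have [d d0 hd] := key x w e e0.
  near=> t; rewrite distrC; have := hd (t - x) 0; rewrite subrKC addr0; apply.
    by near: t; apply: cvgr_distC_lt => //; exact: cvg_id.
  by rewrite normr0.
have [d d0 hd] := key w x e e0.
near=> t; rewrite distrC; have := hd 0 (t - x); rewrite subrKC addr0; apply.
  by rewrite normr0.
by near: t; apply: cvgr_distC_lt => //; exact: cvg_id.
Unshelve. all: by end_near. Qed.

Section Closed.
Variables (A B : R -> R -> R).
(** The shared [b] expresses A_v = B_u. The partial derivatives need not be continuous, whence the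
    bisection instead of Green's formula. *)
Hypothesis closed : forall u v, exists a b d, has_diff2 A u v a b /\ has_diff2 B u v b d.

Let cA : (forall v, continuous (fun u => A u v)) /\ (forall u, continuous (A u)).
Proof. by apply: has_diff2_cts => u v; have [a [b [d [? _]]]] := closed u v; exists a, b. Qed.
Let cB : (forall v, continuous (fun u => B u v)) /\ (forall u, continuous (B u)).
Proof. by apply: has_diff2_cts => u v; have [a [b [d [_ ?]]]] := closed u v; exists b, d. Qed.

Let cA2 v v' : continuous (fun u => A u v - A u v').
Proof. by move=> x; apply: continuousB; exact: cA.1. Qed.
Let cB2 u u' : continuous (fun v => B u v - B u' v).
Proof. by move=> x; apply: continuousB; exact: cB.2. Qed.

Lemma circulation_splitu u0 um u1 v0 v1 : u0 <= um -> um <= u1 ->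
  circulation A B u0 u1 v0 v1 = circulation A B u0 um v0 v1 + circulation A B um u1 v0 v1.
Proof.
move=> h1 h2; rewrite /circulation (segint_cat (@cA2 _ _) h1 h2).
rewrite (eq_segint (f := fun v => B u1 v - B u0 v) (g := fun v => (B um v - B u0 v) + (B u1 v - B um v))).
  by rewrite (segintD _ _ (@cB2 _ _) (@cB2 _ _)); ring.
by move=> x _; ring.
Qed.

Lemma circulation_splitv u0 u1 v0 vm v1 : v0 <= vm -> vm <= v1 ->
  circulation A B u0 u1 v0 v1 = circulation A B u0 u1 v0 vm + circulation A B u0 u1 vm v1.
Proof.
move=> h1 h2; rewrite /circulation (segint_cat (@cB2 _ _) h1 h2).
rewrite (eq_segint (f := fun u => A u v0 - A u v1) (g := fun u => (A u v0 - A u vm) + (A u vm - A u v1))).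
  by rewrite (segintD _ _ (@cA2 _ _) (@cA2 _ _)); ring.
by move=> x _; ring.
Qed.

(** The affine part of the form contributes - b p q + b p q = 0; only the error terms remain, each
    integrand being a difference of two values known up to (e / 2)(p + q). *)
Lemma circulation_small us vs e : 0 < e -> exists2 d, 0 < d &
  forall u0 v0 p q, 0 <= p -> 0 <= q -> u0 <= us <= u0 + p -> v0 <= vs <= v0 + q ->
    p < d -> q < d ->
  `|circulation A B u0 (u0 + p) v0 (v0 + q)| <= e * (p + q) ^+ 2.
Proof.
move=> e0; have [a [b [d [hA hB]]]] := closed us vs.
have e20 : 0 < e / 2 by rewrite divr_gt0.
have [d1 d10 h1] := hA _ e20; have [d2 d20 h2] := hB _ e20.
exists (Num.min d1 d2); first by rewrite lt_min d10.
move=> u0 v0 p q p0 q0 hu hv; rewrite !lt_min => /andP[p1 p2] /andP[q1 q2].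
have HA u v : u0 <= u <= u0 + p -> v0 <= v <= v0 + q ->
    `|A u v - A us vs - (a * (u - us) + b * (v - vs))| <= e / 2 * (p + q).
  move=> hu' hv'; have nu : `|u - us| <= p by rewrite ler_norml; lra.
  have nv : `|v - vs| <= q by rewrite ler_norml; lra.
  have := h1 (u - us) (v - vs); rewrite !subrKC => /(_ (le_lt_trans nu p1) (le_lt_trans nv q1)).
  move/le_trans; apply; rewrite ler_pM2l //; exact: lerD.
have HB u v : u0 <= u <= u0 + p -> v0 <= v <= v0 + q ->
    `|B u v - B us vs - (b * (u - us) + d * (v - vs))| <= e / 2 * (p + q).
  move=> hu' hv'; have nu : `|u - us| <= p by rewrite ler_norml; lra.
  have nv : `|v - vs| <= q by rewrite ler_norml; lra.
  have := h2 (u - us) (v - vs); rewrite !subrKC => /(_ (le_lt_trans nu p2) (le_lt_trans nv q2)).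
  move/le_trans; apply; rewrite ler_pM2l //; exact: lerD.
have hup : u0 <= u0 + p by rewrite lerDl.
have hvq : v0 <= v0 + q by rewrite lerDl.
have I1 := @segint_approx (fun u => A u v0 - A u (v0 + q)) u0 (u0 + p) (- (b * q)) (e * (p + q)) (@cA2 _ _) hup.
have I2 := @segint_approx (fun v => B (u0 + p) v - B u0 v) v0 (v0 + q) (b * p) (e * (p + q)) (@cB2 _ _) hvq.
have {}I1 : `|segint (fun u => A u v0 - A u (v0 + q)) u0 (u0 + p) + b * q * p| <= e * (p + q) * p.
  have pe : u0 + p - u0 = p by ring.
  rewrite pe mulNr !opprK in I1; apply: I1 => x hx.
  have r1 : v0 <= v0 <= v0 + q by rewrite lexx.
  have r2 : v0 <= v0 + q <= v0 + q by rewrite lexx hvq.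
  have := HA x v0 hx r1; have := HA x (v0 + q) hx r2.
  rewrite !ler_norml; lra.
have {}I2 : `|segint (fun v => B (u0 + p) v - B u0 v) v0 (v0 + q) - b * p * q| <= e * (p + q) * q.
  have qe : v0 + q - v0 = q by ring.
  rewrite qe in I2; apply: I2 => x hx.
  have r1 : u0 <= u0 <= u0 + p by rewrite lexx.
  have r2 : u0 <= u0 + p <= u0 + p by rewrite lexx hup.
  have := HB u0 x r1 hx; have := HB (u0 + p) x r2 hx.
  rewrite !ler_norml; lra.
rewrite /circulation; move: I1 I2; rewrite !ler_norml; lra.
Qed.

Lemma circulation_bisect u v p q : 0 <= p -> 0 <= q -> exists u' v',
  [/\ u <= u', u' + p / 2 <= u + p, v <= v', v' + q / 2 <= v + q &
  `|circulation A B u (u + p) v (v + q)| <=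
    4 * `|circulation A B u' (u' + p / 2) v' (v' + q / 2)|].
Proof.
move=> p0 q0.
have hp : (u <= u + p / 2) /\ (u + p / 2 <= u + p) by lra.
have hq : (v <= v + q / 2) /\ (v + q / 2 <= v + q) by lra.
have ep : u + p = (u + p / 2) + p / 2 by lra.
have eq : v + q = (v + q / 2) + q / 2 by lra.
pose c1 := circulation A B u (u + p / 2) v (v + q / 2).
pose c2 := circulation A B u (u + p / 2) (v + q / 2) (v + q / 2 + q / 2).
pose c3 := circulation A B (u + p / 2) (u + p / 2 + p / 2) v (v + q / 2).
pose c4 := circulation A B (u + p / 2) (u + p / 2 + p / 2) (v + q / 2) (v + q / 2 + q / 2).
set c := `| _ |.
have hc : c <= (`|c1| + `|c2|) + (`|c3| + `|c4|).
  rewrite /c (circulation_splitu _ _ hp.1 hp.2) !(circulation_splitv _ _ hq.1 hq.2).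
  rewrite ep eq -/c1 -/c2 -/c3 -/c4.
  apply: le_trans (ler_normD _ _) _; apply: lerD; exact: ler_normD.
have [hp1 hp2] := hp; have [hq1 hq2] := hq.
have [h|h|h|h] := quarter_le hc.
- by exists u, v; split.
- by exists u, (v + q / 2); split => //; rewrite eq.
- by exists (u + p / 2), v; split => //; rewrite ep.
- by exists (u + p / 2), (v + q / 2); split => //; [rewrite ep | rewrite eq].
Qed.

Theorem Goursat u v p q : 0 <= p -> 0 <= q -> circulation A B u (u + p) v (v + q) = 0.
Proof.
move=> p0 q0; apply/eqP; rewrite -normr_le0 leNgt; apply/negP.
set c := `| _ | => c0.
pose P (k : nat) (x : R * R) := c <= 4 ^+ k * `|circulation A B x.1 (x.1 + p / 2 ^+ k) x.2 (x.2 + q / 2 ^+ k)|.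
pose N (k : nat) (x y : R * R) := [/\ x.1 <= y.1, y.1 + p / 2 ^+ k.+1 <= x.1 + p / 2 ^+ k,
  x.2 <= y.2 & y.2 + q / 2 ^+ k.+1 <= x.2 + q / 2 ^+ k].
have pk k : 0 <= p / 2 ^+ k by rewrite divr_ge0 // exprn_ge0.
have qk k : 0 <= q / 2 ^+ k by rewrite divr_ge0 // exprn_ge0.
have hS r k : r / 2 ^+ k.+1 = r / 2 ^+ k / 2 :> R by rewrite exprSr invfM mulrA.
have step (z : nat * (R * R)) : { y : nat * (R * R) |
    P z.1 z.2 -> [/\ y.1 = z.1.+1, P y.1 y.2 & N z.1 z.2 y.2] }.
  case: z => k [x1 x2] /=; apply: cid.
  have [u' [v' [h1 h2 h3 h4 h5]]] := circulation_bisect x1 x2 (pk k) (qk k).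
  exists (k.+1, (u', v')) => /= Pk; split => //; last by split; rewrite /= ?hS.
  rewrite /P /= !hS exprSr -mulrA; apply: le_trans Pk _.
  by rewrite /= ler_pM2l // exprn_gt0.
have [z [z0 zS]] := dependent_choice step (0%N, (u, v)).
have zP k : (z k).1 = k /\ P k (z k).2.
  elim: k => [|k [e Pk]]; first by rewrite z0 /P /= !expr0 !divr1 mul1r.
  by have := zS k; rewrite e => /(_ Pk) [-> ].
have zN k : N k (z k).2 (z k.+1).2.
  by have [e Pk] := zP k; have := zS k; rewrite e => /(_ Pk)[].
have lim (f : nat -> R) (r : nat -> R) : (forall k, f k <= f k.+1) ->
    (forall k, f k.+1 + r k.+1 <= f k + r k) -> (forall k, 0 <= r k) ->
    exists x, forall k, f k <= x <= f k + r k.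
  move=> f1 f2 r0.
  have fm : {homo f : i j / (i <= j)%N >-> i <= j}.
    by apply: homo_leq => // x y w; exact: le_trans.
  have frm : {homo (fun k => f k + r k) : i j / (i <= j)%N >-> j <= i}.
    apply: homo_leq => // x y w h1 h2; exact: le_trans h2 h1.
  have ub k : ubound (range f) (f k + r k).
    move=> _ [j _ <-]; have [kj|jk] := leqP k j.
      by apply: le_trans (frm _ _ kj); rewrite lerDl.
    by apply: le_trans (fm _ _ (ltnW jk)) _; rewrite lerDl.
  exists (sup (range f)) => k; apply/andP; split.
    by apply: ub_le_sup; [exists (f 0%N + r 0%N) | exists k].
  by apply: ge_sup => //; exists (f 0%N), 0%N.
have [us hus] : exists x, forall k, (z k).2.1 <= x <= (z k).2.1 + p / 2 ^+ k.
  by apply: lim => // k; have [] := zN k.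
have [vs hvs] : exists x, forall k, (z k).2.2 <= x <= (z k).2.2 + q / 2 ^+ k.
  by apply: lim => // k; have [] := zN k.
(* The factor 4^k gained in k bisections is exactly offset by the squared side lengths, leaving e (p
   + q)^2, which this choice makes smaller than c. The 1 covers p = q = 0. *)
pose e := c / (2 * (p + q + 1) ^+ 2).
have pq0 : 0 < p + q + 1 by lra.
have e0 : 0 < e by rewrite divr_gt0 // mulr_gt0 // exprn_gt0.
have [d d0 hd] := circulation_small us vs e0.
have [k hk] : exists k : nat, (p + q + 1) / 2 ^+ k < d.
  have : (fun k => (p + q + 1) * (2^-1) ^+ k) @ \oo --> (p + q + 1) * 0.
    apply: cvgM; first exact: cvg_cst.
    by apply: cvg_expr; rewrite ger0_norm ?invr_ge0 // invf_lt1 // ltr1n.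
  rewrite mulr0 => /cvgr_lt /(_ _ d0) [k _ /(_ k (leqnn k))] /=.
  by exists k; rewrite -exprVn.
have i0 : 0 < (2 ^+ k)^-1 :> R by rewrite invr_gt0 exprn_gt0.
have pd : p / 2 ^+ k < d by apply: le_lt_trans hk; rewrite ler_pM2r //; lra.
have qd : q / 2 ^+ k < d by apply: le_lt_trans hk; rewrite ler_pM2r //; lra.
have := hd _ _ _ _ (pk k) (qk k) (hus k) (hvs k) pd qd.
have [_ Pk] := zP k; rewrite -mulrDl exprMn => h.
have : c <= 4 ^+ k * (e * ((p + q) ^+ 2 * (2 ^+ k)^-1 ^+ 2)).
  by apply: le_trans Pk _; rewrite ler_pM2l // exprn_gt0.
have -> : 4 ^+ k * (e * ((p + q) ^+ 2 * (2 ^+ k)^-1 ^+ 2)) = e * (p + q) ^+ 2.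
  have -> : 4 = 2 ^+ 2 :> R by ring.
  by rewrite -exprM mulnC exprM; field; rewrite expf_neq0.
rewrite leNgt => /negP; apply.
rewrite /e mulrAC ltr_pdivrMr ?mulr_gt0 ?exprn_gt0 // ltr_pM2l //.
have : 0 <= p + q by lra.
nra.
Qed.

End Closed.
End Goursat.

Lemma eq_ler (R : numDomainType) (x y : R) : x = y -> x <= y.
Proof. by move=> ->. Qed.

(** * Complex differentiability and the exponential *)

Section ComplexDifferentiation.
Import Normc.
Local Open Scope complex_scope.
Variable R : realType.
Implicit Types (f g : R[i] -> R[i]) (z w h d : R[i]).

(** Differentiability with a real modulus and without division by h, so that h = 0 is no exception;
    [entire_centire] links it to [entire]. *)
Definition cdiff_at f z d := forall e : R, 0 < e -> exists2 r : R, 0 < r &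
  forall h, normc h < r -> normc (f (z + h) - f z - d * h) <= e * normc h.

Lemma normc_triangle z w : normc (z + w) <= normc z + normc w.
Proof. exact: le_normcD. Qed.

Lemma normc_opp z : normc (- z) = normc z.
Proof. exact: normcN. Qed.

Lemma normc_ge0 z : 0 <= normc z.
Proof. by case: z => a b; exact: sqrtr_ge0. Qed.

Lemma Re_le_normc z : `|complex.Re z| <= normc z.
Proof.
case: z => a b /=; rewrite -sqrtr_sqr ler_wsqrtr // lerDl; exact: sqr_ge0.
Qed.

Lemma Im_le_normc z : `|complex.Im z| <= normc z.
Proof.
case: z => a b /=; rewrite -sqrtr_sqr ler_wsqrtr // lerDr; exact: sqr_ge0.
Qed.

Lemma normc_le_ReIm z : normc z <= `|complex.Re z| + `|complex.Im z|.
Proof.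
case: z => a b /=; rewrite -(ger0_norm (x := `|a| + `|b|)) ?addr_ge0 //.
rewrite -sqrtr_sqr ler_wsqrtr // sqrrD !real_normK ?num_real //.
by rewrite addrAC lerDl mulrn_wge0 // mulr_ge0.
Qed.

Lemma normc_gt0 z : (0 < normc z) = (z != 0).
Proof.
rewrite lt_neqAle normc_ge0 andbT eq_sym; congr (~~ _); apply/eqP/eqP => [|->].
  exact: eq0_normc.
exact: normc0.
Qed.

Lemma normc_real (a : R) : normc a%:C = `|a|.
Proof. by rewrite /= expr0n addr0 sqrtr_sqr. Qed.

Lemma cdiff_at_lip f z d : cdiff_at f z d ->
  exists2 r : R, 0 < r & forall h, normc h < r -> normc (f (z + h) - f z) <= (normc d + 1) * normc h.
Proof.
move=> /(_ 1 ltr01)[r r0 hr]; exists r => // h /hr.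
rewrite mul1r => h1; rewrite -[_ - f z](subrK (d * h)).
by apply: le_trans (normc_triangle _ _) _; rewrite normcM addrC mulrDl mul1r lerD2l.
Qed.

Lemma cdiff_cst c z : cdiff_at (fun=> c) z 0.
Proof.
move=> e e0; exists 1 => // h _.
by rewrite mul0r subr0 subrr normc0 mulr_ge0 ?normc_ge0 // ltW.
Qed.

Lemma cdiff_id z : cdiff_at id z 1.
Proof.
move=> e e0; exists 1 => // h _.
have -> : z + h - z - 1 * h = 0 by ring.
by rewrite normc0 mulr_ge0 ?normc_ge0 // ltW.
Qed.

Lemma cdiffD f g z d d' : cdiff_at f z d -> cdiff_at g z d' ->
  cdiff_at (fun x => f x + g x) z (d + d').
Proof.
move=> hf hg e e0; have e2 : 0 < e / 2 by rewrite divr_gt0.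
have [r1 r10 h1] := hf _ e2; have [r2 r20 h2] := hg _ e2.
exists (Num.min r1 r2); first by rewrite lt_min r10.
move=> h; rewrite lt_min => /andP[/h1 {}h1 /h2 {}h2].
have -> : f (z + h) + g (z + h) - (f z + g z) - (d + d') * h =
  (f (z + h) - f z - d * h) + (g (z + h) - g z - d' * h) by ring.
by apply: le_trans (normc_triangle _ _) _; rewrite [e]splitr mulrDl lerD.
Qed.

Lemma cdiffM f g z d d' : cdiff_at f z d -> cdiff_at g z d' ->
  cdiff_at (fun x => f x * g x) z (d * g z + f z * d').
Proof.
move=> hf hg e e0.
pose K := normc (g z) + (normc d + 1) * (normc d' + 1) + normc (f z) + 1.
have K0 : 0 < K.
  rewrite /K; have := normc_ge0 (g z); have := normc_ge0 (f z).
  by have := normc_ge0 d; have := normc_ge0 d'; nra.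
have eK : 0 < e / K by rewrite divr_gt0.
have [r1 r10 h1] := hf _ eK; have [r2 r20 h2] := hg _ eK.
have [r3 r30 h3] := cdiff_at_lip hf; have [r4 r40 h4] := cdiff_at_lip hg.
exists (Num.min (Num.min r1 r2) (Num.min (Num.min r3 r4) (e / K))).
  by rewrite !lt_min r10 r20 r30 r40.
move=> h; rewrite !lt_min => /andP[/andP[/h1 {}h1 /h2 {}h2] /andP[/andP[/h3 {}h3 /h4 {}h4] h5]].
have -> : f (z + h) * g (z + h) - f z * g z - (d * g z + f z * d') * h =
  (f (z + h) - f z - d * h) * g z + (f (z + h) - f z) * (g (z + h) - g z)
  + f z * (g (z + h) - g z - d' * h) by ring.
apply: le_trans (normc_triangle _ _) _; apply: le_trans (lerD (normc_triangle _ _) (lexx _)) _.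
rewrite !normcM.
have hn := normc_ge0 h.
have m1 : normc (f (z + h) - f z) * normc (g (z + h) - g z) <=
    ((normc d + 1) * normc h) * ((normc d' + 1) * normc h).
  by apply: ler_pM => //; exact: normc_ge0.
have m2 : ((normc d + 1) * normc h) * ((normc d' + 1) * normc h) <=
    ((normc d + 1) * (normc d' + 1)) * (e / K) * normc h.
  rewrite [leLHS](_ : _ = ((normc d + 1) * (normc d' + 1)) * normc h * normc h); last by ring.
  apply: ler_wpM2r => //; apply: ler_wpM2l; last exact: ltW.
  by apply: mulr_ge0; apply: addr_ge0 => //; exact: normc_ge0.
have m3 := ler_wpM2r (normc_ge0 (g z)) h1.
have m4 := ler_wpM2l (normc_ge0 (f z)) h2.
have -> : e * normc h = K * (e / K) * normc h by rewrite mulrCA divff ?mulr1 // gt_eqF.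
have : 0 <= e / K * normc h by rewrite mulr_ge0 // ltW.
by rewrite /K; lra.
Qed.

Lemma cdiff_comp f g z d d' : cdiff_at f z d -> cdiff_at g (f z) d' ->
  cdiff_at (g \o f) z (d' * d).
Proof.
move=> hf hg e e0.
pose K := normc d + 1 + normc d' + 1.
have K0 : 0 < K by rewrite /K; have := normc_ge0 d; have := normc_ge0 d'; lra.
have eK : 0 < e / K by rewrite divr_gt0.
have [r1 r10 h1] := hf _ eK; have [r2 r20 h2] := hg _ eK.
have [r3 r30 h3] := cdiff_at_lip hf.
have d1 : 0 < normc d + 1 by have := normc_ge0 d; lra.
exists (Num.min r1 (Num.min r3 (r2 / (normc d + 1)))).
  by rewrite !lt_min r10 r30 divr_gt0.
move=> h; rewrite !lt_min => /and3P[/h1 {}h1 /h3 {}h3 h4].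
set k := f (z + h) - f z in h1 h3.
have fk : f (z + h) = f z + k by rewrite /k; ring.
have kr : normc k < r2.
  by apply: le_lt_trans h3 _; rewrite mulrC -ltr_pdivlMr.
rewrite /= fk.
have -> : g (f z + k) - g (f z) - d' * d * h =
  (g (f z + k) - g (f z) - d' * k) + d' * (k - d * h) by ring.
apply: le_trans (normc_triangle _ _) _; rewrite normcM.
have {}h2 := h2 _ kr.
have m1 := ler_wpM2l (normc_ge0 d') h1.
have m2 : e / K * normc k <= e / K * ((normc d + 1) * normc h) by rewrite ler_pM2l.
have -> : e * normc h = K * (e / K) * normc h by rewrite mulrCA divff ?mulr1 // gt_eqF.
have : 0 <= e / K * normc h by rewrite mulr_ge0 ?normc_ge0 // ltW.
by rewrite /K; lra.
Qed.

Lemma cdiff_ext f g z d : f =1 g -> cdiff_at f z d -> cdiff_at g z d.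
Proof. by move=> e; have -> : f = g by apply/funext. Qed.

Lemma real_diff (f : R -> R) (x df : R) : is_derive x 1 f df ->
  forall e : R, 0 < e -> exists2 r : R, 0 < r & forall t : R, `|t| < r ->
    `|f (x + t) - f x - df * t| <= e * `|t|.
Proof.
move=> [df1 df2] e e0.
have : (fun t : R => t^-1 *: (f (t *: 1 + x) - f x)) @ 0^' --> df.
  by rewrite -df2; exact: df1.
move=> /cvgrPdist_lt /(_ _ e0) [r /= r0 hr]; exists r => // t ht.
have [->|t0] := eqVneq t 0; first by rewrite addr0 subrr mulr0 subr0 normr0 mulr0.
have := hr t; rewrite /ball_ /= sub0r normrN => /(_ ht t0) /ltW.
rewrite -(ler_pM2r (x := `|t|)) ?normr_gt0 // -normrM distrC.
by rewrite mulrBl /GRing.scale /= mulr1 [t + x]addrC mulrAC mulVf // mul1r.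
Qed.

Lemma cexp0 : cexp (0 : R[i]) = 1.
Proof. by rewrite /cexp /= expR0 cos0 sin0 mulr1 mulr0. Qed.

Lemma cexpD z w : cexp (z + w) = cexp z * cexp w.
Proof.
case: z => a b; case: w => c d; rewrite /cexp /= expRD cosD sinD.
by apply/eqP; rewrite eq_complex /=; apply/andP; split; apply/eqP; ring.
Qed.

Lemma normc_cexp z : normc (cexp z) = expR (complex.Re z).
Proof.
case: z => a b; rewrite /cexp /= !exprMn -mulrDr cos2Dsin2 mulr1 sqrtr_sqr.
by rewrite ger0_norm // expR_ge0.
Qed.

(** Only the point 0 requires estimates; the addition formula carries the result to every other
    point in [cdiff_cexp]. *)
Lemma cdiff_cexp0 : cdiff_at (@cexp R) 0 1.
Proof.
move=> e e0; have e4 : 0 < e / 8 by rewrite divr_gt0.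
have [r1 r10 h1] := real_diff (is_derive_expR (0 : R)) e4.
have [r2 r20 h2] := real_diff (is_derive_cos (0 : R)) e4.
have [r3 r30 h3] := real_diff (is_derive_sin (0 : R)) e4.
have [r4 r40 h4] := real_diff (is_derive_expR (0 : R)) ltr01.
have [r5 [r50 r5e r5q]] : exists r5 : R, [/\ 0 < r5, r5 <= e / 8 & r5 <= 1 / 4].
  exists (Num.min (e / 8) (1 / 4)).
  by rewrite lt_min e4 divr_gt0 // !ge_min !lexx orbT.
exists (Num.min (Num.min r1 r2) (Num.min (Num.min r3 r4) r5)).
  by rewrite !lt_min r10 r20 r30 r40 r50.
move=> z; rewrite !lt_min => /andP[/andP[z1 z2] /andP[/andP[z3 z4] z5]].
have az := Re_le_normc z; have bz := Im_le_normc z.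
rewrite cexp0 add0r mul1r; apply: le_trans (normc_le_ReIm _) _.
move: az bz z1 z2 z3 z4 z5; case: z => a b; set n := normc _ => /= az bz z1 z2 z3 z4 z5.
have {h1} := h1 a (le_lt_trans az z1); have {h2} := h2 b (le_lt_trans bz z2).
have {h3} := h3 b (le_lt_trans bz z3); have {h4} := h4 a (le_lt_trans az z4).
rewrite !add0r expR0 cos0 sin0 oppr0 mul0r !subr0 !mul1r addr0 => h4 h3 h2 h1.
have a5 : `|a| < 1/4 by apply: le_lt_trans az (lt_le_trans z5 r5q).
have a6 : `|a| < e / 8 by apply: le_lt_trans az (lt_le_trans z5 r5e).
rewrite addr0.
have b1 : e / 8 * `|b| <= e / 8 * n by rewrite ler_pM2l.
have a1 : e / 8 * `|a| <= e / 8 * n by rewrite ler_pM2l.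
have E1 : `|expR a - 1| <= 2 * `|a|.
  move: h4; rewrite !ler_norml => /andP[]; have := ler_norm a; have := ler_norm (- a).
  rewrite normrN; lra.
have E2 : `|expR a| <= 2.
  by move: E1; rewrite !ler_norml => /andP[]; lra.
have R1 : `|expR a * cos b - 1 - a| <= 3 * (e / 8 * n).
  have -> : expR a * cos b - 1 - a = (expR a - 1 - a) + expR a * (cos b - 1) by ring.
  apply: le_trans (ler_normD _ _) _; rewrite normrM.
  have := ler_pM (normr_ge0 _) (normr_ge0 _) E2 h2; lra.
have R2 : `|expR a * sin b - b| <= 4 * (e / 8 * n).
  have -> : expR a * sin b - b = expR a * (sin b - b) + (expR a - 1) * b by ring.
  apply: le_trans (ler_normD _ _) _; rewrite !normrM.
  have := ler_pM (normr_ge0 _) (normr_ge0 _) E2 h3.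
  have := ler_pM (normr_ge0 _) (normr_ge0 _) E1 bz.
  have n0 : 0 <= n by apply: normc_ge0.
  have : `|a| * n <= e / 8 * n by rewrite ler_wpM2r // ltW.
  lra.
have n0 : 0 <= n by apply: normc_ge0.
have : 0 <= e / 8 * n by rewrite mulr_ge0 // ltW.
lra.
Qed.

Lemma cdiff_cexp z : cdiff_at (@cexp R) z (cexp z).
Proof.
have h1 : cdiff_at (@cexp R \o (fun x => x - z)) z (1 * (1 + 0)).
  apply: cdiff_comp; first by apply: cdiffD; [exact: cdiff_id | exact: cdiff_cst].
  by rewrite /= subrr; exact: cdiff_cexp0.
have := cdiffM (cdiff_cst (cexp z) z) h1.
rewrite mul0r add0r addr0 !mulr1; apply: cdiff_ext => x.
by rewrite -cexpD addrC subrK.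
Qed.

Definition centire f := forall z, exists d, cdiff_at f z d.

Lemma entire_centire f : entire f -> centire f.
Proof.
move=> hf z; have := hf z I; rewrite /derivable => /cvg_ex[d hd]; exists d => e e0.
have e0' : (0 : R[i]) < e%:C by rewrite ltcR.
move/cvgrPdist_lt: hd => /(_ _ e0') [r /= r0 hr].
have rr : r = (complex.Re r)%:C.
  by apply/eqP; rewrite eq_complex /= eqxx /= (ger0_Im (ltW r0)).
exists (complex.Re r); first by rewrite -ltcR -rr.
move=> h hh; have [->|h0] := eqVneq h 0.
  by rewrite addr0 subrr mulr0 subr0 normc0 mulr0.
have := hr h; rewrite /ball_ /= sub0r normrN.
have -> : (`|h| : R[i]) = (normc h)%:C by [].
rewrite [r]rr ltcR => /(_ hh h0).
rewrite /GRing.scale /= mulr1 => hlt.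
have {hlt} : normc (d - h^-1 * (f (h + z) - f z)) < e by rewrite -ltcR.
move/ltW; rewrite -(ler_pM2r (x := normc h)) ?normc_gt0 // -normcM => hle.
apply: le_trans hle; rewrite -normc_opp; apply: eq_ler; congr normc.
by rewrite mulrBl mulrAC mulVf // mul1r [h + z]addrC; ring.
Qed.

End ComplexDifferentiation.

(** * Unique continuation from a real ray *)

Section UniqueContinuation.
Import Normc.
Local Open Scope complex_scope.
Variable R : realType.
Implicit Types (f g : R[i] -> R[i]) (z w h d : R[i]).

Lemma centire_comp f g : centire f -> centire g -> centire (g \o f).
Proof.
move=> hf hg z; have [d hd] := hf z; have [d' hd'] := hg (f z).
by exists (d' * d); exact: cdiff_comp.
Qed.

Lemma centireM f g : centire f -> centire g -> centire (fun z => f z * g z).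
Proof.
move=> hf hg z; have [d hd] := hf z; have [d' hd'] := hg z.
by eexists; exact: (cdiffM hd hd').
Qed.

Lemma centireD f g : centire f -> centire g -> centire (fun z => f z + g z).
Proof.
move=> hf hg z; have [d hd] := hf z; have [d' hd'] := hg z.
by eexists; exact: (cdiffD hd hd').
Qed.

Lemma centire_cst c : centire (fun _ : R[i] => c).
Proof. by move=> z; eexists; exact: cdiff_cst. Qed.

Lemma centire_id : centire (@id R[i]).
Proof. by move=> z; eexists; exact: cdiff_id. Qed.

Lemma centire_cexp : centire (@cexp R).
Proof. by move=> z; eexists; exact: cdiff_cexp. Qed.

(** The Cauchy-Riemann equations; they make the form Im f du + Re f dv closed. *)
Lemma cdiff_diff2 f u v d : cdiff_at f (u +i* v) d ->
  has_diff2 (fun u v => complex.Re (f (u +i* v))) u v (complex.Re d) (- complex.Im d) /\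
  has_diff2 (fun u v => complex.Im (f (u +i* v))) u v (complex.Im d) (complex.Re d).
Proof.
move=> hf.
have key (e : R) : 0 < e -> exists2 r, 0 < r & forall du dv, `|du| < r -> `|dv| < r ->
    normc (f ((u + du) +i* (v + dv)) - f (u +i* v) - d * (du +i* dv)) <= e * (`|du| + `|dv|).
  move=> e0; have [r r0 hr] := hf e e0; exists (r / 2); first by rewrite divr_gt0.
  move=> du dv h1 h2; have hn := normc_le_ReIm (du +i* dv).
  have := hr (du +i* dv); rewrite /= in hn.
  have -> : u +i* v + du +i* dv = (u + du) +i* (v + dv) by [].
  move=> /(_ _)/le_trans; apply; first by apply: le_lt_trans hn _; rewrite /=; lra.
  by rewrite ler_pM2l.
split=> e e0; have [r r0 hr] := key e e0; exists r => // du dv h1 h2;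
  apply: le_trans (hr du dv h1 h2).
- apply: le_trans (Re_le_normc _); apply: eq_ler; congr `| _ |.
  case: (f _) => a b; case: (f _) => a' b'; case: (d) => x y /=; ring.
- apply: le_trans (Im_le_normc _); apply: eq_ler; congr `| _ |.
  case: (f _) => a b; case: (f _) => a' b'; case: (d) => x y /=; ring.
Qed.

(* Pulling back by the exponential, Goursat's theorem on the rectangles
   [[u, 0] x [0, 2 pi]] equates the means over the circles of radius [exp u] and
   [1]; the former tends to the value at the center as [u -> -oo]. *)
Lemma circle_max g (b : R) : centire g ->
  (forall t, complex.Re (g (cexp (0 +i* t))) <= b) -> complex.Re (g 0) <= b.
Proof.
move=> hg hb; pose F := g \o @cexp R.
have hF : centire F by apply: centire_comp => //; exact: centire_cexp.
pose P u v := complex.Re (F (u +i* v)); pose Q u v := complex.Im (F (u +i* v)).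
have closed u v : exists a b d' : R, has_diff2 Q u v a b /\ has_diff2 P u v b d'.
  have [d /cdiff_diff2[h1 h2]] := hF (u +i* v).
  by exists (complex.Im d), (complex.Re d), (- complex.Im d).
have [_ cP] : (forall v, continuous (fun u => P u v)) /\ (forall u, continuous (P u)).
  by apply: has_diff2_cts => u v; have [a [b' [d [_ h]]]] := closed u v; exists b', d.
have pi2 : 0 < pi *+ 2 :> R by rewrite mulrn_wgt0 ?pi_gt0.
have per u : cexp (u +i* 0) = cexp (u +i* (pi *+ 2)).
  by rewrite /cexp /= cos2pi sin2pi cos0 sin0.
have [d0 /cdiff_at_lip[r0 r00 h0]] := hg 0.
apply/ler_addgt0Pr => e e0.
have K0 : 0 < normc d0 + 1 by have := normc_ge0 d0; lra.
(* On the circle of radius exp(- p) the function stays within e of its value at the center; the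
   maximum with 1 keeps p nonnegative. *)
pose p := Num.max 1 (- ln (Num.min (r0 / 2) (e / (normc d0 + 1)))).
have m0 : 0 < Num.min (r0 / 2) (e / (normc d0 + 1)) by rewrite lt_min !divr_gt0.
have p0 : 0 <= p by rewrite le_max ler01.
have small v : `|P (- p) v - complex.Re (g 0)| <= e.
  have hn : normc (cexp ((- p) +i* v)) <= Num.min (r0 / 2) (e / (normc d0 + 1)).
    rewrite normc_cexp /= -[leRHS](lnK m0) ler_expR lerNl le_max lexx orbT //.
  move: hn; rewrite le_min => /andP[h1 h2].
  have := h0 (cexp ((- p) +i* v)); rewrite add0r => h3.
  have {}h3 : normc (g (cexp ((- p) +i* v)) - g 0) <= e.
    apply: le_trans (h3 _) _; first by apply: le_lt_trans h1 _; lra.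
    by rewrite mulrC -ler_pdivlMr.
  apply: le_trans h3; apply: le_trans (Re_le_normc _); apply: eq_ler; congr `| _ |.
  by rewrite /P /F /=; case: (g _) => ? ?; case: (g 0).
have := Goursat closed (- p) 0 p0 (ltW pi2).
rewrite /circulation add0r addNr.
rewrite (eq_segint (g := fun=> 0)); last first.
  by move=> u _; rewrite /Q /F /= -per subrr.
rewrite segint_cst; last by rewrite oppr_le0.
rewrite mul0r add0r segintB; [|exact: cP..] => /eqP; rewrite subr_eq0 => /eqP e1.
have I1 := @segint_approx _ (P (- p)) 0 (pi *+ 2) (complex.Re (g 0)) e (cP _) (ltW pi2) (fun v _ => small v).
have I2 : segint (P 0) 0 (pi *+ 2) <= b * (pi *+ 2).
  have -> : b * (pi *+ 2) = segint (fun=> b) 0 (pi *+ 2) by rewrite (segint_cst b (ltW pi2)) subr0.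
  apply: le_Rintegral; [exact: measurable_itv|exact: continuous_segint| |by move=> v _; exact: hb].
  by apply: continuous_segint => x; exact: cvg_cst.
move: I1; rewrite -e1 subr0 ler_norml => /andP[I1 _].
suff : complex.Re (g 0) * (pi *+ 2) <= (b + e) * (pi *+ 2) by rewrite ler_pM2r.
rewrite mulrDl; move: I1 I2; move: (segint (P 0) 0 (pi *+ 2)) (pi *+ 2 : R) => S L; clear; lra.
Qed.

(* The mean value property at [w] is applied to the product of [f (w + z)] and
   [exp (M (i z - z ^ 2 / 2))]: on the unit circle it vanishes below the height
   [t], and elsewhere the exponential is arbitrarily small as [M] grows. *)
Lemma halfplane_step f t : centire f ->
  (forall z, complex.Im z < t -> f z = 0) ->
  forall z, complex.Im z < t + 1/4 -> f z = 0.
Proof.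
move=> hf h0 w hw.
have [C hC] : exists C : R, forall th, normc (f (w + cexp (0 +i* th))) <= C.
  have hk : centire (fun z => f (w + cexp z)).
    apply: (@centire_comp (fun z => w + cexp z) f) => //.
    by apply: centireD; [exact: centire_cst | exact: centire_cexp].
  have hc : exists C : R, forall th, 0 <= th <= pi *+ 2 -> normc (f (w + cexp (0 +i* th))) <= C.
    have [_ c1] : (forall v, continuous (fun u => complex.Re (f (w + cexp (u +i* v))))) /\
        (forall u, continuous (fun v => complex.Re (f (w + cexp (u +i* v))))).
      by apply: has_diff2_cts => u v; have [d /cdiff_diff2[h1 h2]] := hk (u +i* v); eexists; eexists; exact: h1.
    have [_ c2] : (forall v, continuous (fun u => complex.Im (f (w + cexp (u +i* v))))) /\
        (forall u, continuous (fun v => complex.Im (f (w + cexp (u +i* v))))).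
      by apply: has_diff2_cts => u v; have [d /cdiff_diff2[h1 h2]] := hk (u +i* v); eexists; eexists; exact: h2.
    have pi2 : 0 <= pi *+ 2 :> R by rewrite mulrn_wge0 // pi_ge0.
    have cc : {within `[0, pi *+ 2], continuous (fun v : R => `|complex.Re (f (w + cexp (0 +i* v)))| + `|complex.Im (f (w + cexp (0 +i* v)))|)}.
      apply: continuous_subspaceT => v; apply: cvgD; apply: cvg_norm; [exact: c1 | exact: c2].
    have [c _ hc] := EVT_max pi2 cc.
    exists (`|complex.Re (f (w + cexp (0 +i* c)))| + `|complex.Im (f (w + cexp (0 +i* c)))|) => th hth.
    by apply: le_trans (normc_le_ReIm _) _; apply: hc; rewrite in_itv.
  have [C hC] := hc; exists C => th.
  have pi2 : 0 < pi *+ 2 :> R by rewrite mulrn_wgt0 ?pi_gt0.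
  pose k := Num.floor (th / (pi *+ 2)).
  have [k1 k2] : k%:~R <= th / (pi *+ 2) /\ th / (pi *+ 2) < k%:~R + 1.
    split; first exact: floor_le.
    by rewrite -intrD1 floorD1_gt.
  have := hC (th - (pi *+ 2) * k%:~R).
  have -> : cexp (0 +i* (th - pi *+ 2 * k%:~R)) = cexp (0 +i* th).
    have perc : forall n : nat, forall x : R, cos (x + pi *+ 2 * n%:R) = cos x.
      by move=> n x; rewrite mulr_natr; exact: (periodicn (@cosD2pi R)).
    have pers : forall n : nat, forall x : R, sin (x + pi *+ 2 * n%:R) = sin x.
      by move=> n x; rewrite mulr_natr; exact: (periodicn (@sinD2pi R)).
    rewrite /cexp /=; case: (k) => n.
      by rewrite -(perc n) -(pers n) subrK.
    by rewrite NegzE mulrN opprK perc pers.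
  apply; apply/andP; split; first by rewrite subr_ge0 mulrC -ler_pdivlMr.
  by move: k2; rewrite ltr_pdivrMr // mulrDl mul1r mulrC => /ltW; lra.
have C0 : 0 <= C by apply: le_trans (hC 0); exact: normc_ge0.
apply/eqP; rewrite -[_ == _]negbK -normc_gt0; apply/negP => fw.
(* Then 3 M / 16 = C / A, and the mean value property will give A <= C exp(- C / A), against exp y >
   y. *)
pose A := normc (f w); pose M : R := C / A * 16 / 3.
have A0 : 0 < A := fw.
have M0 : 0 <= M by rewrite /M !mulr_ge0 ?invr_ge0 ?ler0n ?(ltW A0).
have eta : complex.Im w - t < 1/4 by lra.
(* The conjugate of [f w] makes g 0 equal to the real number |f w|^2, so a bound on real parts
   suffices. *)
pose g z := (f w)^* * (f (w + z) * cexp (M%:C * ('i * z - z * z * (1/2)%:C))).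
have hg : centire g.
  apply: centireM; first exact: centire_cst.
  apply: centireM.
    apply: (@centire_comp (fun z => w + z) f) => //.
    by apply: centireD; [exact: centire_cst | exact: centire_id].
  apply: (@centire_comp (fun z => M%:C * ('i * z - z * z * (1/2)%:C)) (@cexp R)); last exact: centire_cexp.
  apply: centireM; first exact: centire_cst.
  have -> : (fun z => 'i * z - z * z * (1/2)%:C) = (fun z : R[i] => 'i * z + z * z * (- (1/2))%:C).
    by apply/funext => z; rewrite rmorphN mulrN.
  by apply: centireD; apply: centireM; [exact: centire_cst|exact: centire_id|
    apply: centireM; exact: centire_id|exact: centire_cst].
have bound th : complex.Re (g (cexp (0 +i* th))) <= A * (C * expR (- (M * (3 / 16)))).
  apply: le_trans (ler_norm _) _; apply: le_trans (Re_le_normc _) _.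
  have nf : normc ((f w)^*) = A.
    by rewrite /A; case: (f w) => a b /=; rewrite sqrrN.
  rewrite /g !normcM nf ler_pM2l //.
  have [im|im] := ltP (complex.Im (w + cexp (0 +i* th))) t.
    by rewrite h0 // normc0 mul0r mulr_ge0 ?expR_ge0.
  apply: ler_pM; [exact: normc_ge0 | exact: normc_ge0 | exact: hC | ].
  rewrite normc_cexp ler_expR.
  have ez : cexp (0 +i* th) = cos th +i* sin th by rewrite /cexp /= expR0 !mul1r.
  rewrite ez in im *; set x := cos th; set y := sin th.
  have xy : x ^+ 2 + y ^+ 2 = 1 by apply: cos2Dsin2.
  (* On the unit circle the real part of i z - z^2 / 2 is y^2 - y - 1/2, at most - 3/16 for - 1/4 <=
     y <= 1. This is why the half-plane grows by 1/4. *)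
  have -> : complex.Re (M%:C * ('i * (x +i* y) - (x +i* y) * (x +i* y) * (1 / 2)%:C)) =
      M * (- y - (x ^+ 2 - y ^+ 2) / 2).
    by rewrite /=; field.
  have yt : - (1/4) < y by move: im eta; case: (w) => a b /=; rewrite -/y; lra.
  have y1 : y <= 1 by apply: sin_le1.
  rewrite -[leRHS]mulrN; apply: ler_wpM2l => //.
  have -> : x ^+ 2 = 1 - y ^+ 2 by lra.
  have : (y + 1/4) * (1 - y) >= 0 by apply: mulr_ge0; lra.
  rewrite !expr2; lra.
have := circle_max hg bound.
have -> : complex.Re (g 0) = A ^+ 2.
  rewrite /g !mulr0 mul0r subr0 mulr0 addr0 cexp0 mulr1 /A.
  case: (f w) => a b /=; rewrite sqr_sqrtr ?addr_ge0 ?sqr_ge0 //; ring.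
rewrite expr2 ler_pM2l // leNgt => /negP; apply.
rewrite expRN -ltr_pdivlMr ?invr_gt0 ?expR_gt0 // invrK.
have := expR_ge1Dx (M * (3/16)).
have -> : M * (3/16) = C / A by rewrite /M; field; rewrite gt_eqF.
rewrite -(ler_pM2l A0) mulrDr mulr1 mulrCA divff ?mulr1 ?gt_eqF //; lra.
Qed.

Lemma halfplane_zero f : centire f -> (forall z, complex.Im z < 0 -> f z = 0) ->
  forall z, f z = 0.
Proof.
move=> hf h0 z.
have key (n : nat) : forall z, complex.Im z < n%:R / 4 -> f z = 0.
  elim: n => [|n IH]; first by rewrite mul0r.
  by move=> x hx; apply: (halfplane_step hf IH); move: hx; rewrite -natr1; lra.
apply: (key (Num.truncn (4 * `|complex.Im z|)).+1).
have := truncnS_gt (4 * `|complex.Im z|); have := ler_norm (complex.Im z); lra.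
Qed.

(** The substitution w^2 + s0 unfolds the ray into the whole real line. There the composite
    vanishes, so it may be replaced by 0 in the lower half-plane and remain entire, which reduces
    the claim to [halfplane_zero]. One of the two square roots w, - w of z - s0 lies in the closed
    upper half-plane. *)
Theorem entire_zero_ray f (s0 : R) : centire f ->
  (forall x : R, s0 <= x -> f x%:C = 0) -> forall z, f z = 0.
Proof.
move=> hf h0.
pose k w := f (w * w + s0%:C).
have hk : centire k.
  apply: (@centire_comp (fun w => w * w + s0%:C) f) => //.
  apply: centireD; last exact: centire_cst.
  by apply: centireM; exact: centire_id.
have k0 (x : R) : k x%:C = 0.
  rewrite /k -rmorphM -rmorphD; apply: h0; rewrite lerDr -expr2; exact: sqr_ge0.
pose F w := if 0 <= complex.Im w then k w else 0.
(* [k] vanishes on the real line, so [F], its gluing with 0, is differentiable. *)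
have hF : centire F.
  move=> w; have [d hd] := hk w.
  have [im|im|im] := ltgtP (complex.Im w) 0.
  - exists 0 => e e0; exists (- complex.Im w); first by rewrite oppr_gt0.
    move=> h hh; have hi := le_lt_trans (Im_le_normc h) hh.
    have i1 : complex.Im (w + h) < 0.
      by move: hi im; case: (w) => a b; case: (h) => c x /=; have := ler_norm x; lra.
    have -> : F (w + h) = 0 by rewrite /F leNgt i1.
    have -> : F w = 0 by rewrite /F leNgt im.
    by rewrite subrr mul0r subr0 normc0 mulr_ge0 ?normc_ge0 // ltW.
  - exists d => e e0; have [r r0 hr] := hd e e0.
    exists (Num.min r (complex.Im w)); first by rewrite lt_min r0.
    move=> h; rewrite lt_min => /andP[hh1 hh2].
    have hi := le_lt_trans (Im_le_normc h) hh2.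
    have i1 : 0 <= complex.Im (w + h).
      move: hi im; case: (w) => a b; case: (h) => c x /=; have := ler_norm (- x); rewrite normrN; lra.
    by rewrite /F i1 (ltW im); exact: hr.
  have wr : w = (complex.Re w)%:C by move: im; case: (w) => a b /= ->.
  have kw : k w = 0 by rewrite wr k0.
  have dz : d = 0.
    apply/eqP; rewrite -[_ == _]negbK -normc_gt0; apply/negP => dn.
    have e0 : 0 < normc d / 2 by rewrite divr_gt0.
    have [r r0 hr] := hd _ e0.
    have r2 : 0 < r / 2 by rewrite divr_gt0.
    have := hr (r / 2)%:C; rewrite normc_real gtr0_norm //.
    rewrite kw {1}wr -rmorphD k0 subrr sub0r normc_opp normcM normc_real gtr0_norm //.
    by rewrite ler_pM2r // => /(_ _); lra.
  exists 0 => e e0; have [r r0 hr] := hd e e0; exists r => // h /hr.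
  rewrite dz kw /F im lexx kw; case: ifP => // _ _.
  by rewrite mul0r !subr0 normc0 mulr_ge0 ?normc_ge0 // ltW.
have F0 : forall z, F z = 0.
  by apply: halfplane_zero => // w im; rewrite /F leNgt im.
move=> z; pose w := sqrtC (z - s0%:C).
have ww : w * w + s0%:C = z by rewrite -expr2 sqrtCK subrK.
have [im|im] := leP 0 (complex.Im w).
  by have := F0 w; rewrite /F im /k ww.
have imN : 0 <= complex.Im (- w).
  by move: im; move: (w : R[i]) => [a b] /=; rewrite oppr_ge0; exact: ltW.
by have := F0 (- w); rewrite /F imN /k mulrNN ww.
Qed.

End UniqueContinuation.

(** * Everywhere convergent power series are entire *)

Section PowerSeries.
Import Normc.
Local Open Scope complex_scope.
Variable R : realType.
Implicit Types (z w h l : R[i]).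

Lemma cvgCP (u : nat -> R[i]) l : cvgC u l <->
  forall e : R, 0 < e -> exists N : nat, forall n, (N <= n)%N -> normc (u n - l) < e.
Proof.
split=> [/cvgrPdist_lt hu e e0|hu].
  have e0' : (0 : R[i]) < e%:C by rewrite ltcR.
  have [N _ hN] := hu _ e0'; exists N => n /hN /=.
  by rewrite -[normc _]normc_opp opprB -ltcR.
apply/cvgrPdist_lt => e e0.
have ee : e = (complex.Re e)%:C.
  by apply/eqP; rewrite eq_complex /= eqxx /= (ger0_Im (ltW e0)).
have [|N hN] := hu (complex.Re e); first by rewrite -ltcR -ee.
exists N => // n /hN; rewrite -[normc _]normc_opp opprB -ltcR -ee; exact.
Qed.

Lemma cvgC_ReIm (u : nat -> R[i]) (a b : R) :
  (fun n => complex.Re (u n)) @ \oo --> a -> (fun n => complex.Im (u n)) @ \oo --> b ->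
  cvgC u (a +i* b).
Proof.
move=> /cvgrPdist_lt h1 /cvgrPdist_lt h2; apply/cvgCP => e e0.
have e2 : 0 < e / 2 by rewrite divr_gt0.
have [N1 _ H1] := h1 _ e2; have [N2 _ H2] := h2 _ e2.
exists (maxn N1 N2) => n; rewrite geq_max => /andP[/H1 /= n1 /H2 /= n2].
apply: le_lt_trans (normc_le_ReIm _) _.
move: n1 n2; rewrite distrC [`|b - _|]distrC; case: (u n) => c d /=; lra.
Qed.

Lemma cvgC_unique (u : nat -> R[i]) l l' : cvgC u l -> cvgC u l' -> l = l'.
Proof.
move=> /cvgCP h1 /cvgCP h2; apply/eqP; rewrite -subr_eq0 -[_ == _]negbK -normc_gt0.
apply/negP => d0; have d2 : 0 < normc (l - l') / 2 by rewrite divr_gt0.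
have [N1 H1] := h1 _ d2; have [N2 H2] := h2 _ d2.
have n1 := H1 _ (leq_maxl N1 N2); have n2 := H2 _ (leq_maxr N1 N2).
have := normc_triangle (l - u (maxn N1 N2)) (u (maxn N1 N2) - l').
by rewrite addrA subrK -[normc (l - u _)]normc_opp opprB; lra.
Qed.

Lemma cvgC_bound (u : nat -> R[i]) l (C : R) : cvgC u l ->
  (forall n, normc (u n) <= C) -> normc l <= C.
Proof.
move=> /cvgCP h hC; apply/ler_addgt0Pr => e e0; have [N /(_ N (leqnn N)) hN] := h _ e0.
have := normc_triangle (u N) (l - u N).
rewrite [X in normc X](_ : _ = l); last by ring.
by rewrite -[normc (l - _)]normc_opp opprB; have := hC N; lra.
Qed.

Lemma cvgC_comb (u v w : nat -> R[i]) l m n h : cvgC u l -> cvgC v m -> cvgC w n ->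
  cvgC (fun k => u k - v k - w k * h) (l - m - n * h).
Proof.
move=> /cvgCP hu /cvgCP hv /cvgCP hw; apply/cvgCP => e e0.
have K0 : 0 < 2 + normc h by have := normc_ge0 h; lra.
have eK : 0 < e / (2 + normc h) by rewrite divr_gt0.
have [N1 H1] := hu _ eK; have [N2 H2] := hv _ eK; have [N3 H3] := hw _ eK.
exists (maxn N1 (maxn N2 N3)) => k; rewrite !geq_max => /and3P[/H1 {}H1 /H2 {}H2 /H3 {}H3].
have -> : u k - v k - w k * h - (l - m - n * h) =
    (u k - l) + (- (v k - m) + - ((w k - n) * h)) by ring.
have t1 := normc_triangle (u k - l) (- (v k - m) + - ((w k - n) * h)).
have t2 := normc_triangle (- (v k - m)) (- ((w k - n) * h)).
rewrite !normc_opp normcM in t2.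
have t3 : normc (w k - n) * normc h <= e / (2 + normc h) * normc h.
  by apply: ler_wpM2r; [exact: normc_ge0 | exact: ltW].
have t4 : e / (2 + normc h) * 2 + e / (2 + normc h) * normc h = e.
  by rewrite -mulrDr divfK // gt_eqF.
lra.
Qed.

Definition psum (c : nat -> R[i]) (n : nat) : R[i] := \sum_(0 <= k < n) c k.

Lemma cvgC_abs (c : nat -> R[i]) (M : nat -> R) : (forall k, normc (c k) <= M k) ->
  cvgn (series M) -> exists l, cvgC (psum c) l.
Proof.
move=> cM hM.
have H (P : R[i] -> R) : (forall z, `|P z| <= normc z) ->
    (forall z w, P (z + w) = P z + P w) -> P 0 = 0 ->
    exists a : R, (fun n => P (psum c n)) @ \oo --> a.
  move=> PM PD P0; have : cvgn (series (fun k => P (c k))).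
    apply: normed_cvg; apply: (series_le_cvg _ _ _ hM) => k.
    - exact: normr_ge0.
    - by apply: le_trans (cM k); exact: normc_ge0.
    - exact: le_trans (PM _) (cM k).
  move=> /cvg_ex[a ha]; exists a.
  have -> : (fun n => P (psum c n)) = series (fun k => P (c k)) => //.
  apply/funext => n; rewrite /psum seriesEnat /=.
  by rewrite (big_morph P PD P0).
have [a ha] : exists a : R, (fun n => complex.Re (psum c n)) @ \oo --> a.
  by apply: H => //; [exact: Re_le_normc | case=> ? ? []].
have [b hb] : exists b : R, (fun n => complex.Im (psum c n)) @ \oo --> b.
  by apply: H => //; [exact: Im_le_normc | case=> ? ? []].
by exists (a +i* b); exact: cvgC_ReIm.
Qed.

Definition dpow z (k : nat) : R[i] := if k is k'.+1 then k%:R * z ^+ k' else 0.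

Lemma normcX z k : normc (z ^+ k) = normc z ^+ k.
Proof. by elim: k => [|k IH]; rewrite ?normc1 // !exprS normcM IH. Qed.

Lemma normc_nat k : normc (k%:R : R[i]) = k%:R.
Proof. by rewrite -(rmorph_nat (real_complex R)) normc_real ger0_norm. Qed.

Lemma nat_le_expn4 k : k%:R <= 4 ^+ k :> R.
Proof. by rewrite -natrX ler_nat ltnW // ltn_expl. Qed.

Lemma dpow_bound z k (r : R) : 1 <= r -> normc z <= r -> normc (dpow z k) <= (4 * r) ^+ k.
Proof.
move=> r1 zr; have r0 : 0 <= r by lra.
case: k => [|k]; first by rewrite normc0 expr0.
rewrite /dpow normcM normcX normc_nat exprMn.
apply: ler_pM => //; first by rewrite exprn_ge0 // normc_ge0.
  exact: nat_le_expn4.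
apply: (@le_trans _ _ (r ^+ k)); last by rewrite exprS ler_peMl // exprn_ge0.
by apply: lerXn2r; rewrite ?nnegrE ?normc_ge0.
Qed.

(** The crude factor (4 r)^k is chosen so that the remainders, summed against the coefficients, form
    the same majorant series at the larger radius 4 r. *)
Lemma pow_taylor1 z h k (r : R) : 1 <= r -> normc z <= r -> normc (z + h) <= r ->
  normc ((z + h) ^+ k - z ^+ k - dpow z k * h) <= normc h ^+ 2 * (4 * r) ^+ k.
Proof.
move=> r1 zr zhr; have r0 : 0 <= r by lra.
elim: k => [|k IH].
  by rewrite !expr0 subrr /= mul0r subr0 normc0 mulr1 exprn_ge0 // normc_ge0.
have -> : (z + h) ^+ k.+1 - z ^+ k.+1 - dpow z k.+1 * h =
    (z + h) * ((z + h) ^+ k - z ^+ k - dpow z k * h) + dpow z k * (h * h).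
  by case: k {IH} => [|k]; rewrite /dpow ?expr0 -?[k.+2%:R]natr1 ?exprS; ring.
apply: le_trans (normc_triangle _ _) _; rewrite !normcM.
have hn : 0 <= normc h ^+ 2 * (4 * r) ^+ k by rewrite mulr_ge0 ?exprn_ge0 ?normc_ge0 // mulr_ge0.
have e1 : normc (z + h) * normc ((z + h) ^+ k - z ^+ k - dpow z k * h) <=
    r * (normc h ^+ 2 * (4 * r) ^+ k).
  by apply: ler_pM => //; exact: normc_ge0.
have e2 : normc (dpow z k) * (normc h * normc h) <= normc h ^+ 2 * (4 * r) ^+ k.
  rewrite -expr2 mulrC; apply: ler_wpM2l; first by rewrite exprn_ge0 // normc_ge0.
  exact: dpow_bound.
have -> : normc h ^+ 2 * (4 * r) ^+ k.+1 = 4 * (r * (normc h ^+ 2 * (4 * r) ^+ k)).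
  by rewrite [(4 * r) ^+ k.+1]exprS; ring.
by move: e1 e2 hn; move: (normc h ^+ 2 * (4 * r) ^+ k) => y; clear -r1; nra.
Qed.

Theorem power_series_entire (b : nat -> R) :
  (forall r : R, 0 <= r -> cvgn (series (fun k => `|b k| * r ^+ k))) ->
  exists2 f : R[i] -> R[i], centire f &
    forall z, cvgC (fun n => \sum_(0 <= k < n) (b k)%:C * z ^+ k) (f z).
Proof.
move=> hb.
have ex z : { l | cvgC (psum (fun k => (b k)%:C * z ^+ k)) l }.
  apply: cid; apply: (cvgC_abs _ (hb _ (normc_ge0 z))) => k.
  by rewrite normcM normcX normc_real.
have exd z : { l | cvgC (psum (fun k => (b k)%:C * dpow z k)) l }.
  apply: cid.
  have r0 : 0 <= 4 * (normc z + 1) by rewrite mulr_ge0 // addr_ge0 // normc_ge0.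
  apply: (cvgC_abs _ (hb _ r0)) => k.
  rewrite normcM normc_real; apply: ler_wpM2l => //.
  by apply: dpow_bound; rewrite ?lerDl ?lerDr ?normc_ge0.
exists (fun z => sval (ex z)); last by move=> z; exact: (svalP (ex z)).
move=> z; exists (sval (exd z)).
pose r := normc z + 1.
have r1 : 1 <= r by rewrite lerDr normc_ge0.
have r40 : 0 <= 4 * r by rewrite mulr_ge0 //; lra.
pose C := limn (series (fun k => `|b k| * (4 * r) ^+ k)).
have hC n : series (fun k => `|b k| * (4 * r) ^+ k) n <= C.
  apply: nondecreasing_cvgn_le; last exact: hb.
  by apply: nondecreasing_series => k _ _; rewrite mulr_ge0 // exprn_ge0.
have C0 : 0 <= C by have := hC 0%N; rewrite seriesEnat /= big_geq.
(* The bound 1 keeps z + h within the radius [r]; the other one turns the remainder |h|^2 C into at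
   most e |h|. *)
move=> e e0; exists (Num.min 1 (e / (C + 1))).
  by rewrite lt_min ltr01 divr_gt0 //; lra.
move=> h; rewrite lt_min => /andP[h1 h2].
have cv := cvgC_comb (h := h) (svalP (ex (z + h))) (svalP (ex z)) (svalP (exd z)).
apply: le_trans (cvgC_bound (C := normc h ^+ 2 * C) cv _) _; last first.
  have hn := normc_ge0 h.
  have : normc h * (C + 1) <= e by rewrite -ler_pdivlMr ?ltW //; lra.
  rewrite expr2 -mulrA [e * _]mulrC; move=> h3; apply: ler_wpM2l => //; nra.
move=> n.
have -> : psum (fun k => (b k)%:C * (z + h) ^+ k) n - psum (fun k => (b k)%:C * z ^+ k) n
    - psum (fun k => (b k)%:C * dpow z k) n * h =
    psum (fun k => (b k)%:C * ((z + h) ^+ k - z ^+ k - dpow z k * h)) n.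
  rewrite /psum big_distrl /= -!sumrB; apply: eq_bigr => k _; ring.
have tri m : normc (psum (fun k => (b k)%:C * ((z + h) ^+ k - z ^+ k - dpow z k * h)) m) <=
    normc h ^+ 2 * series (fun k => `|b k| * (4 * r) ^+ k) m.
  elim: m => [|m IH].
    by rewrite /psum seriesEnat /= !big_geq // normc0 mulr0.
  rewrite /psum seriesEnat /= !big_nat_recr //= [leRHS]mulrDr.
  apply: le_trans (normc_triangle _ _) _; apply: lerD.
    by move: IH; rewrite /psum seriesEnat.
  rewrite normcM normc_real mulrCA; apply: ler_wpM2l => //.
  apply: pow_taylor1 => //; first by rewrite lerDl.
  by apply: le_trans (normc_triangle _ _) _; rewrite lerD2l ltW.
apply: le_trans (tri n) _; apply: ler_wpM2l; last exact: hC.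
by rewrite exprn_ge0 // normc_ge0.
Qed.

End PowerSeries.

(** * The theta function *)

Section PolyaIdentity.
Variable R : realType.

Lemma cos_pow_binomial (y : R) N :
  (2 * cos y) ^+ N = \sum_(k < N.+1) 'C(N, k)%:R * cos ((2 * k%:R - N%:R) * y).
Proof.
elim: N => [|N IH].
  by rewrite big_ord1 expr0 bin0 mulr0 subr0 mul0r cos0 mulr1.
rewrite exprS IH big_distrr /=.
transitivity (\sum_(k < N.+1) ('C(N, k)%:R * cos ((2 * k%:R - N.+1%:R) * y) +
    'C(N, k)%:R * cos ((2 * k.+1%:R - N.+1%:R) * y))).
  apply: eq_bigr => k _; rewrite -mulrDr mulrCA; congr (_ * _).
  set a := (2 * k%:R - N%:R) * y.
  have -> : (2 * k%:R - N.+1%:R) * y = a - y by rewrite /a -natr1; ring.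
  have -> : (2 * k.+1%:R - N.+1%:R) * y = a + y by rewrite /a -!natr1; ring.
  by rewrite cosB cosD; ring.
rewrite big_split /= [X in X + _ = _]big_ord_recl [RHS]big_ord_recl /= !bin0 -addrA.
congr (_ + _).
rewrite [in RHS](eq_bigr (fun k : 'I_N.+1 => 'C(N, k.+1)%:R * cos ((2 * k.+1%:R - N.+1%:R) * y) +
   'C(N, k)%:R * cos ((2 * k.+1%:R - N.+1%:R) * y))); last first.
  by move=> k _; rewrite /bump /= add1n binS natrD mulrDl.
rewrite big_split /=; congr (_ + _).
rewrite [RHS]big_ord_recr /= bin_small // mul0r addr0.
by apply: eq_bigr => k _; rewrite /bump /= add1n.
Qed.

Lemma cos_pow_even (y : R) m :
  (2 * cos y) ^+ (2 * m) = 'C(2 * m, m)%:R +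
    2 * \sum_(d < m) 'C(2 * m, m + d.+1)%:R * cos (2 * d.+1%:R * y).
Proof.
rewrite cos_pow_binomial.
have e : ((2 * m).+1 = m + m.+1)%N by lia.
rewrite (eq_bigr (fun k : 'I_(2 * m).+1 => (fun k : nat => 'C(2 * m, k)%:R * cos ((2 * k%:R - (2 * m)%:R) * y)) k)) //.
rewrite -(big_mkord xpredT (fun k : nat => 'C(2 * m, k)%:R * cos ((2 * k%:R - (2 * m)%:R) * y))).
rewrite e big_mkord big_split_ord /= big_ord_recl /= addn0.
have -> : (2 * m%:R - (2 * m)%:R) * y = 0 by rewrite natrM; ring.
rewrite cos0 mulr1 addrCA mulr2n mulrDl mul1r; congr (_ + (_ + _)).
  rewrite (reindex_inj rev_ord_inj) /=; apply: eq_bigr => d _.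
  have dm : (d < m)%N by [].
  rewrite -bin_sub; last by lia.
  have -> : (2 * m - (m - d.+1) = m + d.+1)%N by lia.
  congr (_ * _); rewrite -cosN; congr cos.
  by rewrite natrM natrB //; ring.
apply: eq_bigr => d _; rewrite /bump /= add1n; congr (_ * cos _).
by rewrite natrM natrD; ring.
Qed.

(** The real part of the sum of the d-th powers of the n-th roots of unity. If n does not divide d,
    multiplication by 2 sin(pi d / n), which is then nonzero, makes the sum telescope. *)
Lemma sum_cos_roots n d : (0 < n)%N ->
  \sum_(j < n) cos (2 * d%:R * (pi * j%:R / n%:R)) = if (n %| d)%N then n%:R else 0 :> R.
Proof.
move=> n0; have nn : n%:R != 0 :> R by rewrite pnatr_eq0 -lt0n.
case: ifPn => [/dvdnP[a ->]|nd].
  rewrite (eq_bigr (fun=> 1)); first by rewrite sumr_const card_ord.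
  move=> j _; have -> : 2 * (a * n)%:R * (pi * j%:R / n%:R) = 0 + (pi *+ 2) *+ (a * j) :> R.
    by rewrite !natrM -[_ *+ (a * j)]mulr_natr natrM; field.
  by rewrite (periodicn (@cosD2pi R)) cos0.
set x : R := pi * d%:R / n%:R.
have sx : sin x != 0.
  have -> : x = pi * (d %% n)%:R / n%:R + pi *+ (d %/ n).
    by rewrite /x {1}(divn_eq d n) natrD natrM -[_ *+ (d %/ n)]mulr_natr; field.
  have -> : sin (pi * (d %% n)%:R / n%:R + pi *+ (d %/ n)) =
      (-1) ^+ (d %/ n) * sin (pi * (d %% n)%:R / n%:R) :> R.
    elim: (d %/ n)%N => [|k IH]; first by rewrite mulr0n addr0 mul1r.
    by rewrite mulrSr addrA sinDpi IH exprS mulN1r mulNr.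
  rewrite mulf_neq0 ?signr_eq0 // gt_eqF // sin_gt0_pi //; apply/andP; split.
    by rewrite divr_gt0 ?ltr0n // mulr_gt0 ?pi_gt0 // ltr0n lt0n.
  by rewrite ltr_pdivrMr ?ltr0n // ltr_pM2l ?pi_gt0 // ltr_nat ltn_mod.
apply: (mulfI sx); rewrite mulr0; apply: (@mulfI _ 2); first by rewrite pnatr_eq0.
rewrite mulr0 mulrA big_distrr /=.
pose S (j : nat) := sin ((2 * j%:R - 1) * x).
rewrite (eq_bigr (fun j : 'I_n => S j.+1 - S j)); last first.
  move=> j _; rewrite /S.
  have -> : 2 * d%:R * (pi * j%:R / n%:R) = 2 * j%:R * x by rewrite /x; ring.
  have -> : (2 * j.+1%:R - 1) * x = 2 * j%:R * x + x by rewrite -natr1; ring.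
  have -> : (2 * j%:R - 1) * x = 2 * j%:R * x - x by ring.
  by rewrite sinB sinD; ring.
rewrite -(big_mkord xpredT (fun j => S j.+1 - S j)) telescope_sumr // /S.
have -> : (2 * n%:R - 1) * x = - x + (pi *+ 2) *+ d.
  by rewrite /x -[_ *+ d]mulr_natr; field.
rewrite (periodicn (@sinD2pi R)) mulr0 sub0r mulN1r subrr //.
Qed.

Definition central (m : nat) : R := 'C(2 * m, m)%:R / 4 ^+ m.

Definition binratio (m k : nat) : R := 'C(2 * m, m + k)%:R / 'C(2 * m, m)%:R.

(* Sum of [(2 cos (pi j / n)) ^ (2 m)] over [j] modulo [n], divided by [4 ^ m]. *)
Lemma polya_identity h m : let n := (2 * h).+1 in
  1 + 2 * (\sum_(j < h) cos (pi * j.+1%:R / n%:R) ^+ (2 * m)) =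
  n%:R * central m * (1 + 2 * \sum_(l < m) binratio m (n * l.+1)).
Proof.
move=> n; have n0 : (0 < n)%N by [].
have nn : n%:R != 0 :> R by rewrite pnatr_eq0.
have c0 : 'C(2 * m, m)%:R != 0 :> R by rewrite pnatr_eq0 -lt0n bin_gt0; lia.
have p4 : 4 ^+ m = 2 ^+ (2 * m) :> R by rewrite exprM; congr (_ ^+ _); ring.
have q0 : 2 ^+ (2 * m) != 0 :> R by rewrite expf_neq0.
apply: (mulfI q0).
transitivity (\sum_(j < n) (2 * cos (pi * j%:R / n%:R)) ^+ (2 * m) : R).
  rewrite [RHS](eq_bigr (fun j : 'I_n => 2 ^+ (2 * m) * cos (pi * j%:R / n%:R) ^+ (2 * m))); last first.
    by move=> j _; rewrite exprMn.
  rewrite -big_distrr /=; congr (_ * _).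
  rewrite big_ord_recl mulr0 mul0r cos0 expr1n; congr (_ + _).
  rewrite (eq_bigr (fun j : 'I_(2 * h) => (fun j : nat => cos (pi * j.+1%:R / n%:R) ^+ (2 * m)) j)) //.
  rewrite -(big_mkord xpredT (fun j : nat => cos (pi * j.+1%:R / n%:R) ^+ (2 * m))).
  have eh : (2 * h = h + h)%N by lia.
  rewrite eh big_mkord big_split_ord /= mulr2n mulrDl mul1r; congr (_ + _).
  rewrite [RHS](reindex_inj rev_ord_inj) /=; apply: eq_bigr => j _.
  have jh : (j < h)%N by [].
  rewrite !(exprM _ 2 m); congr (_ ^+ m).
  have -> : ((h + (h - j.+1)).+1 = n - j.+1)%N by rewrite /n; lia.
  have -> : pi * (n - j.+1)%:R / n%:R = - (pi * j.+1%:R / n%:R) + pi :> R.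
    by rewrite natrB; [field | rewrite /n; lia].
  by rewrite cosDpi sqrrN cosN.
under eq_bigr => j _ do rewrite cos_pow_even.
rewrite big_split /= sumr_const card_ord -big_distrr /= exchange_big /=.
under eq_bigr => d _ do rewrite -big_distrr /= sum_cos_roots //.
transitivity (n%:R * 'C(2 * m, m)%:R * (1 + 2 * \sum_(d < m) (if (n %| d.+1)%N then binratio m d.+1 else 0))).
  rewrite -[_ *+ n]mulr_natl mulrDr mulr1; congr (_ + _).
  rewrite mulrCA; congr (_ * _); rewrite big_distrr /=; apply: eq_bigr => d _.
  by case: ifP => _; rewrite ?mulr0 // /binratio; field.
rewrite /central p4; move: (2 ^+ (2 * m)) q0 => q q0.
have -> X : q * (n%:R * ('C(2 * m, m)%:R / q) * X) = n%:R * 'C(2 * m, m)%:R * X by field.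
congr (_ * (_ + _ * _)).
rewrite -big_mkcond /=.
(* The surviving frequencies d + 1 are the multiples n (l + 1); those above m vanish, and [f]
   matches the index l with d. *)
have bz k : (m < k)%N -> binratio m k = 0 by move=> mk; rewrite /binratio bin_small ?mul0r //; lia.
rewrite [RHS](bigID (fun l : 'I_m => (n * l.+1 <= m)%N)) /= [X in _ = _ + X]big1 ?addr0; last first.
  by move=> l; rewrite -ltnNge => /bz.
pose f (l : nat) := (n * l.+1).-1.
have fl (l : 'I_m) : (n * l.+1 <= m)%N -> (f l < m)%N by rewrite /f /n; lia.
rewrite -(big_mkord (fun l => n %| l.+1)%N (fun l => binratio m l.+1)).
rewrite -(big_mkord (fun l => n * l.+1 <= m)%N (fun l => binratio m (n * l.+1)%N)).
rewrite -[in LHS]big_filter -[in RHS]big_filter.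
rewrite -(big_map f xpredT (fun l => binratio m l.+1)) /=.
apply: perm_big; apply: uniq_perm.
- by rewrite filter_uniq // iota_uniq.
- rewrite map_inj_uniq ?filter_uniq ?iota_uniq // => x y; rewrite /f /n; nia.
move=> d; rewrite mem_filter mem_index_iota /=; apply/andP/mapP.
  move=> [/dvdnP[a ha] dm]; exists a.-1.
    by rewrite mem_filter mem_index_iota /=; move: ha dm; rewrite /n; case: a => [|a]; nia.
  by rewrite /f; move: ha; case: a => [|a] //; rewrite [(_ * n)%N]mulnC => <-.
move=> [l]; rewrite mem_filter mem_index_iota /= => /andP[h1 h2] ->.
rewrite /f; have -> : ((n * l.+1).-1.+1 = n * l.+1)%N by rewrite prednK // muln_gt0.
by split; [exact: dvdn_mulr | move: h1; rewrite /n; nia].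
Qed.

End PolyaIdentity.

Section Tannery.
Variable R : realType.

(** Dominated convergence for sums whose length varies with h; [h <= L h] ensures that every fixed
    index is eventually present. *)
Lemma tannery (a : nat -> nat -> R) (A M : nat -> R) (L : nat -> nat) :
  (forall l, (fun h => a h l) @ \oo --> A l) ->
  (forall h l, (l < L h)%N -> 0 <= a h l <= M l) ->
  (forall h, (h <= L h)%N) -> cvgn (series M) ->
  cvgn (series A) /\ (fun h => \sum_(l < L h) a h l) @ \oo --> limn (series A).
Proof.
move=> aA aM hL hM.
have near_bound l : \forall h \near \oo, 0 <= a h l <= M l.
  by exists l.+1 => // h /= lh; apply: aM; apply: leq_trans (hL h).
have AM l : 0 <= A l <= M l.
  have <- : limn (fun h => a h l) = A l by apply/cvg_lim => //; exact: aA.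
  have cv : cvgn (fun h => a h l) by apply: cvgP; exact: aA.
  apply/andP; split.
    by apply: limr_ge => //; apply: filterS (near_bound l) => h /andP[].
  by apply: limr_le => //; apply: filterS (near_bound l) => h /andP[].
have hA : cvgn (series A).
  by apply: (series_le_cvg _ _ _ hM) => n; have /andP[h1 h2] := AM n => //; exact: le_trans h2.
split => //.
have M0 n : 0 <= M n by have /andP[h1 h2] := AM n; exact: le_trans h2.
have serE (f : nat -> R) n : series f n = \sum_(l < n) f l by rewrite seriesEord.
apply/cvgrPdist_le => e e0.
have e3 : 0 < e / 3 by rewrite divr_gt0.
have [K hK] : exists K : nat, limn (series M) - series M K <= e / 3.
  move/cvgrPdist_le: hM => /(_ _ e3) [K _ /(_ K (leqnn K))] /= h; exists K.
  exact: le_trans (ler_norm _) h.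
have tail (f : nat -> R) N : (forall l, (l < N)%N -> 0 <= f l <= M l) -> (K <= N)%N ->
    0 <= \sum_(l < N) f l - \sum_(l < K) f l <= e / 3.
  move=> hf KN.
  have -> : \sum_(l < N) f l - \sum_(l < K) f l = \sum_(K <= l < N) f l.
    by rewrite -!(big_mkord xpredT f) (big_cat_nat (n := K)) //= addrAC subrr add0r.
  apply/andP; split.
    by rewrite big_nat; apply: sumr_ge0 => l /andP[_ /hf /andP[]].
  apply: le_trans (_ : \sum_(K <= l < N) M l <= _).
    by apply: ler_sum_nat => l /andP[_ /hf /andP[]].
  apply: le_trans hK; have -> : \sum_(K <= l < N) M l = series M N - series M K.
    by rewrite !seriesEnat /= [in RHS](big_cat_nat (n := K) (p := N)) //= addrAC subrr add0r.
  rewrite lerD2r; apply: nondecreasing_cvgn_le => //.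
  by apply: nondecreasing_series => k _ _.
have limA : 0 <= limn (series A) - series A K <= e / 3.
  apply/andP; split.
    rewrite subr_ge0; apply: nondecreasing_cvgn_le => //.
    by apply: nondecreasing_series => k _ _; have /andP[] := AM k.
  rewrite lerBlDr; apply: limr_le => //; exists K => // N /= KN.
  rewrite !serE; have /andP[_] := tail A N (fun l _ => AM l) KN; lra.
have cK : (fun h => \sum_(l < K) a h l) @ \oo --> \sum_(l < K) A l.
  by apply: cvg_big => [|l _]; [exact: add_continuous | exact: aA].
move/cvgrPdist_le: cK => /(_ _ e3) cK.
near=> h.
have h1 : `|\sum_(l < K) A l - \sum_(l < K) a h l| <= e / 3 by near: h.
have KL : (K <= L h)%N by apply: leq_trans (hL h); near: h; exact: nbhs_infty_ge.
have /andP[h2 h3] := tail (a h) (L h) (aM h) KL.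
move: limA h1; rewrite serE !ler_norml; lra.
Unshelve. all: by end_near. Qed.

End Tannery.

Section Theta.
Variable R : realType.

Lemma one_sub_bounds (s : R) : 0 <= s < 1 -> expR (- (s / (1 - s))) <= 1 - s <= expR (- s).
Proof.
move=> /andP[s0 s1]; apply/andP; split; last exact: expR_ge1Dx.
have d0 : 0 < 1 - s by lra.
rewrite expRN -[leRHS]invrK lef_pV2 ?posrE ?expR_gt0 ?invr_gt0 //.
apply: le_trans (expR_ge1Dx _); apply: eq_ler; field; lra.
Qed.

Lemma cvg_one_sub_pow (s : nat -> R) (m : nat -> nat) c : (forall h, 0 <= s h) ->
  s @ \oo --> 0 -> (fun h => (m h)%:R * s h) @ \oo --> c ->
  (fun h => (1 - s h) ^+ m h) @ \oo --> expR (- c).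
Proof.
move=> s0 sl ms.
have c1 : (fun h => expR (- ((m h)%:R * s h))) @ \oo --> expR (- c).
  by apply: continuous_cvg; [exact: continuous_expR | exact: cvgN].
have c2 : (fun h => expR (- ((m h)%:R * s h / (1 - s h)))) @ \oo --> expR (- c).
  apply: continuous_cvg; [exact: continuous_expR | apply: cvgN].
  rewrite -[X in _ --> X](divr1 c) -[X in _ --> c / X]subr0.
  apply: cvgM => //; apply: cvgV; first by rewrite subr0 oner_neq0.
  by apply: cvgB => //; exact: cvg_cst.
apply: squeeze_cvgr c2 c1; have /cvgr_lt /(_ _ ltr01) sl1 := sl.
apply: filterS sl1 => h s1; have /andP[b1 b2] := one_sub_bounds (s := s h) (introT andP (conj (s0 h) s1)).
have -> : - ((m h)%:R * s h / (1 - s h)) = (m h)%:R * - (s h / (1 - s h)) by ring.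
have -> : - ((m h)%:R * s h) = (m h)%:R * - s h by ring.
have p1 : 0 <= 1 - s h by lra.
by rewrite !expRM_natl; apply/andP; split; apply: lerXn2r => //; rewrite nnegrE ?expR_ge0.
Qed.

(** A weak Jordan inequality. Applied at pi y, with pi >= 2, it gives y <= sin(pi y). *)
Lemma sin_ge_half (x : R) : 0 <= x <= pi / 2 -> x / 2 <= sin x.
Proof.
move=> /andP[x0 x1].
have [->|xn] := eqVneq x 0; first by rewrite sin0 mul0r.
have xp : 0 < x by rewrite lt_neqAle eq_sym xn.
pose y := x / 2; have y0 : 0 < y by rewrite divr_gt0.
have pi0 := pi_gt0 R.
have siny : y * cos y <= sin y.
  have [|c hc] := MVT (f := sin) (df := cos) y0 (fun z _ => is_derive_sin z).
    by apply: continuous_subspaceT => z; exact: continuous_sin.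
  rewrite sin0 !subr0 => ->; rewrite mulrC ler_pM2r //.
  move: hc; rewrite in_itv /= => /andP[c0 cy].
  by rewrite ltW // ltr_cos ?in_itv /= ?ltW //=; rewrite /y in cy *; lra.
have cosy : 0 <= cos y by apply: cos_ge0_pihalf; rewrite /y; lra.
have cosx : 0 <= cos x by apply: cos_ge0_pihalf; lra.
have e : x = y *+ 2 by rewrite /y mulr2n -splitr.
have -> : x / 2 = y by [].
move: cosx; rewrite e cos_mulr2n sin_mulr2n => cosx.
have : y * cos y * cos y <= sin y * cos y by exact: ler_wpM2r.
move: cosx; rewrite expr2 !mulr2n; nra.
Qed.

Lemma binratioS m k : (k <= m)%N ->
  binratio R m k.+1 = binratio R m k * ((m - k)%:R / (m + k.+1)%:R).
Proof.
move=> km; rewrite /binratio.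
have := mul_bin_left (2 * m) (m + k); have -> : (2 * m - (m + k) = m - k)%N by lia.
rewrite -addnS => /(congr1 (fun n => n%:R : R)); rewrite !natrM => e.
have d0 : (m + k.+1)%:R != 0 :> R by rewrite pnatr_eq0 addnS.
have -> : 'C(2 * m, m + k.+1)%:R = (m - k)%:R * 'C(2 * m, m + k)%:R / (m + k.+1)%:R :> R.
  by rewrite -e mulrAC divff // mul1r.
move: (_^-1) (_^-1) => x y; ring.
Qed.

Lemma binratio0 m : binratio R m 0 = 1.
Proof. by rewrite /binratio addn0 divff // pnatr_eq0 -lt0n bin_gt0; lia. Qed.

Lemma binratio_ge0 m k : 0 <= binratio R m k.
Proof. by rewrite divr_ge0. Qed.

(** Consecutive ratios are 1 - (2k + 1)/(m + k + 1) <= exp(- (2k + 1)/(m + K)), and the odd numbers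
    sum to k^2. [binratio_lb] inverts the ratio and argues in the same way. *)
Lemma binratio_ub m k K : (0 < m)%N -> (k <= K)%N -> (K <= m)%N ->
  binratio R m k <= expR (- (k%:R ^+ 2 / (m + K)%:R)).
Proof.
move=> m0; elim: k => [|k IH] kK Km.
  by rewrite binratio0 expr0n mul0r oppr0 expR0.
rewrite binratioS; last by lia.
have -> : - (k.+1%:R ^+ 2 / (m + K)%:R) =
    - (k%:R ^+ 2 / (m + K)%:R) + - ((2 * k%:R + 1) / (m + K)%:R) :> R by rewrite -natr1; ring.
rewrite expRD; apply: ler_pM.
- exact: binratio_ge0.
- by rewrite divr_ge0.
- by apply: IH => //; exact: ltnW.
apply: le_trans (expR_ge1Dx _).
have d1 : 0 < (m + k.+1)%:R :> R by rewrite ltr0n; lia.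
have d2 : (m + k.+1)%:R <= (m + K)%:R :> R by rewrite ler_nat; lia.
have -> : (m - k)%:R / (m + k.+1)%:R = 1 - (2 * k%:R + 1) / (m + k.+1)%:R :> R.
  apply: (mulIf (lt0r_neq0 d1)); rewrite mulrBl mul1r !divfK ?lt0r_neq0 //.
  by rewrite natrB ?natrD -?natr1; [ring | lia].
rewrite lerD2l lerN2; apply: ler_wpM2l; first by rewrite addr_ge0 // mulr_ge0.
by rewrite lef_pV2 ?posrE // (lt_le_trans d1).
Qed.

Lemma binratio_lb m k K : (k <= K)%N -> (K < m)%N ->
  expR (- (k%:R ^+ 2 / (m - K)%:R)) <= binratio R m k.
Proof.
move=> + Km; elim: k => [|k IH] kK.
  by rewrite binratio0 expr0n mul0r oppr0 expR0.
rewrite binratioS; last by lia.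
have -> : - (k.+1%:R ^+ 2 / (m - K)%:R) =
    - (k%:R ^+ 2 / (m - K)%:R) + - ((2 * k%:R + 1) / (m - K)%:R) :> R by rewrite -natr1; ring.
rewrite expRD; apply: ler_pM; try exact: expR_ge0.
  by apply: IH; exact: ltnW.
have d1 : 0 < (m - k)%:R :> R by rewrite ltr0n; lia.
have d2 : 0 < (m - K)%:R :> R by rewrite ltr0n; lia.
have d3 : (m - K)%:R <= (m - k)%:R :> R by rewrite ler_nat; lia.
have d4 : 0 < (m + k.+1)%:R :> R by rewrite ltr0n addnS.
rewrite expRN -[leRHS]invrK lef_pV2 ?posrE ?expR_gt0 ?invr_gt0 ?divr_gt0 //.
apply: le_trans (expR_ge1Dx _).
rewrite invf_div.
have -> : (m + k.+1)%:R / (m - k)%:R = 1 + (2 * k%:R + 1) / (m - k)%:R :> R.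
  apply: (mulIf (lt0r_neq0 d1)); rewrite mulrDl mul1r !divfK ?lt0r_neq0 //.
  by rewrite natrB ?natrD -?natr1; [ring | lia].
rewrite lerD2l; apply: ler_wpM2l; first by rewrite addr_ge0 // mulr_ge0.
by rewrite lef_pV2 ?posrE.
Qed.

Lemma centralS m : central R m.+1 = central R m * ((2 * m%:R + 1) / (2 * m%:R + 2)).
Proof.
rewrite /central.
have e1 : (m.+1 * 'C(2 * m.+1, m.+1) = (2 * m.+1) * 'C((2 * m).+1, m))%N.
  have -> : (2 * m.+1 = (2 * m).+2)%N by lia.
  by rewrite -mul_bin_diag.
have e2 : (m.+1 * 'C((2 * m).+1, m) = (2 * m).+1 * 'C(2 * m, m))%N.
  have := mul_bin_down (2 * m).+1 m; have -> : ((2 * m).+1 - m = m.+1)%N by lia.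
  by move=> <-.
have e3 : m.+1%:R * (m.+1%:R * 'C(2 * m.+1, m.+1)%:R) = (2 * m.+1%:R) * ((2 * m%:R + 1) * 'C(2 * m, m)%:R) :> R.
  have -> : 2 * m%:R + 1 = (2 * m).+1%:R :> R by rewrite -[(2 * m).+1%:R]natr1 natrM.
  by rewrite -!natrM; congr (_%:R); rewrite e1 mulnCA e2.
have m0 : m.+1%:R != 0 :> R by rewrite pnatr_eq0.
have m2 : 2 * m%:R + 2 != 0 :> R.
  by have -> : 2 * m%:R + 2 = 2 * m.+1%:R :> R; [rewrite -[m.+1%:R]natr1; ring | rewrite mulf_neq0].
have p0 : 4 ^+ m != 0 :> R by rewrite expf_neq0.
have -> : 'C(2 * m.+1, m.+1)%:R = 2 * (2 * m%:R + 1) * 'C(2 * m, m)%:R / m.+1%:R :> R.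
  apply: (mulfI m0); apply: (mulfI m0); rewrite e3; field.
  by rewrite addrC natr1.
rewrite exprS; move: m0; rewrite -[m.+1%:R]natr1 => m0; field.
by rewrite p0 m2 m0.
Qed.

(** Wallis's sequence. Its convergence is monotone; the value 1 / pi of the limit is found only in
    [theta_functional]. *)
Definition centralq m : R := m%:R * central R m ^+ 2.

Lemma cvg_centralq : cvgn centralq.
Proof.
apply: nondecreasing_is_cvgn.
  apply: homo_leq => [//|x y z|m]; first exact: le_trans.
  rewrite /centralq centralS; have m0 : 0 <= m%:R :> R by [].
  move: (central R m) => c.
  have d0 : 0 < 2 * m%:R + 2 :> R by lra.
  have -> : m%:R * c ^+ 2 = c ^+ 2 * m%:R by ring.
  have -> : m.+1%:R * (c * ((2 * m%:R + 1) / (2 * m%:R + 2))) ^+ 2 =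
      c ^+ 2 * (m.+1%:R * ((2 * m%:R + 1) ^+ 2 / (2 * m%:R + 2) ^+ 2)) :> R by field; lra.
  apply: ler_wpM2l; first exact: sqr_ge0.
  rewrite -[m.+1%:R]natr1 mulrA ler_pdivlMr ?exprn_gt0 // !expr2; nra.
have key m : (2 * m%:R + 1) * central R m ^+ 2 <= 1.
  elim: m => [|m IH]; first by rewrite /central bin0 expr0 divr1 expr1n mulr0 add0r mulr1.
  apply: le_trans IH; rewrite centralS; have m0 : 0 <= m%:R :> R by [].
  move: (central R m) => c.
  have d0 : 0 < 2 * m%:R + 2 :> R by lra.
  have -> : (2 * m%:R + 1) * c ^+ 2 = c ^+ 2 * (2 * m%:R + 1) by ring.
  have -> : (2 * m.+1%:R + 1) * (c * ((2 * m%:R + 1) / (2 * m%:R + 2))) ^+ 2 =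
      c ^+ 2 * ((2 * m.+1%:R + 1) * (2 * m%:R + 1) ^+ 2 / (2 * m%:R + 2) ^+ 2) :> R by field; lra.
  apply: ler_wpM2l; first exact: sqr_ge0.
  rewrite -[m.+1%:R]natr1 ler_pdivrMr ?exprn_gt0 // !expr2; nra.
exists 1 => _ [m _ <-]; apply: le_trans (key m); apply: ler_wpM2r; first exact: sqr_ge0.
by have : 0 <= m%:R :> R by []; lra.
Qed.

End Theta.

(** * The functional equation of theta *)

Section ThetaLimit.
Variable R : realType.

Definition gauss (y : R) (l : nat) : R := expR (- (l.+1%:R ^+ 2 * y)).
Definition thetas (y : R) : R := limn (series (gauss y)).
Definition theta (y : R) : R := 1 + 2 * thetas y.

Lemma gauss_ge0 y l : 0 <= gauss y l. Proof. exact: expR_ge0. Qed.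

Lemma cvg_gauss (y : R) : 0 < y -> cvgn (series (gauss y)).
Proof.
move=> y0; have e1 : `|expR (- y)| < 1.
  by rewrite ger0_norm ?expR_ge0 // expR_lt1; lra.
apply: (series_le_cvg _ _ _ (is_cvg_geometric_series (a := 1) e1)) => l.
- exact: gauss_ge0.
- by rewrite /geometric /= mul1r exprn_ge0 // expR_ge0.
rewrite /geometric /= mul1r -expRM_natl ler_expR mulrN lerN2 ler_pM2r //.
by rewrite -natrX ler_nat; nia.
Qed.

Lemma thetas_ge0 y : 0 < y -> 0 <= thetas y.
Proof.
move=> y0; apply: limr_ge; first exact: cvg_gauss.
by near=> n; rewrite seriesEnat /=; apply: sumr_ge0 => l _; exact: gauss_ge0.
Unshelve. all: by end_near. Qed.

Section FixT.
Variable t : R.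
Hypothesis t0 : 0 < t.

(** [n] is odd as in [polya_identity] and [mu] = m / n^2 tends to t. The successor in [m] makes it
    positive and gives [mu >= t], on which the domination in [cvg_left] rests. *)
Let n (h : nat) := (2 * h).+1.
Let m (h : nat) := (Num.truncn (t * (n h)%:R ^+ 2)).+1.
Let i (h : nat) : R := (n h)%:R^-1.
Let mu (h : nat) : R := (m h)%:R * i h ^+ 2.

Let n0 h : 0 < (n h)%:R :> R. Proof. by rewrite ltr0n. Qed.
Let i0 h : 0 < i h. Proof. by rewrite invr_gt0. Qed.
Let ni h : (n h)%:R * i h = 1. Proof. by rewrite divff // gt_eqF. Qed.

Let i1 h : i h <= 1.
Proof. by rewrite invf_le1 // ler1n. Qed.

Let mu_bounds h : t <= mu h <= t + i h ^+ 2.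
Proof.
have tn : 0 <= t * (n h)%:R ^+ 2 by rewrite mulr_ge0 ?exprn_ge0 // ltW.
have /andP[h1 h2] := truncn_itv tn.
have -> : t = (t * (n h)%:R ^+ 2) * i h ^+ 2.
  by rewrite -mulrA -exprMn ni expr1n mulr1.
rewrite /mu -[X in _ + X]mul1r -mulrDl; apply/andP; split; apply: ler_wpM2r; rewrite ?sqr_ge0 //.
  exact: ltW.
by rewrite /m -natr1 lerD2r.
Qed.

Let cvg_i : i @ \oo --> 0.
Proof.
apply: (squeeze_cvgr (f := fun=> 0) (h := @harmonic R)); [|exact: cvg_cst|exact: cvg_harmonic].
near=> h; rewrite ltW //= /harmonic /= lef_pV2 ?posrE ?ltr0n // ler_nat /n; lia.
Unshelve. all: by end_near. Qed.

Let cvg_mu : mu @ \oo --> t.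
Proof.
apply: (squeeze_cvgr (f := fun=> t) (h := fun h => t + i h * i h)); [|exact: cvg_cst|].
  by near=> h; rewrite -expr2; exact: mu_bounds.
rewrite [X in _ --> X](_ : _ = t + 0 * 0); last by rewrite mulr0 addr0.
by apply: cvgD; [exact: cvg_cst | exact: cvgM].
Unshelve. all: by end_near. Qed.

(** Each term is (1 - sin^2)^m, where m times sin^2 tends to (j + 1)^2 pi^2 t. The terms are
    dominated by [gauss t], since sin(pi y) >= y for y = (j + 1)/n <= 1/2. *)
Let cvg_left : (fun h => \sum_(j < h) cos (pi * j.+1%:R / (n h)%:R) ^+ (2 * m h)) @ \oo -->
  thetas (pi ^+ 2 * t).
Proof.
pose s j h : R := sin (pi * j.+1%:R * i h) ^+ 2.
have cosE j h : cos (pi * j.+1%:R / (n h)%:R) ^+ (2 * m h) = (1 - s j h) ^+ m h.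
  by rewrite exprM cos2sin2.
have pi0 := pi_gt0 R.
have ms j : (fun h => (m h)%:R * s j h) @ \oo --> j.+1%:R ^+ 2 * (pi ^+ 2 * t).
  have nsin : (fun h => (n h)%:R * sin (pi * j.+1%:R * i h)) @ \oo --> pi * j.+1%:R.
    set a := pi * _; have a0 : 0 < a by rewrite mulr_gt0 // ltr0n.
    apply/cvgrPdist_le => e e0; have ea : 0 < e / a by rewrite divr_gt0.
    have [r r0 hr] := real_diff (is_derive_sin (0 : R)) ea.
    have : (fun h => a * i h) @ \oo --> a * 0 by apply: cvgM => //; exact: cvg_cst.
    rewrite mulr0 => /cvgrPdist_lt /(_ r r0); apply: filterS => h.
    rewrite sub0r normrN => /hr; rewrite add0r sin0 cos0 subr0 mul1r distrC.
    have ai : 0 < a * i h by rewrite mulr_gt0.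
    rewrite [X in _ <= _ * X]gtr0_norm // mulrA divfK ?gt_eqF // => hd.
    have nI y : `|y| * i h = `|y * i h| by rewrite normrM (gtr0_norm (i0 h)).
    rewrite -(ler_pM2r (i0 h)) nI mulrBl.
    by rewrite [_ * sin _ * i h]mulrAC ni mul1r.
  have -> : (fun h => (m h)%:R * s j h) =
     (fun h => mu h * (((n h)%:R * sin (pi * j.+1%:R * i h)) * ((n h)%:R * sin (pi * j.+1%:R * i h)))).
    apply/funext => h; rewrite /s /mu.
    have -> y : (m h)%:R * i h ^+ 2 * ((n h)%:R * y * ((n h)%:R * y)) =
      (m h)%:R * y ^+ 2 * ((n h)%:R * i h) ^+ 2 by ring.
    by rewrite ni expr1n mulr1.
  have -> : j.+1%:R ^+ 2 * (pi ^+ 2 * t) = t * ((pi * j.+1%:R) * (pi * j.+1%:R)) by ring.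
  by apply: cvgM => //; exact: cvgM.
have sc j : s j @ \oo --> 0.
  have e : s j = (fun h => (i h * i h) * (((m h)%:R * s j h) * (mu h)^-1)).
    apply/funext => h; have m0 : (m h)%:R != 0 :> R by rewrite pnatr_eq0.
    by rewrite /mu; field; rewrite m0 gt_eqF.
  rewrite e [X in _ --> X](_ : _ = 0 * 0 * (j.+1%:R ^+ 2 * (pi ^+ 2 * t) * t^-1)); last by rewrite !mul0r.
  apply: cvgM; first exact: cvgM.
  by apply: cvgM => //; apply: cvgV => //; rewrite gt_eqF.
have H := @tannery R (fun h j => cos (pi * j.+1%:R / (n h)%:R) ^+ (2 * m h)) (gauss (pi ^+ 2 * t)) (gauss t) id.
apply: (H _ _ _ (cvg_gauss t0)).2 => //.
- move=> j; under eq_fun => h do rewrite cosE.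
  by apply: cvg_one_sub_pow => // h; exact: sqr_ge0.
move=> h j jh; rewrite cosE.
have sj1 : s j h <= 1 by rewrite /s sin2cos2; have := sqr_ge0 (cos (pi * j.+1%:R * i h)); lra.
have s0 : 0 <= 1 - s j h by lra.
rewrite exprn_ge0 //=.
apply: le_trans (_ : expR (- s j h) ^+ m h <= _).
  by apply: lerXn2r; rewrite ?nnegrE ?expR_ge0 // expR_ge1Dx.
rewrite -expRM_natl /gauss ler_expR mulrN lerN2.
have x0 : 0 <= pi * j.+1%:R * i h by rewrite !mulr_ge0 // ltW.
have xh : pi * j.+1%:R * i h <= pi / 2.
  rewrite -mulrA; apply: ler_wpM2l; first exact: ltW.
  rewrite -[leRHS]mul1r ler_pdivlMr // /i mulrAC ler_pdivrMr // mul1r -natrM ler_nat /n; lia.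
have h1 : j.+1%:R * i h <= sin (pi * j.+1%:R * i h).
  apply: le_trans (sin_ge_half (introT andP (conj x0 xh))).
  rewrite -[pi * _ * _]mulrA.
  have := pi_ge2 R; have : 0 <= j.+1%:R * i h by rewrite mulr_ge0 // ltW.
  by move: (j.+1%:R * i h) => x hx; nra.
have h2 : (j.+1%:R * i h) ^+ 2 <= s j h.
  have y0 : 0 <= j.+1%:R * i h by rewrite mulr_ge0 // ltW.
  by apply: lerXn2r; rewrite ?nnegrE //; exact: le_trans h1.
apply: le_trans (_ : (m h)%:R * (j.+1%:R * i h) ^+ 2 <= _); last exact: ler_wpM2l.
have /andP[h3 _] := mu_bounds h.
have -> : (m h)%:R * (j.+1%:R * i h) ^+ 2 = j.+1%:R ^+ 2 * mu h by rewrite /mu; ring.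
by apply: ler_wpM2l => //; exact: sqr_ge0.
Qed.

(** The length [m h + h] meets the requirement [h <= L h] of [tannery] for every h; the terms beyond
    [m h] are 0. *)
Let cvg_right : (fun h => \sum_(l < m h + h) binratio R (m h) (n h * l.+1)) @ \oo --> thetas t^-1.
Proof.
have t10 : 0 < (2 * (t + 1))^-1 by rewrite invr_gt0 mulr_gt0 // addr_gt0.
have H := @tannery R (fun h l => binratio R (m h) (n h * l.+1)) (gauss t^-1) (gauss (2 * (t + 1))^-1)
  (fun h => m h + h)%N.
apply: (H _ _ _ (cvg_gauss t10)).2 => //; last by move=> h; lia.
- move=> l.
  have c1 : (fun h => mu h + l.+1%:R * i h) @ \oo --> t.
    rewrite [X in _ --> X](_ : _ = t + l.+1%:R * 0); last by rewrite mulr0 addr0.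
    by apply: cvgD => //; apply: cvgM => //; exact: cvg_cst.
  have c2 : (fun h => mu h - l.+1%:R * i h) @ \oo --> t.
    rewrite [X in _ --> X](_ : _ = t - l.+1%:R * 0); last by rewrite mulr0 subr0.
    by apply: cvgB => //; apply: cvgM => //; exact: cvg_cst.
  have ex (u : nat -> R) : u @ \oo --> t ->
      (fun h => expR (- (l.+1%:R ^+ 2 * (u h)^-1))) @ \oo --> gauss t^-1 l.
    move=> ut; apply: continuous_cvg; [exact: continuous_expR | apply: cvgN].
    by apply: cvgM; [exact: cvg_cst | apply: cvgV => //; rewrite gt_eqF].
  apply: squeeze_cvgr (ex _ c2) (ex _ c1).
  have /cvgr_gt /(_ 0 t0) := c2; apply: filterS => h hp.
  have i2 : i h != 0 by rewrite gt_eqF.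
  have km : (n h * l.+1 < m h)%N.
    rewrite -(ltr_nat R) natrM -(ltr_pM2r (x := i h ^+ 2)) ?exprn_gt0 // -/(mu h).
    have -> : (n h)%:R * l.+1%:R * i h ^+ 2 = l.+1%:R * i h :> R.
      by rewrite expr2 mulrACA ni mul1r.
    lra.
  have U := binratio_ub R (m := m h) (ltn0Sn _) (leqnn (n h * l.+1)) (ltnW km).
  have V := binratio_lb R (leqnn (n h * l.+1)) km.
  apply/andP; split; [apply: le_trans V | apply: le_trans U _]; rewrite ler_expR lerN2.
    have -> : (m h - n h * l.+1)%:R = (mu h - l.+1%:R * i h) * (n h)%:R ^+ 2 :> R.
      have -> : (mu h - l.+1%:R * i h) * (n h)%:R ^+ 2 = (m h)%:R * ((n h)%:R * i h) ^+ 2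
          - (n h)%:R * l.+1%:R * ((n h)%:R * i h) by rewrite /mu; ring.
      by rewrite ni expr1n !mulr1 natrB ?natrM // ltnW.
    rewrite natrM; apply: eq_ler; have := n0 h.
    pose x := mu h - l.+1%:R * i h; rewrite -/x in hp *.
    move: x hp ((n h)%:R : R) (l.+1%:R : R) => x hp k L k0; field.
    by rewrite !gt_eqF.
  have -> : (m h + n h * l.+1)%:R = (mu h + l.+1%:R * i h) * (n h)%:R ^+ 2 :> R.
    have -> : (mu h + l.+1%:R * i h) * (n h)%:R ^+ 2 = (m h)%:R * ((n h)%:R * i h) ^+ 2
        + (n h)%:R * l.+1%:R * ((n h)%:R * i h) by rewrite /mu; ring.
    by rewrite ni expr1n !mulr1 natrD natrM.
  have mu1 : 0 < mu h + l.+1%:R * i h.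
    by apply: lt_le_trans hp _; rewrite lerD2l; apply: (@le_trans _ _ 0);
      rewrite ?oppr_le0 mulr_ge0 // ltW.
  rewrite natrM; apply: eq_ler; have := n0 h.
  pose x := mu h + l.+1%:R * i h; rewrite -/x in mu1 *.
  move: x mu1 ((n h)%:R : R) (l.+1%:R : R) => x x0 k L k0; field.
  by rewrite !gt_eqF.
move=> h l _; rewrite binratio_ge0 /=.
have [km|mk] := leqP (n h * l.+1) (m h); last first.
  by rewrite /binratio bin_small ?mul0r ?gauss_ge0 //; lia.
apply: le_trans (binratio_ub R (m := m h) (ltn0Sn _) km (leqnn _)) _.
rewrite ler_expR lerN2.
have m0 : 0 < (m h)%:R :> R by rewrite ltr0n.
have mu0 : 0 < mu h by rewrite mulr_gt0 // exprn_gt0.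
have -> : (n h * l.+1)%:R ^+ 2 / (m h + m h)%:R = l.+1%:R ^+ 2 * (2 * mu h)^-1 :> R.
  rewrite natrM natrD /mu /i; have := n0 h.
  move: ((m h)%:R : R) m0 ((n h)%:R : R) (l.+1%:R : R) => M M0 k L k0; field.
  by rewrite !gt_eqF // addr_gt0.
apply: ler_wpM2l; first exact: sqr_ge0.
rewrite lef_pV2 ?posrE ?mulr_gt0 ?addr_gt0 //.
rewrite ler_pM2l //; have /andP[_ h1] := mu_bounds h; apply: le_trans h1 _; rewrite lerD2l.
by rewrite expr_le1 // ltW.
Qed.

(* Polya's proof: let [n -> oo] with [m ~ t n ^ 2] in [polya_identity], squared in
   order to have a limit of [m * central m ^ 2]. *)
Lemma theta_limit : t * theta (pi ^+ 2 * t) ^+ 2 = limn (@centralq R) * theta t^-1 ^+ 2.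
Proof.
have cq : (fun h => centralq R (m h)) @ \oo --> limn (@centralq R).
  have mh : m @ \oo --> \oo.
    apply/cvgnyPge => A; near=> h; rewrite /m.
    apply: ltnW; rewrite -(ltr_nat R).
    have tn : 0 <= t * (n h)%:R ^+ 2 by rewrite mulr_ge0 ?exprn_ge0 // ltW.
    have /andP[_ h2] := truncn_itv tn.
    have h3 : A%:R / t <= h%:R by near: h; exact: nbhs_infty_ger.
    have h4 : (h%:R : R) <= (n h)%:R ^+ 2 by rewrite -natrX ler_nat /n; nia.
    by apply: le_lt_trans h2; rewrite mulrC -ler_pdivrMr //; exact: le_trans h4.
  exact: (cvg_comp _ _ mh (@cvg_centralq R)).
have E h : mu h * (1 + 2 * (\sum_(j < h) cos (pi * j.+1%:R / (n h)%:R) ^+ (2 * m h))) ^+ 2 =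
    centralq R (m h) * (1 + 2 * \sum_(l < m h + h) binratio R (m h) (n h * l.+1)) ^+ 2.
  have -> : \sum_(l < m h + h) binratio R (m h) (n h * l.+1) = \sum_(l < m h) binratio R (m h) (n h * l.+1).
    rewrite big_split_ord /= [X in _ + X]big1 ?addr0 // => l _.
    by rewrite /binratio bin_small ?mul0r // /n; nia.
  rewrite polya_identity /mu /centralq -/(n h); move: (1 + _) => x.
  have -> a c : (m h)%:R * i h ^+ 2 * ((n h)%:R * a * c) ^+ 2 =
      (m h)%:R * a ^+ 2 * c ^+ 2 * ((n h)%:R * i h) ^+ 2 by ring.
  by rewrite ni expr1n mulr1.
have cl (u v : nat -> R) (w l : R) : u @ \oo --> l -> v @ \oo --> w ->
    (fun h => v h * (1 + 2 * u h) ^+ 2) @ \oo --> w * (1 + 2 * l) ^+ 2.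
  move=> ul vw; have c1 : (fun h => 1 + 2 * u h) @ \oo --> 1 + 2 * l.
    by apply: cvgD; [exact: cvg_cst | apply: cvgM => //; exact: cvg_cst].
  by apply: cvgM => //; rewrite expr2; apply: (cvgM c1 c1).
have L := cl _ _ _ _ cvg_left cvg_mu.
have Rr := cl _ _ _ _ cvg_right cq.
rewrite -(cvg_lim (@Rhausdorff R) L) -(cvg_lim (@Rhausdorff R) Rr).
by congr (lim (_ @ \oo)); apply/funext => h; exact: E.
Unshelve. all: by end_near. Qed.

End FixT.

Theorem theta_functional (x : R) : 0 < x ->
  theta (pi / x) = Num.sqrt x * theta (pi * x).
Proof.
move=> x0; have pi0 := pi_gt0 R.
have tp y : 0 < y -> 0 < theta y by move=> y0; rewrite /theta; have := thetas_ge0 y0; lra.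
(* At t = 1 / pi both sides of [theta_limit] contain the same positive factor [theta pi ^+ 2], which
   determines the constant. *)
have c : limn (@centralq R) = pi^-1.
  have ip : 0 < pi^-1 :> R by rewrite invr_gt0.
  have := theta_limit ip; rewrite invrK.
  have -> : pi ^+ 2 / pi = pi :> R by rewrite expr2 mulfK // gt_eqF.
  by move/mulIf => /(_ _) ->//; rewrite expf_neq0 // gt_eqF // tp.
have tx : 0 < x / pi by rewrite divr_gt0.
have := theta_limit tx; rewrite c invf_div.
have -> : pi ^+ 2 * (x / pi) = pi * x by rewrite mulrA mulrAC expr2 mulfK ?gt_eqF.
move=> e; have {}e : theta (pi / x) ^+ 2 = x * theta (pi * x) ^+ 2.
  have p0 : pi != 0 :> R by rewrite gt_eqF.
  have -> : theta (pi / x) ^+ 2 = pi * (pi^-1 * theta (pi / x) ^+ 2) by rewrite mulrA divff // mul1r.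
  by rewrite -e mulrA [pi * _]mulrCA divff // mulr1.
have h1 : 0 <= theta (pi / x) by apply/ltW/tp; rewrite divr_gt0.
have h2 : 0 <= theta (pi * x) by apply/ltW/tp; rewrite mulr_gt0.
rewrite -[LHS]ger0_norm // -sqrtr_sqr e sqrtrM ?ltW //.
by rewrite sqrtr_sqr ger0_norm.
Qed.

End ThetaLimit.

(** * The Mellin transform of the theta function *)

Section HalfLineIntegrals.
Local Open Scope ereal_scope.
Variable R : realType.
Local Notation mu := (@lebesgue_measure R).
Implicit Types (G : R -> R) (c a b : R).

Lemma cvg_seriesMr (x : nat -> R) (c l : R) : (series x @ \oo --> l ->
  series (fun k => x k * c) @ \oo --> l * c)%R.
Proof.
move=> h; have -> : (series (fun k => x k * c) = fun n => series x n * c)%R.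
  by apply/funext => n; rewrite !seriesEnat /= big_distrl.
by apply: cvgM; [exact: h | exact: cvg_cst].
Qed.

Lemma derive1_eq (f : R -> R) (x d : R) : is_derive x 1%R f d -> (derive1 f) x = d.
Proof. by move=> h; rewrite derive1E; exact: derive_val. Qed.

Lemma derivable_of_is_derive (f : R -> R) (x d : R) : is_derive x 1%R f d -> derivable f x 1%R.
Proof. by move=> []. Qed.

Lemma is_derive_cts (f : R -> R) (x d : R) : is_derive x 1%R f d -> {for x, continuous f}.
Proof. by move=> [h _]; apply/differentiable_continuous/derivable1_diffP. Qed.

Lemma cvg_right_of_cts (f : R -> R) (x : R) : {for x, continuous f} -> f y @[y --> x^'+] --> f x.
Proof. by move=> h; apply: cvg_within_filter; exact: h. Qed.

Lemma cvg_left_of_cts (f : R -> R) (x : R) : {for x, continuous f} -> f y @[y --> x^'-] --> f x.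
Proof. by move=> h; apply: cvg_within_filter; exact: h. Qed.

Lemma cts_within (D : set R) G : (forall x, D x -> {for x, continuous G}) -> {within D, continuous G}.
Proof. by move=> h; apply: continuous_in_subspaceT => x; rewrite inE => /h. Qed.

Lemma cts_measurable (D : set R) G : open D -> (forall x, D x -> {for x, continuous G}) -> measurable_fun D G.
Proof. by move=> oD h; apply: open_continuous_measurable_fun => // x; rewrite inE => /h. Qed.

Lemma pos_measurable (D : set R) G : measurable D -> (forall x, D x -> (0 < x)%R) ->
  (forall x : R, (0 < x)%R -> {for x, continuous G}) -> measurable_fun D G.
Proof.
move=> mD D0 cG.
have m0 : measurable_fun (`]0%R, +oo[%classic : set R) G.
  by apply: cts_measurable; [exact: interval_open | move=> x; rewrite /= in_itv /= andbT => /cG].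
apply: measurable_funS m0 => //.
by move=> x /D0; rewrite /= in_itv /= => ->.
Qed.

Lemma integral_scale c G : (0 < c)%R -> (forall x : R, (0 < x)%R -> {for x, continuous G}) ->
  (forall x : R, (0 < x)%R -> (0 <= G x)%R) ->
  \int[mu]_(x in `[c, +oo[) (G x)%:E = \int[mu]_(x in `[1%R, +oo[) (G (c * x) * c)%:E.
Proof.
move=> c0 cG G0; pose F (x : R) := (c * x)%R.
have dF (x : R) : is_derive x 1%R F c.
  rewrite -[X in is_derive _ _ _ X]mulr1 /F.
  by have := is_deriveM (is_derive_cst c x 1%R) (is_derive_id x 1%R); rewrite scaler0 addr0.
have F' : (derive1 F) = cst c by apply/funext => x; exact: derive1_eq (dF x).
have F1 : F 1%R = c by rewrite /F mulr1.
have := @increasing_ge0_integration_by_substitutiony R F G 1%R.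
rewrite F1 F' => -> //.
- by move=> x y _ _ xy; rewrite /F ltr_pM2l.
- by move=> x _; exact: cvg_cst.
- exact: is_cvg_cst.
- exact: is_cvg_cst.
- split; first by move=> x _; exact: derivable_of_is_derive (dF x).
  exact/cvg_right_of_cts/(is_derive_cts (dF _)).
- by apply: gt0_cvgMry; [exact: c0 | exact: cvg_id].
- by apply: cts_within => x; rewrite /= in_itv /= andbT => cx; apply: cG; exact: lt_le_trans cx.
- by move=> x; rewrite in_itv /= andbT => cx; apply: G0; exact: lt_trans cx.
Qed.

Lemma integral_inversion c G : (0 < c)%R -> (forall x : R, (0 < x)%R -> {for x, continuous G}) ->
  (forall x : R, (0 < x)%R -> (0 <= G x)%R) ->
  \int[mu]_(x in `]0%R, c]) (G x)%:E = \int[mu]_(x in `[1%R, +oo[) (G (c / x) * (c / x ^+ 2))%:E.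
Proof.
move=> c0 cG G0.
pose H (x : R) := (G (c / x) * (c / x ^+ 2))%R.
have cinv (x : R) : (0 < x)%R -> {for x, continuous (fun x : R => c / x)%R}.
  move=> x0; apply: cvgM; [exact: cvg_cst | apply: cvgV; [by rewrite gt_eqF | exact: cvg_id]].
have cinv2 (x : R) : (0 < x)%R -> {for x, continuous (fun x : R => c / x ^+ 2)%R}.
  move=> x0; apply: cvgM; [exact: cvg_cst | apply: cvgV; first by rewrite expf_neq0 // gt_eqF].
  exact: exprn_continuous.
have cH (x : R) : (0 < x)%R -> {for x, continuous H}.
  move=> x0; apply: cvgM; last exact: cinv2.
  apply: (continuous_comp (f := fun x : R => (c / x)%R) (g := G)); first exact: cinv.
  by apply: cG; rewrite divr_gt0.
have H0 (x : R) : (0 < x)%R -> (0 <= H x)%R.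
  by move=> x0; rewrite mulr_ge0 ?divr_ge0 ?exprn_ge0 ?G0 ?ltW // divr_gt0.
(* The decreasing substitution c / x is made on compact intervals; both sides then increase to the
   full integrals. *)
have fin n : \int[mu]_(x in `[(c / n.+1%:R)%R, c]) (G x)%:E =
    \int[mu]_(x in `[1%R, n.+1%:R]) (H x)%:E.
  pose F (x : R) := (c / x)%R.
  have dF (x : R) : (0 < x)%R -> is_derive x 1%R F (- (c / x ^+ 2))%R.
    move=> x0; have x1 : x != 0%R by rewrite gt_eqF.
    have := is_deriveM (is_derive_cst c x 1%R) (is_deriveV x1 (is_derive_id x 1%R)).
    by rewrite scaler0 addr0 /GRing.scale /= mulr1 mulrN.
  have F' (x : R) : (0 < x)%R -> (derive1 F) x = (- (c / x ^+ 2))%R by move=> /dF/derive1_eq.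
  have F1 : F 1%R = c by rewrite /F divr1.
  have cF' (x : R) : (0 < x)%R -> {for x, continuous (derive1 F)}.
    move=> x0; suff: derive1 F y @[y --> x] --> (- (c / x ^+ 2))%R by rewrite -F'.
    have C : (- (c / y ^+ 2))%R @[y --> x] --> (- (c / x ^+ 2))%R by apply: cvgN; exact: (cinv2 x x0).
    apply: cvg_trans C; apply: near_eq_cvg; near=> y; rewrite F' //.
    by near: y; have /cvgr_gt := @cvg_id _ (nbhs x); exact.
  have n1 : (1 <= n.+1%:R :> R)%R by rewrite ler1n.
  have := @integration_by_substitution_decreasing R F G 1%R n.+1%:R n1.
  rewrite F1 -/(F n.+1%:R) => -> //.
  - apply: eq_integral => x; rewrite inE /= in_itv /= => /andP[x1 _].
    by rewrite !fctE /= F' ?opprK // (lt_le_trans ltr01).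
  - move=> x y; rewrite !in_itv /= => /andP[x1 _] /andP[y1 _] xy.
    rewrite /F ltr_pM2l // ltf_pV2 // posrE; exact: lt_le_trans ltr01 _.
  - by move=> x; rewrite in_itv /= => /andP[x1 _]; apply: cF'; exact: lt_trans x1.
  - by apply: cvgP; apply: cvg_right_of_cts; exact: cF'.
  - by apply: cvgP; apply: cvg_left_of_cts; apply: cF'.
  - split.
    + move=> x; rewrite in_itv /= => /andP[x1 _]; apply: derivable_of_is_derive (dF x _); exact: lt_trans x1.
    + exact/cvg_right_of_cts/(is_derive_cts (dF _ _)).
    + by apply/cvg_left_of_cts/(is_derive_cts (dF _ _)).
  - apply: cts_within => x; rewrite /= in_itv /= => /andP[x1 _]; apply: cG; apply: lt_le_trans x1.
    by rewrite divr_gt0.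
have A : \int[mu]_(x in `[(c / n.+1%:R)%R, c]) (G x)%:E @[n --> \oo] --> \int[mu]_(x in `]0%R, c]) (G x)%:E.
  have -> : `]0%R, c]%classic = \bigcup_n `[(c / n.+1%:R)%R, c]%classic.
    apply/seteqP; split => x /=; rewrite !in_itv /=.
      move=> /andP[x0 xc]; exists (Num.truncn (c / x)%R) => //=; rewrite in_itv /= xc andbT.
      rewrite ler_pdivrMr // mulrC -ler_pdivrMr //; apply: ltW; exact: truncnS_gt.
    by move=> [n _] /=; rewrite in_itv /= => /andP[h ->]; rewrite andbT; apply: lt_le_trans h; rewrite divr_gt0.
  apply: ge0_nondecreasing_set_cvg_integral => //.
  - move=> n m nm; rewrite subsetEset => x /=; rewrite !in_itv /= => /andP[h ->]; rewrite andbT.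
    by apply: le_trans h; rewrite ler_pM2l // lef_pV2 ?posrE // ler_nat.
  - move=> n; apply/measurable_EFinP; apply: pos_measurable => // x; rewrite /= in_itv /= => /andP[h _].
    by apply: lt_le_trans h; rewrite divr_gt0.
  - move=> n x; rewrite /= in_itv /= => /andP[h _]; rewrite lee_fin G0 //.
    by apply: lt_le_trans h; rewrite divr_gt0.
have B : \int[mu]_(x in `[1%R, n.+1%:R]) (H x)%:E @[n --> \oo] --> \int[mu]_(x in `[1%R, +oo[) (H x)%:E.
  have -> : `[1%R, +oo[%classic = \bigcup_n `[1%R, n.+1%:R : R]%classic.
    apply/seteqP; split => x /=; rewrite !in_itv /= ?andbT.
      move=> x1; exists (Num.truncn x) => //=; rewrite in_itv /= x1 /=; apply: ltW; exact: truncnS_gt.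
    by move=> [n _] /=; rewrite in_itv /= => /andP[].
  apply: ge0_nondecreasing_set_cvg_integral => //.
  - move=> n m nm; rewrite subsetEset => x /=; rewrite !in_itv /= => /andP[-> h] /=.
    by apply: le_trans h _; rewrite ler_nat.
  - move=> n; apply/measurable_EFinP; apply: pos_measurable => // x; rewrite /= in_itv /= => /andP[h _].
    exact: lt_le_trans h.
  - move=> n x; rewrite /= in_itv /= => /andP[h _]; rewrite lee_fin H0 //; exact: lt_le_trans h.
rewrite -(cvg_lim (@ereal_hausdorff R) A) -(cvg_lim (@ereal_hausdorff R) B).
by congr (lim (_ @ \oo)); apply/funext => n; exact: fin.
Unshelve. all: by end_near. Qed.

End HalfLineIntegrals.

Section Mellin.
Local Open Scope ereal_scope.
Variable R : realType.
Local Notation mu := (@lebesgue_measure R).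
Local Notation I1 := (`[1%R, +oo[%classic : set R).

Lemma nneseries_EFin (a : nat -> R) (l : R) : (series a @ \oo --> l)%R ->
  \sum_(n <oo) (a n)%:E = l%:E.
Proof.
move=> alpha; have -> : (fun n => \sum_(0 <= i < n) (a i)%:E) = EFin \o series a.
  by apply/funext => n; rewrite /= seriesEnat sumEFin.
by rewrite EFin_lim; [rewrite (cvg_lim _ alpha) | exact: cvgP alpha].
Qed.

(** For x > 0 this is x^a exp(- c x), and [pexpV] below is x^a exp(- c / x). *)
Definition pexp (a c x : R) : R := expR (a * ln x - c * x).

Lemma pexp_ge0 a c x : (0 <= pexp a c x)%R. Proof. exact: expR_ge0. Qed.

Lemma cts_pexp (a c x : R) : (0 < x)%R -> {for x, continuous (pexp a c)}.
Proof.
move=> x0; apply: (continuous_comp (g := expR)); last exact: continuous_expR.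
apply: cvgB; first by apply: cvgM; [exact: cvg_cst | exact: continuous_ln].
by apply: cvgM; [exact: cvg_cst | exact: cvg_id].
Qed.

Definition pexpV (a c x : R) : R := expR (a * ln x - c / x).

Lemma cts_pexpV (a c x : R) : (0 < x)%R -> {for x, continuous (pexpV a c)}.
Proof.
move=> x0; apply: (continuous_comp (g := expR)); last exact: continuous_expR.
apply: cvgB; first by apply: cvgM; [exact: cvg_cst | exact: continuous_ln].
by apply: cvgM; [exact: cvg_cst | apply: cvgV; [rewrite gt_eqF | exact: cvg_id]].
Qed.

Definition egamma (s : R) : \bar R := \int[mu]_(x in `]0%R, +oo[) (pexp (s - 1) 1 x)%:E.

Lemma pos1 (x : R) : I1 x -> (0 < x)%R.
Proof. by rewrite /= in_itv /= andbT; exact: lt_le_trans. Qed.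

Lemma measurable_pos1 (G : R -> R) : (forall x : R, (0 < x)%R -> {for x, continuous G}) ->
  measurable_fun I1 (EFin \o G).
Proof. by move=> cG; apply/measurable_EFinP; apply: pos_measurable => //; exact: pos1. Qed.

(** Up to the factor c^s this is the integral of x^(s-1) exp(- c x) over (0, oo), cut at 1 with (0,
    1] folded onto [1, oo) by inversion. Both pieces are nonnegative, so the identity holds in the
    extended reals. *)
Lemma egamma_split (c s : R) : (0 < c)%R ->
  egamma s = (expR (s * ln c))%:E *
   (\int[mu]_(x in I1) (pexp (s - 1) c x)%:E +
    \int[mu]_(x in I1) (pexpV (- s - 1) c x)%:E).
Proof.
move=> c0.
have cp := @cts_pexp (s - 1) 1.
have pp (x : R) : (0 < x)%R -> (0 <= pexp (s - 1) 1 x)%R by move=> _; exact: pexp_ge0.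
have -> : egamma s = \int[mu]_(x in `]0%R, c]) (pexp (s - 1) 1 x)%:E +
    \int[mu]_(x in `[c, +oo[) (pexp (s - 1) 1 x)%:E.
  rewrite -integral_itv_obnd_cbnd; last first.
    apply/measurable_EFinP; apply: pos_measurable => // x; rewrite /= in_itv /= andbT; exact: lt_trans.
  rewrite -ge0_integral_setU //=.
  - by rewrite /egamma -itv_bndbnd_setU // bnd_simp ltW.
  - apply/measurable_EFinP; apply: pos_measurable => //; first exact: measurableU.
    by move=> x [] /=; rewrite in_itv /=; [move=> /andP[] | rewrite andbT; exact: lt_trans].
  - by move=> x _; rewrite lee_fin pexp_ge0.
  - apply/disj_setPS => x [] /=; rewrite !in_itv /= andbT => /andP[_ h1] h2.
    by have := le_lt_trans h1 h2; rewrite ltxx.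
rewrite integral_inversion // integral_scale // addeC ge0_muleDr; last 2 first.
- by apply: integral_ge0 => x _; rewrite lee_fin pexp_ge0.
- by apply: integral_ge0 => x _; rewrite lee_fin expR_ge0.
congr (_ + _); rewrite -ge0_integralZl_EFin ?expR_ge0 //.
- apply: eq_integral => x; rewrite inE => /pos1 x0; rewrite -EFinM; congr EFin.
  rewrite /pexp -expRD -[in LHS](lnK c0) -expRD lnM ?posrE ?expR_gt0 // expRK lnK //.
  by congr expR; ring.
- by move=> x _; rewrite lee_fin pexp_ge0.
- by apply: measurable_pos1 => x; exact: cts_pexp.
- apply: eq_integral => x; rewrite inE => /pos1 x0; rewrite -EFinM; congr EFin.
  have -> : (c / x ^+ 2)%R = expR (ln c - 2 * ln x).
    by rewrite expRB lnK // expRM_natl lnK.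
  rewrite /pexp /pexpV -!expRD ln_div ?posrE //.
  by congr expR; ring.
- by move=> x _; rewrite lee_fin expR_ge0.
- by apply: measurable_pos1 => x; exact: cts_pexpV.
Qed.

Definition omega (x : R) : R := thetas (pi * x).
Definition theta_rate (k : nat) : R := (pi * k.+1%:R ^+ 2)%R.

Lemma theta_rate_gt0 k : (0 < theta_rate k)%R.
Proof. by rewrite mulr_gt0 ?pi_gt0 // exprn_gt0 // ltr0n. Qed.

Lemma cvg_omega (x : R) : (0 < x)%R -> (series (fun k => expR (- (theta_rate k * x))) @ \oo --> omega x)%R.
Proof.
move=> x0; have px : (0 < pi * x)%R by rewrite mulr_gt0 // pi_gt0.
have := cvg_gauss px; rewrite -/(omega x) => h.
have -> : (fun k => expR (- (theta_rate k * x))) = gauss (pi * x).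
  by apply/funext => k; rewrite /gauss /theta_rate; congr expR; ring.
exact: h.
Qed.

Lemma omega_ge0 x : (0 < x)%R -> (0 <= omega x)%R.
Proof. by move=> x0; apply: thetas_ge0; rewrite mulr_gt0 // pi_gt0. Qed.

Lemma omega_inv (x : R) : (0 < x)%R ->
  omega x^-1 = (expR (ln x / 2) * omega x + (expR (ln x / 2) - 1) / 2)%R.
Proof.
move=> x0; have := theta_functional x0; rewrite /theta -/(omega x) -/(omega x^-1).
have -> : Num.sqrt x = expR (ln x / 2).
  have e : (expR (ln x / 2) ^+ 2 = x)%R by rewrite -expRM_natl mulrCA divff ?mulr1 // lnK.
  by rewrite -{1}e sqrtr_sqr ger0_norm ?expR_ge0.
lra.
Qed.

Lemma measurable_omega : measurable_fun I1 omega.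
Proof.
apply: (@measurable_fun_cvg _ _ _ _ (fun n x => series (fun k => expR (- (theta_rate k * x))) n)%R).
  move=> n.
  have -> : (fun x => series (fun k => expR (- (theta_rate k * x))) n)%R =
      (fun x => \sum_(k < n) expR (- (theta_rate k * x)))%R by apply/funext => x; rewrite seriesEord.
  apply: pos_measurable => //; first exact: pos1.
  move=> x x0; apply: cvg_big => [|k _]; first exact: add_continuous.
  apply: continuous_cvg; first exact: continuous_expR.
  by apply: cvgN; apply: cvgM; [exact: cvg_cst | exact: cvg_id].
by move=> x /pos1/cvg_omega.
Qed.

Lemma series_omega_pexp (a x : R) : (0 < x)%R ->
  \sum_(k <oo) (pexp a (theta_rate k) x)%:E = (expR (a * ln x) * omega x)%:E.
Proof.
move=> x0; apply: nneseries_EFin.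
have -> : series (fun k => pexp a (theta_rate k) x) =
    (fun n => expR (a * ln x) * series (fun k => expR (- (theta_rate k * x))) n)%R.
  apply/funext => n; rewrite !seriesEnat /= big_distrr /=; apply: eq_bigr => k _.
  by rewrite /pexp expRD.
by apply: cvgM; [exact: cvg_cst | exact: cvg_omega].
Qed.

Lemma series_omega_pexpV (a x : R) : (0 < x)%R ->
  \sum_(k <oo) (pexpV a (theta_rate k) x)%:E = (expR (a * ln x) * omega x^-1)%:E.
Proof.
move=> x0; apply: nneseries_EFin.
have -> : series (fun k => pexpV a (theta_rate k) x) =
    (fun n => expR (a * ln x) * series (fun k => expR (- (theta_rate k * x^-1))) n)%R.
  apply/funext => n; rewrite !seriesEnat /= big_distrr /=; apply: eq_bigr => k _.
  by rewrite /pexpV expRD.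
by apply: cvgM; [exact: cvg_cst | apply: cvg_omega; rewrite invr_gt0].
Qed.

(** The left-hand side is pi^(- s) Gamma(s) zeta(2 s), termwise in the Dirichlet series. *)
Lemma mellin_sum (s : R) :
  \sum_(k <oo) ((expR (- (s * ln (theta_rate k))))%:E * egamma s) =
  \int[mu]_(x in I1) (expR ((s - 1) * ln x) * omega x + expR ((- s - 1) * ln x) * omega x^-1)%:E.
Proof.
transitivity (\sum_(k <oo) \int[mu]_(x in I1) ((pexp (s - 1) (theta_rate k) x)%:E + (pexpV (- s - 1) (theta_rate k) x)%:E)).
  apply: eq_eseriesr => k _; rewrite (egamma_split _ (theta_rate_gt0 k)) muleA -EFinM -expRD addNr expR0 mul1e.
  rewrite ge0_integralD //.
  - by move=> x _; rewrite lee_fin pexp_ge0.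
  - by apply: measurable_pos1 => x; exact: cts_pexp.
  - by move=> x _; rewrite lee_fin expR_ge0.
  - by apply: measurable_pos1 => x; exact: cts_pexpV.
rewrite -integral_nneseries //; last 2 first.
- move=> k; apply: emeasurable_funD; apply: measurable_pos1 => x; [exact: cts_pexp | exact: cts_pexpV].
- by move=> k x _; rewrite adde_ge0 // lee_fin expR_ge0.
apply: eq_integral => x; rewrite inE => /pos1 x0.
rewrite nneseriesD; last 2 first.
- by move=> k _; rewrite lee_fin expR_ge0.
- by move=> k _; rewrite lee_fin expR_ge0.
by rewrite series_omega_pexp // series_omega_pexpV.
Qed.

(** This is the contribution of (sqrt x - 1)/2 in [omega_inv]. Its value 1/(2 s (2 s - 1)),
    multiplied by the factor 2 s (2 s - 1)/2 of xi, gives the constant 1/2. The two powers stay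
    together so that the integrand is nonnegative. *)
Lemma integral_power_diff (s : R) : (1 < s)%R ->
  \int[mu]_(x in I1) ((expR ((- s - 1/2) * ln x) - expR ((- s - 1) * ln x)) / 2)%:E =
  ((2 * s - 1)^-1 - (2 * s)^-1)%:E.
Proof.
move=> s1.
have s12 : (s - 1/2 != 0)%R by lra.
have s0 : (s != 0)%R by lra.
pose F (x : R) := ((expR (- s * ln x) / s - expR ((- s + 1/2) * ln x) / (s - 1/2)) / 2)%R.
have dE (a x : R) : (0 < x)%R -> is_derive x 1%R (fun x : R => expR (a * ln x)) (a * expR ((a - 1) * ln x))%R.
  move=> x0; have dl := is_derive1_ln x0.
  have d1 : is_derive x 1%R (fun x : R => a * ln x)%R (a / x)%R.
    have := is_deriveM (is_derive_cst a x 1%R) dl.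
    by rewrite scaler0 addr0.
  have := @is_derive1_comp _ expR (fun x : R => a * ln x)%R x _ _ (is_derive_expR _) d1.
  rewrite mulrCA; suff -> : (expR (a * ln x) / x)%R = expR ((a - 1) * ln x) by [].
  by rewrite mulrBl mul1r expRB lnK.
have dF (x : R) : (0 < x)%R -> is_derive x 1%R F ((expR ((- s - 1/2) * ln x) - expR ((- s - 1) * ln x)) / 2)%R.
  move=> x0.
  have e1 := is_deriveM (dE (- s)%R x x0) (is_derive_cst s^-1%R x 1%R).
  have e2 := is_deriveM (dE (- s + 1/2)%R x x0) (is_derive_cst (s - 1/2)^-1%R x 1%R).
  have := is_deriveM (is_deriveB e1 e2) (is_derive_cst (2^-1 : R)%R x 1%R).
  rewrite !scaler0 !add0r /GRing.scale /=.
  have -> : (- s + 1 / 2 - 1 = - s - 1/2)%R by lra.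
  set d := (X in is_derive _ _ _ X); suff -> : d = ((expR ((- s - 1/2) * ln x) - expR ((- s - 1) * ln x)) / 2)%R by [].
  by rewrite /d; field; rewrite s0; move: s12; lra.
have lim0 (a : R) : (a < 0)%R -> expR (a * ln x) @[x --> +oo%R] --> (0 : R)%R.
  move=> a0; apply/cvgrPdist_lt => e e0; near=> x.
  rewrite sub0r normrN ger0_norm ?expR_ge0 // -[ltRHS](lnK e0) ltr_expR mulrC -ltr_ndivrMr //.
  have xe : (expR (ln e / a) < x)%R by near: x; exact: nbhs_pinfty_gt.
  rewrite -[ltLHS]expRK ltr_ln ?posrE ?expR_gt0 //; by apply: lt_trans xe; rewrite expR_gt0.
rewrite (@ge0_continuous_FTC2y R _ F 1%R 0%R).
- rewrite /F ln1 !mulr0 expR0 -EFinB; congr EFin; field.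
  by rewrite s0 /=; lra.
- move=> x x1; have x0 : (0 < x)%R by apply: lt_le_trans x1.
  rewrite divr_ge0 // subr_ge0 ler_expR ler_wpM2r ?ln_ge0 //; lra.
- apply: cts_within => x /pos1 x0.
  have cE (a : R) : {for x, continuous (fun x : R => expR (a * ln x))} := is_derive_cts (dE a x x0).
  by apply: cvgM; [apply: cvgB; exact: cE | exact: cvg_cst].
- rewrite /F [X in _ --> X](_ : _ = (0 / s - 0 / (s - 1/2)) / 2)%R; last by rewrite !mul0r subr0 mul0r.
  apply: cvgM; last exact: cvg_cst.
  by apply: cvgB; apply: cvgM; try exact: cvg_cst; apply: lim0; lra.
- by move=> x x1; apply: derivable_of_is_derive (dF x _); exact: lt_trans x1.
- by apply: cvg_right_of_cts; apply: is_derive_cts (dF 1%R _).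
- move=> x; rewrite in_itv /= andbT => x1; apply: derive1_eq; apply: dF; exact: lt_trans x1.
Unshelve. all: by end_near. Qed.

End Mellin.

(** * Expansion in moments and their finiteness *)

Section Moments.
Local Open Scope ereal_scope.
Variable R : realType.
Local Notation mu := (@lebesgue_measure R).
Local Notation I1 := (`[1%R, +oo[%classic : set R).

Lemma cvg_cosh_series (y : R) :
  (series (fun k => 2 * y ^+ (2 * k) / (2 * k)`!%:R) @ \oo --> expR y + expR (- y))%R.
Proof.
have ev (z : R) : ((fun n => series (exp_coeff z) (2 * n)%N) @ \oo --> expR z)%R.
  have h : series (exp_coeff z) @ \oo --> expR z by exact: is_cvg_series_exp_coeff.
  apply: (cvg_comp (fun n => (2 * n)%N) _ _ h).
  by apply/cvgnyPge => A; near=> n; apply: leq_trans (leq_pmull n (isT : (0 < 2)%N)); near: n; exact: nbhs_infty_ge.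
have -> : series (fun k => 2 * y ^+ (2 * k) / (2 * k)`!%:R)%R =
  (fun n => series (exp_coeff y) (2 * n)%N + series (exp_coeff (- y)) (2 * n)%N)%R.
  apply/funext => n; elim: n => [|n IH].
    by rewrite !seriesEnat /= muln0 !big_geq // addr0.
  have -> : (2 * n.+1 = (2 * n).+2)%N by lia.
  rewrite !seriesSr IH.
  move: (series (exp_coeff y) _) (series (exp_coeff (- y)) _) => p q.
  rewrite /exp_coeff /= !exprS !exprM sqrrN; ring.
exact: cvgD.
Unshelve. all: by end_near. Qed.

Definition moment_density (k : nat) (x : R) : R := (omega x * expR (- (3/4) * ln x) * ln x ^+ (2 * k))%R.
Definition emoment (k : nat) : \bar R := \int[mu]_(x in I1) (moment_density k x)%:E.
(** The coefficient of (ln x)^(2 k) in 2 cosh((u / 2) ln x). *)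
Definition cosh_coef (u : R) (k : nat) : R := (2 * (u / 2) ^+ (2 * k) / (2 * k)`!%:R)%R.

Lemma cosh_coef_gt0 u k : (0 < u)%R -> (0 < cosh_coef u k)%R.
Proof. by move=> u0; rewrite !mulr_gt0 ?exprn_gt0 ?invr_gt0 ?ltr0n ?fact_gt0 // divr_gt0. Qed.

Lemma moment_density_ge0 k x : (1 <= x)%R -> (0 <= moment_density k x)%R.
Proof.
move=> x1; rewrite !mulr_ge0 ?expR_ge0 ?exprn_ge0 ?ln_ge0 //.
by apply: omega_ge0; exact: lt_le_trans x1.
Qed.

Lemma I1_ge1 (x : R) : I1 x -> (1 <= x)%R.
Proof. by rewrite /= in_itv /= andbT. Qed.

Lemma measurable_moment_density k : measurable_fun I1 (moment_density k).
Proof.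
apply: measurable_funM; first apply: measurable_funM.
- exact: measurable_omega.
- apply: pos_measurable => //; first exact: pos1.
  move=> x x0; apply: continuous_cvg; first exact: continuous_expR.
  by apply: cvgM; [exact: cvg_cst | exact: continuous_ln].
- apply: pos_measurable => //; first exact: pos1.
  move=> x x0; apply: (continuous_comp (g := fun y : R => (y ^+ (2 * k))%R)); first exact: continuous_ln.
  exact: exprn_continuous.
Qed.

Lemma emoment_ge0 k : 0 <= emoment k.
Proof. by apply: integral_ge0 => x /I1_ge1 x1; rewrite lee_fin moment_density_ge0. Qed.

(** With 2 s = u + 1/2, the functional equation of theta makes the powers symmetric: omega is
    multiplied by x^(- 3/4) (x^(u/2) + x^(- u/2)). The hyperbolic cosine has nonnegative Taylor
    terms, so its expansion may be integrated termwise. *)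
Lemma mellin_moments (u : R) : (2 <= u)%R ->
  let s := (u / 2 + 1 / 4)%R in
  \sum_(k <oo) ((expR (- (s * ln (theta_rate R k))))%:E * egamma s) =
  \sum_(k <oo) ((cosh_coef u k)%:E * emoment k) + ((2 * s - 1)^-1 - (2 * s)^-1)%:E.
Proof.
move=> u2 s; have u0 : (0 < u)%R by lra.
have s1 : (1 < s)%R by rewrite /s; lra.
rewrite mellin_sum.
pose G (x : R) := (omega x * expR (- (3/4) * ln x) * (expR (u / 2 * ln x) + expR (- (u / 2 * ln x))))%R.
pose H (x : R) := ((expR ((- s - 1/2) * ln x) - expR ((- s - 1) * ln x)) / 2)%R.
have H0 (x : R) : I1 x -> (0 <= H x)%R.
  move=> /I1_ge1 x1; rewrite divr_ge0 // subr_ge0 ler_expR ler_wpM2r ?ln_ge0 //; lra.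
have cE (a x : R) : (0 < x)%R -> {for x, continuous (fun x : R => expR (a * ln x))}.
  move=> x0; apply: continuous_cvg; first exact: continuous_expR.
  by apply: cvgM; [exact: cvg_cst | exact: continuous_ln].
have mH : measurable_fun I1 (EFin \o H).
  by apply: measurable_pos1 => x x0; apply: cvgM; [apply: cvgB; exact: cE | exact: cvg_cst].
have sumG (x : R) : I1 x -> \sum_(k <oo) (cosh_coef u k * moment_density k x)%:E = (G x)%:E.
  move=> x1; apply: nneseries_EFin.
  have -> : series (fun k => cosh_coef u k * moment_density k x)%R = (fun n => omega x * expR (- (3/4) * ln x) *
      series (fun k => 2 * (u / 2 * ln x) ^+ (2 * k) / (2 * k)`!%:R) n)%R.
    apply/funext => n; rewrite !seriesEnat /= big_distrr /=; apply: eq_bigr => k _.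
    rewrite /cosh_coef /moment_density [((u / 2 * _) ^+ _)%R]exprMn; ring.
  by apply: cvgM; [exact: cvg_cst | exact: cvg_cosh_series].
rewrite -(integral_power_diff s1) -/H.
transitivity (\int[mu]_(x in I1) ((\sum_(k <oo) (cosh_coef u k * moment_density k x)%:E) + (H x)%:E)).
  apply: eq_integral => x; rewrite inE => x1; rewrite sumG // -EFinD; congr EFin.
  rewrite (omega_inv (pos1 x1)) /G /H.
  have -> : ((s - 1) * ln x = - (3/4) * ln x + u / 2 * ln x)%R by rewrite /s; field.
  have -> : ((- s - 1) * ln x = - (3/4) * ln x - u / 2 * ln x - ln x / 2)%R by rewrite /s; field.
  have -> : ((- s - 1/2) * ln x = - (3/4) * ln x - u / 2 * ln x)%R by rewrite /s; field.
  rewrite !expRD; set a := expR (- (3/4) * _); set b := expR (u / 2 * _); set c := expR (- (u / 2 * _)).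
  have e : (expR (- (ln x / 2)) * expR (ln x / 2) = 1)%R by rewrite -expRD addNr expR0.
  move: e; set d := expR (ln x / 2); set d' := expR (- _) => e.
  transitivity (a * b * omega x + a * c * (d' * d) * omega x + a * c * (d' * d - d') / 2)%R.
    by field.
  by rewrite e; field.
have mT k : measurable_fun I1 (fun x => (cosh_coef u k * moment_density k x)%:E).
  by apply/measurable_EFinP; apply: measurable_funM => //; exact: measurable_moment_density.
have T0 k x : I1 x -> 0 <= (cosh_coef u k * moment_density k x)%:E.
  by move=> /I1_ge1 x1; rewrite lee_fin mulr_ge0 ?moment_density_ge0 // ltW // cosh_coef_gt0.
rewrite ge0_integralD //=.
- rewrite integral_nneseries //; congr (_ + _).
  apply: eq_eseriesr => k _; rewrite -ge0_integralZl_EFin //.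
  + by move=> x /I1_ge1 x1; rewrite lee_fin moment_density_ge0.
  + by apply/measurable_EFinP; exact: measurable_moment_density.
  + by rewrite ltW // cosh_coef_gt0.
- by move=> x x1; apply: nneseries_ge0 => k _ _; exact: T0.
- apply: (@ge0_emeasurable_sum _ _ R I1 _ predT) => // k x x1 _; exact: T0.
Qed.

Lemma egamma_fin (s : R) : (1 < s)%R -> egamma s \is a fin_num.
Proof.
move=> s1; set a := (s - 1)%R; have a0 : (0 < a)%R by rewrite /a; lra.
(* The tangent of ln at 2 a gives a ln x <= x / 2 + a ln(2 a), hence x^a exp(- x) <= K exp(- x /
   2). *)
pose K := expR (a * ln (2 * a)).
pose F (x : R) : R := (- 2 * K * expR (- (1/2) * x))%R.
have dF (x : R) : is_derive x 1%R F (K * expR (- (1/2) * x))%R.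
  have d1 : is_derive x 1%R (fun x : R => - (1/2) * x)%R (- (1/2))%R.
    have := is_deriveM (is_derive_cst (- (1/2) : R)%R x 1%R) (is_derive_id x 1%R).
    by rewrite scaler0 addr0 /GRing.scale /= mulr1.
  have d2 := @is_derive1_comp _ expR (fun x : R => - (1/2) * x)%R x _ _ (is_derive_expR _) d1.
  have := is_deriveM (is_derive_cst (- 2 * K : R)%R x 1%R) d2.
  rewrite scaler0 addr0 /GRing.scale /=.
  set d := (X in is_derive _ _ _ X); suff -> : d = (K * expR (- (1/2) * x))%R by [].
  by rewrite /d; field.
have cG : continuous (fun x : R => K * expR (- (1/2) * x))%R.
  move=> x; apply: cvgM; first exact: cvg_cst.
  apply: continuous_cvg; first exact: continuous_expR.
  by apply: cvgM; [exact: cvg_cst | exact: cvg_id].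
rewrite ge0_fin_numE; last by apply: integral_ge0 => x _; rewrite lee_fin pexp_ge0.
apply: (@le_lt_trans _ _ (\int[mu]_(x in `]0%R, +oo[) (K * expR (- (1/2) * x))%:E)).
  apply: ge0_le_integral => //.
  - by move=> x _; rewrite lee_fin pexp_ge0.
  - apply/measurable_EFinP; apply: pos_measurable => //.
      by move=> x; rewrite /= in_itv /= andbT.
    by move=> x; exact: cts_pexp.
  - by apply/measurable_EFinP/measurable_funTS; exact: continuous_measurable_fun.
  - move=> x; rewrite /= in_itv /= andbT => x0; rewrite lee_fin /pexp /K -expRD ler_expR.
    have h := @le_ln1Dx R (x / (2 * a) - 1)%R; rewrite (addrC 1%R) subrK in h.
    have ax : (0 < x / (2 * a))%R by rewrite divr_gt0 // mulr_gt0.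
    have {}h : (ln x - ln (2 * a) <= x / (2 * a) - 1)%R.
      by rewrite -ln_div ?posrE ?mulr_gt0 //; apply: h; lra.
    have : (a * (ln x - ln (2 * a)) <= a * (x / (2 * a) - 1))%R by rewrite ler_pM2l.
    have -> : (a * (x / (2 * a) - 1) = x / 2 - a)%R by field; lra.
    by rewrite -/a; lra.
apply: (@le_lt_trans _ _ (\int[mu]_(x in `[0%R, +oo[) (K * expR (- (1/2) * x))%:E)).
  apply: ge0_subset_integral => //.
  - by apply/measurable_EFinP/measurable_funTS; exact: continuous_measurable_fun.
  - by move=> x _; rewrite lee_fin mulr_ge0 // expR_ge0.
  - by move=> x; rewrite /= !in_itv /= !andbT; exact: ltW.
rewrite (@ge0_continuous_FTC2y R _ F 0%R 0%R) ?ltry //.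
- by move=> x _; rewrite mulr_ge0 // expR_ge0.
- exact: continuous_subspaceT.
- rewrite /F [X in _ --> X](_ : _ = (- 2 * K * 0)%R); last by rewrite mulr0.
  apply: cvgM; first exact: cvg_cst.
  apply/cvgrPdist_lt => e e0; near=> x.
  rewrite sub0r normrN ger0_norm ?expR_ge0 // -[ltRHS](lnK e0) ltr_expR.
  have : (- 2 * ln e < x)%R by near: x; apply: nbhs_pinfty_gt; exact: num_real.
  lra.
- by apply: cvg_right_of_cts; exact: is_derive_cts (dF 0%R).
- by move=> x _; apply: derive1_eq; exact: dF.
Unshelve. all: by end_near. Qed.

(** The zeta side of [mellin_moments] is finite and bounds every term on the moment side, where each
    moment has a positive coefficient. *)
Lemma emoment_fin (u : R) : (2 <= u)%R ->
  cvgn (series (fun k => expR (- ((u / 2 + 1 / 4) * ln (theta_rate R k))))) ->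
  forall k, emoment k \is a fin_num.
Proof.
move=> u2 cv k; have u0 : (0 < u)%R by lra.
set s := (u / 2 + 1 / 4)%R in cv *.
have gf : egamma s \is a fin_num by apply: egamma_fin; rewrite /s; lra.
have S : \sum_(k <oo) ((expR (- (s * ln (theta_rate R k))))%:E * egamma s) \is a fin_num.
  rewrite -(fineK gf) (@nneseries_EFin _ _ (limn (series (fun k => expR (- (s * ln (theta_rate R k))))) * fine (egamma s))%R) //.
  exact: cvg_seriesMr.
have T0 i : 0 <= (cosh_coef u i)%:E * emoment i by rewrite mule_ge0 ?emoment_ge0 // lee_fin ltW // cosh_coef_gt0.
move: S; rewrite mellin_moments // fin_numD => /andP[S _].
have : (cosh_coef u k)%:E * emoment k <= \sum_(k <oo) ((cosh_coef u k)%:E * emoment k).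
  apply: le_trans (@nneseries_lim_ge R (fun i => (cosh_coef u i)%:E * emoment i) predT 0%N k.+1 (fun i _ _ => T0 i)).
  by rewrite big_nat_recr //= leeDr // sume_ge0.
move=> tS; have {S} : (cosh_coef u k)%:E * emoment k < +oo.
  by apply: le_lt_trans tS _; rewrite -ge0_fin_numE //; exact: nneseries_ge0.
 move: (emoment_ge0 k); case: (emoment k) => [r _ _ //|_|].
  by rewrite gt0_muley ?ltxx // lte_fin cosh_coef_gt0.
by rewrite leNgt ltNyr.
Qed.

End Moments.

(** * The values of xi on a real half-line *)

Section XiOnReals.
Import Normc.
Local Open Scope complex_scope.
Variable R : realType.
Local Notation mu := (@lebesgue_measure R).

Lemma nneseries_cvg (a : nat -> R) l : (forall n, 0 <= a n) ->
  (\sum_(n <oo) (a n)%:E = l%:E)%E -> series a @ \oo --> l.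
Proof.
move=> a0 alpha.
have h : (fun n => \sum_(0 <= i < n) (a i)%:E)%E @ \oo --> l%:E.
  rewrite -alpha; apply: is_cvg_nneseries => n _ _; exact: a0.
have e : (fun n => \sum_(0 <= i < n) (a i)%:E)%E = EFin \o series a.
  by apply/funext => n; rewrite /= seriesEnat sumEFin.
by rewrite e in h; have /fine_cvgP[_] := h.
Qed.

Lemma cvgC_real (a : nat -> R) z : cvgC (fun n => (a n)%:C) z ->
  a @ \oo --> complex.Re z /\ z = (complex.Re z)%:C.
Proof.
move=> h; have ha : a @ \oo --> complex.Re z.
  apply/cvgrPdist_lt => e e0; have [N hN] := (cvgCP _ _).1 h _ e0.
  exists N => // n /= /hN; apply: le_lt_trans.
  rewrite distrC; have := Re_le_normc ((a n)%:C - z).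
  by case: (z) => x y /=.
split=> //; apply: cvgC_unique h _.
by apply: cvgC_ReIm => //=; exact: cvg_cst.
Qed.

Lemma cpow_real (t r : R) : cpow t r%:C = (expR (r * ln t))%:C.
Proof. by rewrite /cpow -rmorphM /cexp /= cos0 sin0 mulr1 mulr0. Qed.

Lemma Gamma_integral_real (r : R) : Gamma_integral r%:C = (fine (egamma r))%:C.
Proof.
have e t : Gamma_integrand r%:C t = (pexp (r - 1) 1 t)%:C.
  rewrite /Gamma_integrand -[1 : R[i]]/(1%:C) -rmorphB cpow_real -rmorphM -expRD.
  by rewrite /pexp mul1r.
rewrite /Gamma_integral /Rintegral /egamma.
congr (fine _ +i* _).
  by apply: eq_integral => t _; rewrite e.
transitivity (fine (\int[mu]_(x in `]0%R, +oo[) (cst 0%E x))).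
  by congr fine; apply: eq_integral => t _; rewrite e.
by rewrite integral0.
Qed.

Variables (G zeta xi : R[i] -> R[i]).
Hypotheses (hG : is_Gamma G) (hzeta : is_zeta zeta) (hxi : is_xi G zeta xi).

Lemma cvg_zeta_real (s : R) : 1 < s ->
  series (fun k => expR (- (s * ln k.+1%:R))) @ \oo --> complex.Re (zeta s%:C) /\
  zeta s%:C = (complex.Re (zeta s%:C))%:C.
Proof.
move=> s1; have [_ /(_ s%:C s1) h] := hzeta.
pose a n := \sum_(1 <= k < n) expR (- (s * ln k%:R)) : R.
have [h1 h2] : a @ \oo --> complex.Re (zeta s%:C) /\ zeta s%:C = (complex.Re (zeta s%:C))%:C.
  apply: cvgC_real; move: h; congr cvgC; apply/funext => n.
  rewrite /a rmorph_sum /=; apply: eq_bigr => k _.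
  by rewrite -rmorphN cpow_real mulNr.
split=> //; move: h1; rewrite -(cvg_shiftS a).
suff -> : (fun n => a n.+1) = series (fun k => expR (- (s * ln k.+1%:R))) by [].
by apply/funext => n; rewrite /a seriesEnat /= big_add1.
Qed.

Lemma cvg_theta_rate (u : R) : 2 <= u -> let s := u / 2 + 1 / 4 in
  series (fun k => expR (- (s * ln (theta_rate R k)))) @ \oo -->
    expR (- (s * ln pi)) * complex.Re (zeta (2 * s)%:C).
Proof.
move=> u2 s; have s1 : 1 < 2 * s by rewrite /s; lra.
have [h _] := cvg_zeta_real s1.
have -> : series (fun k => expR (- (s * ln (theta_rate R k)))) =
    (fun n => expR (- (s * ln pi)) * series (fun k => expR (- (2 * s * ln k.+1%:R))) n).
  apply/funext => n; rewrite !seriesEnat /= big_distrr; apply: eq_bigr => k _ /=.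
  rewrite /theta_rate lnM ?posrE ?pi_gt0 ?exprn_gt0 ?ltr0n // lnXn ?ltr0n // -expRD.
  by congr expR; rewrite mulr2n; ring.
by apply: cvgM; [exact: cvg_cst | exact: h].
Qed.

Lemma emoment_fin_num k : emoment R k \is a fin_num.
Proof. by apply: (@emoment_fin R 2) => //; apply: cvgP; exact: cvg_theta_rate. Qed.

(** For u >= 2 the point 2 s = u + 1/2 lies where the Dirichlet series gives zeta and the Euler
    integral gives Gamma(s), so both sides of [mellin_moments] can be evaluated. *)
Lemma xi_real (u : R) : 2 <= u -> exists2 S,
  series (fun k => cosh_coef u k * fine (emoment R k)) @ \oo --> S &
  xi (u + 1 / 2)%:C = (1 / 2 + (u ^+ 2 - 1 / 4) / 2 * S)%:C.
Proof.
move=> u2; pose s := u / 2 + 1 / 4.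
have s1 : 1 < s by rewrite /s; lra.
have gf := egamma_fin s1.
have hz := cvg_theta_rate u2; rewrite /= -/s in hz.
have s2 : 1 < 2 * s by lra.
have [_ ze] := cvg_zeta_real s2.
set Z := complex.Re _ in hz ze.
set g := fine (egamma s); set P := expR (- (s * ln pi)) in hz.
pose S := P * Z * g - ((2 * s - 1)^-1 - (2 * s)^-1).
exists S.
  apply: nneseries_cvg => [k|].
    rewrite mulr_ge0 ?fine_ge0 ?emoment_ge0 // ltW // cosh_coef_gt0 //; lra.
  have := mellin_moments u2; rewrite /= -/s -(fineK gf) -/g.
  rewrite (@nneseries_EFin _ _ (P * Z * g)); last exact: cvg_seriesMr.
  have -> : (\sum_(k <oo) (cosh_coef u k)%:E * emoment R k = \sum_(k <oo) (cosh_coef u k * fine (emoment R k))%:E)%E.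
    by apply: eq_eseriesr => k _; rewrite -[in LHS](fineK (emoment_fin_num k)) -EFinM.
  by rewrite /S [in X in _ -> X]EFinB => ->; rewrite -addeA -EFinB subrr adde0.
have [_ xie] := hxi; have [_ Ge] := hG.
have us : u + 1 / 2 = 2 * s by rewrite /s; field.
have half : (2 * s)%:C / 2%:R = s%:C.
  rewrite -[2%:R : R[i]](rmorph_nat (real_complex R)) -fmorphV -rmorphM; congr (_%:C).
  by rewrite mulrC mulKf.
rewrite us xie; first last.
- rewrite half => -[n /(congr1 (@complex.Re R))] /=.
  rewrite -(rmorph_nat (real_complex R)) /= => sn; have : 0 <= n%:R :> R by [].
  lra.
- by move=> /(congr1 (@complex.Re R)) /=; lra.
rewrite half Ge; last by rewrite /=; lra.
rewrite Gamma_integral_real -/g ze [cpow _ _](_ : _ = P%:C); last first.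
  by rewrite /P -mulNr -cpow_real rmorphN.
rewrite -[2%:R : R[i]](rmorph_nat (real_complex R)) -[1 : R[i]]/(1%:C) -fmorphV -rmorphB -!rmorphM.
congr (_%:C); rewrite /S.
have -> : u ^+ 2 - 1 / 4 = 2 * s * (2 * s - 1) by rewrite /s; field.
by field; rewrite ?gt_eqF //; lra.
Qed.

End XiOnReals.

(** * The moments by Laplace's method *)

Section Pointwise.
Variable R : realType.

(** It yields exp(s) - 1 - s >= s^2 / 4, the quadratic decay around the saddle. *)
Lemma expR_sq_ge (s : R) : - 2 <= s -> (1 + s / 2) ^+ 2 <= expR s.
Proof.
move=> s2; have -> : expR s = expR (s / 2) ^+ 2.
  by rewrite -expRM_natl; congr expR; field.
by rewrite lerXn2r ?nnegrE ?expR_ge0 ?expR_ge1Dx //; lra.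
Qed.

(* With [b ^ 2 = pi X] and [s = ln (x / X)], the left-hand side is the logarithm of
   the bound for [x * moment_density N x / (2 * saddleA)] derived in [moment_density_upper]. *)
Lemma laplace_exponent (s b : R) : 2 <= b ->
  s / 4 - b ^+ 2 * (expR s - 1 - s) <= 3 / 2 - (2 + b * `|s|) / 4.
Proof.
move=> b2; have [s2|s2] := lerP (- 2) s.
  have h := expR_sq_ge s2.
  have h2 : b ^+ 2 * ((1 + s / 2) ^+ 2 - 1 - s) <= b ^+ 2 * (expR s - 1 - s).
    by rewrite ler_wpM2l ?sqr_ge0 // !lerB.
  have e : b ^+ 2 * ((1 + s / 2) ^+ 2 - 1 - s) = (b * `|s|) ^+ 2 / 4.
    by rewrite exprMn real_normK ?num_real //; field.
  rewrite e in h2; have a0 := normr_ge0 s; have sa := ler_norm s.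
  have va : 2 * `|s| <= b * `|s| by rewrite ler_wpM2r.
  move: h2 va; move: (_ * (_ - _ - _)) => z; move: (b * `|s|) => v h2 va.
  (* Since s / 4 <= v / 8, it suffices that v^2 / 4 - 3 v / 8 + 1 >= 0, a parabola with vertex
     3/4. *)
  have := sqr_ge0 (v - 3/4); nra.
have e0 := expR_ge0 s; rewrite ltr0_norm; last by lra.
have h : b ^+ 2 * (- 1 - s) <= b ^+ 2 * (expR s - 1 - s).
  by rewrite ler_wpM2l ?sqr_ge0 //; lra.
have : b * (- s) <= b ^+ 2 * (- 1 - s).
  have h1 : 0 <= b * (b - 2) * (- 1 - s) by rewrite !mulr_ge0 //; lra.
  have h2 : 0 <= b * (- 2 - s) by rewrite mulr_ge0 //; lra.
  by move: h1 h2; clear; nra.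
move: h; move: (_ * (expR s - _ - _)) => z h h'.
have : 0 < b * (- s) by rewrite mulr_gt0; lra.
by lra.
Qed.

Lemma expn_le_expR (M : nat) (y : R) : 0 <= y -> y ^+ M <= M`!%:R * 4 ^+ M * expR (y / 4).
Proof.
move=> y0; case: M => [|M].
  by rewrite !mul1r -[X in X <= _]expR0 ler_expR divr_ge0.
have y4 : 0 <= y / 4 by rewrite divr_ge0.
have h := expR_ge1Dxn M y4.
have f0 : (0 : R) < M.+1`!%:R by rewrite ltr0n fact_gt0.
have {}h : (y / 4) ^+ M.+1 / M.+1`!%:R <= expR (y / 4) by lra.
rewrite ler_pdivrMr // in h; have e : y ^+ M.+1 = (y / 4) ^+ M.+1 * 4 ^+ M.+1.
  by rewrite -exprMn divfK.
have p4 : (0 : R) <= 4 ^+ M.+1 by rewrite exprn_ge0.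
have := ler_wpM2r p4 h; rewrite -e; congr (_ <= _); ring.
Qed.

Definition tailC (M : nat) : R := expR (3 / 2) * (M`!%:R * 4 ^+ M).

Lemma tailC_gt0 M : 0 < tailC M.
Proof. by rewrite mulr_gt0 ?expR_gt0 // mulr_gt0 ?exprn_gt0 // ltr0n fact_gt0. Qed.

(** Each factor |s| gains 1 / b, the width of the peak, with a constant independent of b. What
    remains is bounded by a Lorentz profile, whose integral in s is an explicit arctangent. *)
Lemma laplace_tail (p m : nat) (s b : R) : 2 <= b ->
  `|s| ^+ p * (2 + `|s|) ^+ m * expR (s / 4 - b ^+ 2 * (expR s - 1 - s)) <=
  tailC (p + m + 2) * b ^- p / (1 + (b * s) ^+ 2).
Proof.
move=> b2; have b0 : 0 < b by lra.
have a0 := normr_ge0 s; set v := b * `|s|.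
have v0 : 0 <= v by rewrite mulr_ge0 // ltW.
have av : `|s| <= v by rewrite ler_peMl //; lra.
have d0 : 0 < 1 + (b * s) ^+ 2 by have := sqr_ge0 (b * s); lra.
have ev : (b * s) ^+ 2 = v ^+ 2 by rewrite /v !exprMn real_normK ?num_real.
rewrite ler_pdivlMr // ev.
have -> : `|s| ^+ p = v ^+ p * b ^- p by rewrite /v exprMn mulrAC divff ?mul1r // expf_neq0 // gt_eqF.
set Ex := expR _; have Ex0 : 0 <= Ex by exact: expR_ge0.
have ExB : Ex <= expR (3 / 2) * expR (- ((2 + v) / 4)).
  by rewrite -expRD ler_expR; exact: laplace_exponent.
have -> : v ^+ p * b ^- p * (2 + `|s|) ^+ m * Ex * (1 + v ^+ 2) =
  (v ^+ p * (2 + `|s|) ^+ m * (1 + v ^+ 2)) * Ex * b ^- p by ring.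
have bp : 0 <= b ^- p by rewrite invr_ge0 exprn_ge0 // ltW.
rewrite ler_wpM2r //.
have : v ^+ p * (2 + `|s|) ^+ m * (1 + v ^+ 2) <= (2 + v) ^+ (p + m + 2).
  rewrite !exprD; apply: ler_pM.
  - by rewrite mulr_ge0 // exprn_ge0 //; lra.
  - by have := sqr_ge0 v; lra.
  - by apply: ler_pM; rewrite ?exprn_ge0 //; (try by lra); rewrite lerXn2r ?nnegrE //; lra.
  - nra.
have v2 : 0 <= 2 + v by lra.
move=> h; have {}h := le_trans h (expn_le_expR (p + m + 2) v2).
apply: le_trans (_ : _ <= (p + m + 2)`!%:R * 4 ^+ (p + m + 2) * expR ((2 + v) / 4) *
   (expR (3 / 2) * expR (- ((2 + v) / 4)))) _.
  apply: ler_pM => //.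
  by rewrite !mulr_ge0 ?exprn_ge0 //; have := sqr_ge0 v; lra.
rewrite le_eqVlt; apply/orP; left; apply/eqP.
have e : expR ((2 + v) / 4) * expR (- ((2 + v) / 4)) = 1 by rewrite -expRD subrr expR0.
rewrite /tailC; set f := _%:R * _.
transitivity (expR (3 / 2) * f * (expR ((2 + v) / 4) * expR (- ((2 + v) / 4)))); first by ring.
by rewrite e mulr1.
Qed.

Lemma omega_bounds (x : R) : 1 <= x ->
  expR (- (pi * x)) <= omega x <= 2 * expR (- (pi * x)).
Proof.
move=> x1; have x0 : 0 < x by lra.
have h := cvg_omega x0; set e := expR (- (pi * x)).
have e0 : 0 <= e := expR_ge0 _.
have e12 : e <= 1 / 2.
  have := expR_ge1Dx (pi * x : R); have p2 := pi_ge2 R.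
  have px : 2 <= pi * x by rewrite -[2]mulr1 ler_pM.
  rewrite /e expRN => ?; rewrite div1r lef_pV2 ?posrE ?expR_gt0 //; lra.
have nd n m : (n <= m)%N -> series (fun k => expR (- (theta_rate R k * x))) n <= series (fun k => expR (- (theta_rate R k * x))) m.
  move=> nm; rewrite !seriesEnat /= (big_cat_nat (leq0n n) nm) //= lerDl sumr_ge0 // => k _; exact: expR_ge0.
apply/andP; split.
  rewrite -(cvg_lim _ h) //; apply: limr_ge; first exact: cvgP h.
  near=> n; apply: le_trans (nd 1%N n _).
    by rewrite seriesEnat /= big_nat1 /theta_rate expr1n mulr1.
  by near: n; exact: nbhs_infty_ge.
rewrite -(cvg_lim _ h) //; apply: limr_le; first exact: cvgP h.
near=> n.
apply: le_trans (_ : _ <= series (fun k => e * (1 / 2) ^+ k) n) _.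
  rewrite !seriesEnat /=; apply: ler_sum_nat => k _.
  have : pi * x * k.+1%:R <= theta_rate R k * x.
    rewrite /theta_rate [leRHS]mulrAC ler_wpM2l ?mulr_ge0 ?pi_ge0 //; first by lra.
    by rewrite -natrX ler_nat expnS expn1 leq_pmulr.
  move=> hk; apply: le_trans (_ : _ <= e ^+ k.+1) _.
    by rewrite /e -expRM_natl ler_expR mulrN lerN2 mulrC.
  by rewrite exprS ler_wpM2l // lerXn2r ?nnegrE.
have -> : series (fun k => e * (1 / 2) ^+ k) n = 2 * e * (1 - (1 / 2) ^+ n).
  elim: (n) => [|j IH]; first by rewrite seriesEnat /= big_geq // expr0 subrr mulr0.
  by rewrite seriesSr IH exprS; field.
have : 0 <= (1 / 2 : R) ^+ n by rewrite exprn_ge0.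
by move=> z0; rewrite -[leRHS]mulr1 ler_wpM2l ?mulr_ge0 // gerBl.
Unshelve. all: by end_near. Qed.

Section AtSaddle.
Variables (N : nat) (X : R).
Let l : R := ln X.
Let kap : R := pi * X.
Hypotheses (X0 : 0 < X) (l1 : 1 <= l) (sad : (2 * N)%:R = kap * l).

(** The value at X of (ln x)^(2 N) exp(- pi x) x^(1/4), the main part of x times the density, since
    dx = x d(ln x). The saddle equation makes X the maximum of (ln x)^(2 N) exp(- pi x). *)
Definition saddleA : R := ln X ^+ (2 * N) * expR (- (pi * X)) * expR (ln X / 4).

Lemma saddle_X2 : 2 <= X.
Proof.
rewrite -(lnK X0) -/l; apply: le_trans (_ : _ <= expR 1) _; last by rewrite ler_expR.
exact: expR_ge1Dx.
Qed.

Lemma saddle_kap4 : 4 <= kap.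
Proof. by have := saddle_X2; have := pi_ge2 R; rewrite /kap; nra. Qed.

Lemma sqrt_kap2 : 2 <= Num.sqrt kap.
Proof.
have -> : 2 = Num.sqrt (2 ^+ 2) :> R by rewrite sqrtr_sqr ger0_norm.
by rewrite ler_wsqrtr //; have := saddle_kap4; lra.
Qed.

Lemma saddleA_gt0 : 0 < saddleA.
Proof. by rewrite !mulr_gt0 ?expR_gt0 // exprn_gt0 // (lt_le_trans _ l1). Qed.

(** From ln x = l (1 + s / l), the power (ln x)^(2 N) is at most l^(2 N) exp(2 N s / l), which is
    l^(2 N) exp(kap s) by the saddle equation. Against exp(- kap exp(s)) the linear terms in s
    cancel, leaving the exponent of [laplace_tail] with b^2 = kap. *)
Lemma moment_density_upper (p m : nat) (x s : R) : 1 <= x -> s = ln x - ln X ->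
  moment_density N x * (`|s| ^+ p * (2 + `|s|) ^+ m) <=
  2 * saddleA * tailC (p + m + 2) * Num.sqrt kap ^- p / (x * (1 + (Num.sqrt kap * s) ^+ 2)).
Proof.
move=> x1 s_def; have x0 : 0 < x by lra.
have [_ om] := andP (omega_bounds x1).
have l0 : 0 < l := lt_le_trans ltr01 l1.
have lx : ln x = l * (1 + s / l) by rewrite s_def /l; field; rewrite gt_eqF.
have lx0 : 0 <= 1 + s / l by have := ln_ge0 x1; rewrite lx pmulr_rge0.
have xs : x = X * expR s by rewrite s_def expRB !lnK ?posrE // mulrC divfK // gt_eqF.
have k0 : 0 <= kap by have := saddle_kap4; lra.
have A1 : ln x ^+ (2 * N) <= l ^+ (2 * N) * expR (kap * s).
  rewrite lx exprMn ler_wpM2l //; first by rewrite exprn_ge0 // ltW.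
  have -> : expR (kap * s) = expR (s / l) ^+ (2 * N).
    by rewrite -expRM_natl sad; congr expR; field; rewrite gt_eqF.
  by rewrite lerXn2r ?nnegrE ?expR_ge0 ?expR_ge1Dx.
have A2 : moment_density N x <= 2 * saddleA * expR (s / 4 - kap * (expR s - 1 - s)) / x.
  rewrite /moment_density; have -> : expR (- (3 / 4) * ln x) = expR (l / 4) * expR (s / 4) / x.
    by rewrite -{2}(lnK x0) -expRN -!expRD; congr expR; rewrite s_def /l; field.
  have e : 2 * saddleA * expR (s / 4 - kap * (expR s - 1 - s)) =
     2 * expR (- (pi * x)) * (expR (l / 4) * expR (s / 4)) * (l ^+ (2 * N) * expR (kap * s)).
    rewrite /saddleA -/kap -/l.
    have -> : s / 4 - kap * (expR s - 1 - s) = s / 4 - kap * expR s + kap + kap * s by ring.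
    rewrite !expRD xs [pi * (X * _)]mulrA -/kap.
    have ek : expR (- kap) * expR kap = 1 by rewrite -expRD addNr expR0.
    move: ek; move: (expR (- kap)) (expR kap) => a b ab.
    set u := expR (s / 4); set v := expR (- _); set w := expR (kap * s); set z := expR (l / 4).
    transitivity (2 * v * (z * u) * (l ^+ (2 * N) * w) * (a * b)); first by ring.
    by rewrite ab mulr1.
  have xe : 0 <= expR (l / 4) * expR (s / 4) / x by rewrite !mulr_ge0 ?expR_ge0 // invr_ge0 ltW.
  rewrite e; apply: le_trans (_ : _ <= 2 * expR (- (pi * x)) * (expR (l / 4) * expR (s / 4) / x) *
      (l ^+ (2 * N) * expR (kap * s))) _; last by rewrite le_eqVlt; apply/orP; left; apply/eqP; ring.
  apply: ler_pM => //; last by rewrite ler_wpM2r.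
    by rewrite mulr_ge0 // omega_ge0.
  by rewrite exprn_ge0 // ln_ge0.
set Q := _ ^+ p * _; have Q0 : 0 <= Q by rewrite mulr_ge0 ?exprn_ge0 ?addr_ge0.
apply: le_trans (ler_wpM2r Q0 A2) _.
have := laplace_tail p m s sqrt_kap2; rewrite -/Q sqr_sqrtr // => T.
have c0 : 0 <= 2 * saddleA / x.
  by rewrite divr_ge0 ?(ltW x0) // mulr_ge0 // (ltW saddleA_gt0).
have := ler_wpM2l c0 T; congr (_ <= _); first by ring.
have d0 : 1 + (Num.sqrt kap * s) ^+ 2 != 0 by have := sqr_ge0 (Num.sqrt kap * s); lra.
rewrite invfM; ring.
Qed.

(** Within relative distance kap^(- 1/2) to the right of X the density loses only a constant factor:
    exp(- 2) from applying ln(1 + y) >= y / (1 + y) twice, and 1/2 from x <= 2 X and omega at its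
    leading term. *)
Lemma moment_density_lower (x t : R) : x = X * (1 + t) -> 0 <= t -> t <= 1 -> kap * t ^+ 2 <= 1 ->
  saddleA * expR (- 2) / (2 * X) <= moment_density N x.
Proof.
move=> xt t0 t1 kt; have l0 : 0 < l := lt_le_trans ltr01 l1.
have X2 := saddle_X2; have k4 := saddle_kap4.
have t10 : 0 < 1 + t by lra.
have x1 : 1 <= x by rewrite xt; nra.
have x0 : 0 < x by lra.
have [om _] := andP (omega_bounds x1).
have lnge (y : R) : 0 <= y -> y / (1 + y) <= ln (1 + y).
  move=> y0; have y1 : 0 < 1 + y by lra.
  have h : 0 < (1 + y)^-1 by rewrite invr_gt0.
  have := @le_ln1Dx R ((1 + y)^-1 - 1); have -> : 1 + ((1 + y)^-1 - 1) = (1 + y)^-1 by ring.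
  rewrite lnV ?posrE // => H; have {}H := H ltac:(lra).
  have -> : y / (1 + y) = 1 - (1 + y)^-1 by field; lra.
  lra.
have lx : ln x = l + ln (1 + t) by rewrite xt lnM ?posrE.
set y := t / (1 + t) / l.
have y0 : 0 <= y by rewrite !divr_ge0 // ltW.
have B1 : l ^+ (2 * N) * expR (kap * t - 2) <= ln x ^+ (2 * N).
  apply: le_trans (_ : _ <= (l * (1 + y)) ^+ (2 * N)) _; last first.
    rewrite lerXn2r ?nnegrE ?ln_ge0 //; first by rewrite mulr_ge0 //; lra.
    rewrite lx mulrDr mulr1 lerD2l /y mulrC divfK ?gt_eqF //; exact: lnge.
  rewrite exprMn ler_wpM2l //; first by rewrite exprn_ge0 // ltW.
  have y1 : 0 < 1 + y by lra.
  rewrite -[1 + y]lnK // -expRM_natl ler_expR sad.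
  apply: le_trans (_ : _ <= kap * l * (y / (1 + y))) _; last first.
    by rewrite ler_wpM2l ?lnge // mulr_ge0 //; lra.
  have -> : kap * l * (y / (1 + y)) = kap * t / (1 + t + t / l).
    rewrite /y; field; rewrite !gt_eqF //=.
    by rewrite ltr_wpDr // mulr_gt0.
  have tl : t / l <= t by rewrite ler_pdivrMr // ler_peMr.
  have tl0 : 0 <= t / l by rewrite divr_ge0 // ltW.
  rewrite ler_pdivlMr; last by lra.
  move: tl tl0; move: (t / l) => w w1 w0.
  have kt0 : 0 <= kap * t by rewrite mulr_ge0 //; lra.
  have h2 : kap * t * (t + w) <= 2.
    apply: le_trans (_ : _ <= kap * t * (2 * t)) _; first by rewrite ler_wpM2l //; lra.
    have -> : kap * t * (2 * t) = 2 * (kap * t ^+ 2) by ring.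
    by rewrite -[leRHS]mulr1 ler_pM2l.
  move: kt0 h2 w0 t0; move: (kap * t) => z kt0 h2 w0' t0'.
  have -> : (z - 2) * (1 + t + w) = z - 2 + (z * (t + w) - 2 * (t + w)) by ring.
  by move: h2; move: (z * _) => h; lra.
have B2 : expR (l / 4) / (2 * X) <= expR (- (3 / 4) * ln x).
  have -> : expR (- (3 / 4) * ln x) = expR (ln x / 4) / x.
    have -> : expR (ln x / 4) / x = expR (ln x / 4) * expR (- ln x) by rewrite expRN lnK.
    by rewrite -expRD; congr expR; field.
  apply: ler_pM; rewrite ?expR_ge0 ?invr_ge0 //; first by lra.
    rewrite ler_expR lx; have := @ln_ge0 R (1 + t); lra.
  by rewrite lef_pV2 ?posrE //; [rewrite xt; nra | lra].
rewrite /moment_density /saddleA -/l -/kap.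
have -> : l ^+ (2 * N) * expR (- kap) * expR (l / 4) * expR (- 2) / (2 * X) =
  expR (- (pi * x)) * (expR (l / 4) / (2 * X)) * (l ^+ (2 * N) * expR (kap * t - 2)).
  rewrite expRD.
  have -> : expR (- kap) = expR (- (pi * x)) * expR (kap * t).
    by rewrite -expRD xt /kap; congr expR; ring.
  move: (expR _) (expR _) (expR _) (expR (-2)) => a b c d; ring.
have X20 : 0 <= (2 * X)^-1 by rewrite invr_ge0; lra.
apply: ler_pM => //.
- by rewrite !mulr_ge0 ?expR_ge0.
- by rewrite mulr_ge0 ?exprn_ge0 ?expR_ge0 // ltW.
- by apply: ler_pM => //; rewrite ?mulr_ge0 ?expR_ge0.
Qed.

End AtSaddle.
End Pointwise.

(** * Differences of the moments around a saddle point *)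

Section LaplaceMethod.
Variable R : realType.
Local Notation mu := (@lebesgue_measure R).
Local Notation I1 := (`[1%R, +oo[%classic : set R).
Hypothesis mfin : forall k, emoment R k \is a fin_num.
Definition moment (k : nat) : R := fine (emoment R k).

Lemma integrable_moment_density k : mu.-integrable I1 (EFin \o @moment_density R k).
Proof.
apply/integrableP; split; first by apply/measurable_EFinP; exact: measurable_moment_density.
rewrite [X in (X < _)%E](_ : _ = emoment R k); last first.
  apply: eq_integral => x; rewrite inE => /I1_ge1 x1 /=.
  by rewrite ger0_norm // moment_density_ge0.
by have := mfin k; rewrite ge0_fin_numE // emoment_ge0.
Qed.

Lemma cts_lorentz (b c x : R) : 0 < x ->
  {for x, continuous (fun x : R => (x * (1 + (b * (ln x - c)) ^+ 2))^-1)}.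
Proof.
move=> x0; apply: cvgV; first by rewrite mulf_neq0 ?gt_eqF // ltr_wpDr // sqr_ge0.
apply: cvgM; first exact: cvg_id.
apply: cvgD; first exact: cvg_cst.
apply: (@continuous_comp _ _ _ (fun x : R => b * (ln x - c)) (fun y : R => y ^+ 2)).
  by apply: cvgM; [exact: cvg_cst | apply: cvgB; [exact: continuous_ln | exact: cvg_cst]].
exact: exprn_continuous.
Qed.

Lemma integral_lorentz (b c : R) : 0 < b ->
  (\int[mu]_(x in I1) ((x * (1 + (b * (ln x - c)) ^+ 2))^-1)%:E <= (pi / b)%:E)%E.
Proof.
move=> b0; pose F (x : R) : R := atan (b * (ln x - c)) / b.
have bn0 : b != 0 by rewrite gt_eqF.
have dn (x : R) : 1 + (b * (ln x - c)) ^+ 2 != 0.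
  by rewrite gt_eqF // ltr_wpDr // sqr_ge0.
have dF (x : R) : 0 < x -> is_derive x 1 F (x * (1 + (b * (ln x - c)) ^+ 2))^-1.
  move=> x0; have dl := is_derive1_ln x0.
  have d1 : is_derive x 1 (fun x : R => b * (ln x - c)) (b / x).
    have := is_deriveM (is_derive_cst (b : R) x 1) (is_deriveB dl (is_derive_cst (c : R) x 1)).
    by rewrite scaler0 addr0 subr0.
  have d2 := @is_derive1_comp _ atan (fun x : R => b * (ln x - c)) x _ _ (is_derive1_atan _) d1.
  have := is_deriveM d2 (is_derive_cst (b^-1 : R) x 1).
  rewrite scaler0 add0r /GRing.scale /=.
  set d := (X in is_derive _ _ _ X); suff -> : d = (x * (1 + (b * (ln x - c)) ^+ 2))^-1 by [].
  rewrite /d; have := dn x; set v := 1 + _ => v0.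
  by field; rewrite v0 bn0 gt_eqF.
rewrite (@ge0_continuous_FTC2y R _ F 1 (pi / 2 / b)).
- rewrite -EFinB lee_fin /F -mulrBl ler_pM2r ?invr_gt0 //.
  by have := atan_gtNpi2 (b * (ln 1 - c)); lra.
- move=> x x1; rewrite invr_ge0 mulr_ge0 //; first by lra.
  by rewrite addr_ge0 // sqr_ge0.
- by apply: cts_within => x /pos1; exact: cts_lorentz.
- apply: cvgM; last exact: cvg_cst.
  apply: cvg_comp (@cvgy_atan R).
  apply/cvgryPge => A; near=> x.
  rewrite mulrC -ler_pdivrMr // lerBrDr.
  have xe : expR (A / b + c) <= x by near: x; apply: nbhs_pinfty_ge; exact: num_real.
  by rewrite -[leLHS]expRK ler_ln ?posrE ?expR_gt0 //; apply: lt_le_trans xe; rewrite expR_gt0.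
- by move=> x x1; apply: derivable_of_is_derive (dF x _); exact: lt_trans x1.
- by apply: cvg_right_of_cts; apply: is_derive_cts (dF 1 _).
- move=> x; rewrite in_itv /= andbT => x1; apply: derive1_eq; apply: dF; exact: lt_trans x1.
Unshelve. all: by end_near. Qed.

Section AtSaddle.
Variables (N : nat) (X : R).
Hypotheses (X0 : 0 < X) (l1 : 1 <= ln X) (sad : (2 * N)%:R = pi * X * ln X).

Let r (x : R) : R := ln x ^+ 2 / ln X ^+ 2.
(** Rescaled by powers of (ln X)^2, the moments after N are power moments of [r]. As r^(k+1) - r^k =
    r^k (r - 1), taking p differences inserts (r - 1)^p, small near the saddle where r = 1. *)
Let dpk (p k : nat) (x : R) : R := moment_density N x * r x ^+ k * (r x - 1) ^+ p.
Let l0 : 0 < ln X. Proof. exact: lt_le_trans ltr01 l1. Qed.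
Let b : R := Num.sqrt (pi * X).
Let b2 : 2 <= b. Proof. exact: sqrt_kap2. Qed.

Let dpk0 k x : dpk 0 k x = moment_density (N + k) x * (ln X ^+ 2) ^- k.
Proof.
rewrite /dpk mulr1 /r /moment_density mulnDr exprD expr_div_n -exprM.
by rewrite !mulrA -exprM.
Qed.

Let dpkS p k x : dpk p.+1 k x = dpk p k.+1 x - dpk p k x.
Proof. by rewrite /dpk !exprS; ring. Qed.

Let dpk_int p k : mu.-integrable I1 (EFin \o dpk p k).
Proof.
elim: p k => [|p IH] k.
  have -> : EFin \o dpk 0 k = (fun x => ((ln X ^+ 2) ^- k)%:E * (moment_density (N + k) x)%:E)%E.
    by apply/funext => x; rewrite /= dpk0 mulrC EFinM.
  by apply: integrableZl => //; exact: integrable_moment_density.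
have -> : EFin \o dpk p.+1 k = (fun x => (dpk p k.+1 x)%:E - (dpk p k x)%:E)%E.
  by apply/funext => x; rewrite /= dpkS EFinB.
by apply: integrableB => //; exact: IH.
Qed.

Lemma iter_fdiff_moment p k :
  iter p (@fdiff R) (fun k => moment (N + k) * (ln X ^+ 2) ^- k) k = \int[mu]_(x in I1) dpk p k x.
Proof.
elim: p k => [|p IH] k.
  rewrite /= /moment -[fine _]/(\int[mu]_(x in I1) moment_density (N + k) x) -RintegralZr //; last exact: integrable_moment_density.
  by apply: eq_Rintegral => x _; rewrite dpk0.
rewrite iter_fdiffS !IH -RintegralB //; try exact: dpk_int.
by apply: eq_Rintegral => x _; rewrite dpkS.
Qed.

Let dpk_bound p k x : 1 <= x -> `|dpk p k x| <=
  2 * saddleA N X * tailC R (p + (p + 2 * k) + 2) * b ^- p * ln X ^- p * (x * (1 + (b * (ln x - ln X)) ^+ 2))^-1.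
Proof.
move=> x1; set s := ln x - ln X.
have h := @moment_density_upper R N X X0 l1 sad p (p + 2 * k) x s x1 erefl.
have g0 := moment_density_ge0 N x1.
have a0 := normr_ge0 s; have li : 0 <= (ln X)^-1 by rewrite invr_ge0 ltW.
have r0 : 0 <= r x by rewrite divr_ge0 // sqr_ge0.
have e1 : r x - 1 = s * (2 + s / ln X) / ln X.
  by rewrite /r /s; field; rewrite gt_eqF.
have sl : `|s / ln X| <= `|s|.
  by rewrite normrM normfV [X in _ / X]gtr0_norm // ler_pdivrMr // ler_peMr.
have A1 : `|r x - 1| <= `|s| * (2 + `|s|) / ln X.
  rewrite e1 !normrM normfV [X in _ / X]gtr0_norm // ler_wpM2r // ler_wpM2l //.
  by apply: le_trans (ler_normD _ _) _; rewrite lerD // ger0_norm.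
have A2 : r x <= (2 + `|s|) ^+ 2.
  have -> : r x = `|1 + s / ln X| ^+ 2.
    by rewrite real_normK ?num_real // /r /s; field; rewrite gt_eqF.
  rewrite lerXn2r ?nnegrE ?addr_ge0 //.
  by apply: le_trans (ler_normD _ _) _; rewrite normr1 lerD // ler1n.
have -> : `|dpk p k x| = moment_density N x * (r x ^+ k * `|r x - 1| ^+ p).
  rewrite /dpk; move: (moment_density N x) g0 (r x) r0 => g g0 w w0.
  by rewrite !normrM !normrX (ger0_norm g0) (ger0_norm w0) mulrA.
apply: le_trans (_ : _ <= moment_density N x * (`|s| ^+ p * (2 + `|s|) ^+ (p + 2 * k)) * ln X ^- p) _.
  rewrite -mulrA ler_wpM2l //.
  apply: le_trans (_ : _ <= ((2 + `|s|) ^+ 2) ^+ k * (`|s| * (2 + `|s|) / ln X) ^+ p) _.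
    by apply: ler_pM; rewrite ?exprn_ge0 // lerXn2r ?nnegrE ?sqr_ge0 // !mulr_ge0 ?addr_ge0.
  rewrite le_eqVlt; apply/orP; left; apply/eqP.
  by rewrite -exprM !exprMn exprVn exprD; ring.
have lp : 0 <= ln X ^- p by rewrite invr_ge0 exprn_ge0 // ltW.
apply: le_trans (ler_wpM2r lp h) _.
rewrite le_eqVlt; apply/orP; left; apply/eqP; rewrite -/b; move: (_^-1) => z; ring.
Qed.

Lemma moment_diff_upper p k :
  `|\int[mu]_(x in I1) dpk p k x| <=
  2 * saddleA N X * tailC R (p + (p + 2 * k) + 2) * b ^- p * ln X ^- p * (pi / b).
Proof.
have b0 : 0 < b by exact: lt_le_trans b2.
apply: le_trans (le_normr_Rintegral _ (dpk_int p k)) _ => //.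
set C := (X in X * (pi / b)).
have C0 : 0 <= C.
  by rewrite !mulr_ge0 ?invr_ge0 ?exprn_ge0 ?(ltW (tailC_gt0 _ _)) ?(ltW (saddleA_gt0 _ l1)) // ?ltW.
have I0 x : 1 <= x -> 0 <= (x * (1 + (b * (ln x - ln X)) ^+ 2))^-1.
  by move=> x1; rewrite invr_ge0 mulr_ge0 ?addr_ge0 ?sqr_ge0 //; lra.
have mI : measurable_fun I1 (fun x : R => ((x * (1 + (b * (ln x - ln X)) ^+ 2))^-1)%:E).
  by apply: measurable_pos1 => x; exact: cts_lorentz.
have le : (\int[mu]_(x in I1) (`|dpk p k x|)%:E <= (C * (pi / b))%:E)%E.
  apply: le_trans (_ : _ <= \int[mu]_(x in I1) (C%:E * ((x * (1 + (b * (ln x - ln X)) ^+ 2))^-1)%:E))%E _.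
    apply: ge0_le_integral => //.
    - by have /integrableP[/measurable_EFinP m _] := dpk_int p k; apply/measurable_EFinP; exact: measurableT_comp.
    - exact: emeasurable_funM.
    - by move=> x /I1_ge1 x1; rewrite -EFinM lee_fin; exact: dpk_bound.
  rewrite ge0_integralZl_EFin //.
  - by rewrite [leRHS]EFinM lee_wpmul2l ?lee_fin // integral_lorentz.
  - by move=> x /I1_ge1 x1; rewrite lee_fin I0.
rewrite -lee_fin /Rintegral fineK // ge0_fin_numE; last by apply: integral_ge0 => x _; rewrite lee_fin.
by apply: le_lt_trans le _; rewrite ltry.
Qed.

Lemma moment_lower : saddleA N X * expR (- 2) / (2 * b) <= moment N.
Proof.
have b0 : 0 < b by exact: lt_le_trans b2.
have X2 := saddle_X2 X0 l1.
rewrite -lee_fin /moment fineK //.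
pose J := `[X, X * (1 + b^-1)]%classic : set R.
have mJ : measurable J by exact: measurable_itv.
have sub : J `<=` I1.
  by move=> x; rewrite /J /= !in_itv /= andbT => /andP[h _]; lra.
have -> : saddleA N X * expR (- 2) / (2 * b) = saddleA N X * expR (- 2) / (2 * X) * (X * (1 + b^-1) - X).
  by field; rewrite !gt_eqF.
apply: le_trans (_ : _ <= \int[mu]_(x in J) (cst (saddleA N X * expR (- 2) / (2 * X))%:E x))%E _.
  rewrite integral_cst; last exact: measurable_itv.
  rewrite [Y in (_ <= _ * Y)%E](_ : _ = (X * (1 + b^-1) - X)%:E); last first.
    apply: etrans (lebesgue_measure_itv _) _; rewrite /= lte_fin -EFinB.
    by rewrite ltr_pMr // ltrDl invr_gt0 b0.
  by rewrite -EFinM.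
apply: le_trans (_ : _ <= \int[mu]_(x in J) (moment_density N x)%:E)%E _.
  apply: ge0_le_integral => //.
  - move=> x _; rewrite /= lee_fin divr_ge0 //; last by rewrite mulr_ge0 // ltW.
    by apply: mulr_ge0; [exact/ltW/saddleA_gt0 | exact: expR_ge0].
  - by apply/measurable_EFinP; apply: measurable_funS (measurable_moment_density N).
  - move=> x; rewrite /J /= in_itv /= => /andP[xX xb]; rewrite lee_fin.
    have xt : x = X * (1 + (x / X - 1)) by field; rewrite gt_eqF.
    have t0 : 0 <= x / X - 1 by rewrite subr_ge0 ler_pdivlMr // mul1r.
    have tb : x / X - 1 <= b^-1 by rewrite lerBlDl ler_pdivrMr // mulrC.
    apply: (moment_density_lower X0 l1 sad xt t0).
      apply: le_trans tb _; rewrite -[leRHS]invr1 lef_pV2 ?posrE //.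
      by apply: le_trans b2; rewrite ler1n.
    have kb : pi * X = b ^+ 2 by rewrite sqr_sqrtr // mulr_ge0 ?pi_ge0 // ltW.
    rewrite kb -exprMn expr_le1 // ?mulr_ge0 // ?(ltW b0) //.
    by rewrite -[leRHS](@mulfV _ b) ?gt_eqF // ler_pM2l.
apply: ge0_subset_integral => //.
  by apply/measurable_EFinP; exact: measurable_moment_density.
by move=> x /I1_ge1 x1; rewrite lee_fin moment_density_ge0.
Qed.

Lemma moment_gt0 : 0 < moment N.
Proof.
apply: lt_le_trans moment_lower; apply: divr_gt0.
  by apply: mulr_gt0; [exact: saddleA_gt0 | exact: expR_gt0].
by apply: mulr_gt0 => //; exact: lt_le_trans b2.
Qed.

(** The upper and the lower bound share the factor [saddleA N X / b], so it disappears from the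
    quotient: each difference gains 1 / (b ln X), relative to the moment itself. *)
Lemma moment_diff p k :
  `|iter p (@fdiff R) (fun k => moment (N + k) * (ln X ^+ 2) ^- k) k| <=
  moment N * (4 * pi * expR 2 * tailC R (p + (p + 2 * k) + 2) * (b * ln X) ^- p).
Proof.
rewrite iter_fdiff_moment; apply: le_trans (moment_diff_upper p k) _.
have b0 : 0 < b by exact: lt_le_trans b2.
set T := tailC _ _; have T0 : 0 < T := tailC_gt0 _ _.
have c0 : 0 <= 4 * pi * expR 2 * T * (b * ln X) ^- p.
  by rewrite !mulr_ge0 ?expR_ge0 ?pi_ge0 ?(ltW T0) // invr_ge0 exprn_ge0 // mulr_ge0 // ltW.
apply: le_trans (ler_wpM2r c0 moment_lower); rewrite le_eqVlt; apply/orP; left; apply/eqP.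
have -> : (b * ln X) ^- p = b ^- p * ln X ^- p by rewrite exprMn invfM.
move: (b ^- p) (ln X ^- p) => y z.
have e : expR (- 2) * expR 2 = 1 :> R by rewrite -expRD addNr expR0.
transitivity (2 * saddleA N X * T * y * z * (pi / b) * (expR (- 2) * expR 2)); first by rewrite e mulr1.
by field; rewrite gt_eqF.
Qed.

End AtSaddle.
End LaplaceMethod.

Lemma iter_fdiffZ (R : numDomainType) (c : R) f p k :
  iter p (@fdiff R) (fun k => c * f k) k = c * iter p (@fdiff R) f k.
Proof. by elim: p k => [//|p IH] k; rewrite !iter_fdiffS !IH mulrBr. Qed.

(** * The moments are asymptotically geometric at the scale sqrt N *)

Section MomentRatios.
Variable R : realType.
Hypothesis mfin : forall k, emoment R k \is a fin_num.

Lemma saddle_ex n : { X : R | 1 <= X & (2 * n.+1)%:R = pi * X * ln X }.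
Proof.
apply: cid2; pose B : R := expR 1 + (2 * n.+1)%:R.
have e1 : 1 <= expR 1 :> R by rewrite -[leLHS]expR0 ler_expR.
have B1 : 1 <= B by rewrite /B; have : 0 <= (2 * n.+1)%:R :> R by []; lra.
pose f (x : R) := pi * x * ln x.
have [||X] := @IVT R f 1 B (2 * n.+1)%:R B1.
- apply: cts_within => x; rewrite /= in_itv /= => /andP[x1 _].
  apply: cvgM; last by apply: continuous_ln; exact: lt_le_trans x1.
  by apply: cvgM; [exact: cvg_cst | exact: cvg_id].
- have f1 : f 1 = 0 by rewrite /f ln1 mulr0.
  have lB : 1 <= ln B.
    rewrite -[leLHS](@expRK R) ler_ln ?posrE ?expR_gt0 //; last exact: lt_le_trans B1.
    by rewrite lerDl.
  have fB : (2 * n.+1)%:R <= f B.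
    rewrite /f; have p2 := pi_ge2 R.
    apply: le_trans (_ : _ <= B) _; first by rewrite lerDr expR_ge0.
    rewrite -[leLHS]mulr1; apply: ler_pM => //; first by lra.
    by rewrite ler_peMl; lra.
  rewrite f1 /Num.min /Num.max ifT; last by apply: lt_le_trans fB; rewrite ltr0n.
  by rewrite ifT ?fB ?ler0n //; apply: lt_le_trans fB; rewrite ltr0n.
- by rewrite in_itv /= => /andP[X1 _] fX; exists X.
Qed.

Definition saddle n : R := projT1 (sig_of_sig2 (saddle_ex n)).

Lemma saddleP n : 1 <= saddle n /\ (2 * n.+1)%:R = pi * saddle n * ln (saddle n).
Proof. by rewrite /saddle; case: saddle_ex. Qed.

Lemma cvg_ln_saddle : (fun n => ln (saddle n)) @ \oo --> +oo.
Proof.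
apply/cvgryPge => A; near=> n; rewrite leNgt; apply/negP => lA.
have [X1 sad] := saddleP n; have X0 : 0 < saddle n by exact: lt_le_trans X1.
have l0 := ln_ge0 X1; have A0 : 0 < A by exact: le_lt_trans lA.
have XA : saddle n < expR A by rewrite -[ltLHS]lnK // ltr_expR.
have : (2 * n.+1)%:R <= pi * expR A * A.
  rewrite sad; apply: ler_pM => //; rewrite ?mulr_ge0 ?pi_ge0 ?(ltW X0) ?(ltW lA) //.
  by rewrite ler_wpM2l ?pi_ge0 // ltW.
apply/negP; rewrite -ltNge; apply: lt_le_trans (_ : n%:R <= _); last by rewrite ler_nat; lia.
by near: n; apply: nbhs_infty_gtr.
Unshelve. all: by end_near. Qed.

Definition tau n : R := ln (saddle n) ^+ 2.

Lemma ln_saddle_gt0 n : 0 < ln (saddle n).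
Proof.
have [X1 sad] := saddleP n; have l0 := ln_ge0 X1.
rewrite lt_neqAle l0 andbT; apply/eqP => z; move: sad; rewrite -z mulr0 => /eqP.
by rewrite pnatr_eq0.
Qed.

Lemma tau_gt0 n : 0 < tau n. Proof. by rewrite exprn_gt0 // ln_saddle_gt0. Qed.

Lemma cvg_ln_saddleV : (fun n => (ln (saddle n))^-1) @ \oo --> 0.
Proof.
apply/(@gtr0_cvgV0 R _ _ _ (fun n => ln (saddle n))); last exact: cvg_ln_saddle.
by near=> n; exact: ln_saddle_gt0.
Unshelve. all: by end_near. Qed.

Lemma cvg_tau_ratio : (fun n => tau n / (2 * n.+1)%:R ^+ 2) @ \oo --> 0.
Proof.
have h := cvg_ln_saddleV.
have h2 : (fun n => (ln (saddle n))^-1 * (ln (saddle n))^-1) @ \oo --> (0 : R).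
  by rewrite -[X in _ --> X](mul0r 0); apply: cvgM.
apply: squeeze_cvgr (cvg_cst (0 : R)) h2.
near=> n; have [X1 sad] := saddleP n; have l0 := ln_saddle_gt0 n.
have X0 : 0 < saddle n by exact: lt_le_trans X1.
rewrite divr_ge0 ?sqr_ge0 // /tau sad /=.
have kl : ln (saddle n) <= pi * saddle n.
  have lx : ln (saddle n) <= saddle n - 1.
    have := @le_ln1Dx R (saddle n - 1); rewrite (addrC 1) subrK; apply; lra.
  apply: le_trans lx _; apply: le_trans (_ : _ <= saddle n) _; first by rewrite gerBl.
  by rewrite ler_peMl ?(ltW X0) // (le_trans _ (pi_ge2 R)) // ler1n.
have -> : ln (saddle n) ^+ 2 / (pi * saddle n * ln (saddle n)) ^+ 2 = (pi * saddle n)^-1 * (pi * saddle n)^-1.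
  have gen (a c : R) : a != 0 -> c != 0 -> c ^+ 2 / (a * c) ^+ 2 = a^-1 * a^-1.
    by move=> a0 c0; field; rewrite a0 c0.
  by apply: gen; rewrite gt_eqF // mulr_gt0 // pi_gt0.
by apply: ler_pM; rewrite ?invr_ge0 ?mulr_ge0 ?pi_ge0 ?(ltW X0) // lef_pV2 ?posrE // mulr_gt0 // pi_gt0.
Unshelve. all: by end_near. Qed.

Definition moment_ratio n k : R := (moment R n.+1)^-1 * (moment R (n.+1 + k) * (tau n) ^- k).

(** The saddle equation gives (b ln X)^2 = 2 N ln X, so sqrt N / (b ln X) = (2 ln X)^(- 1/2): a
    logarithm separates the scale of the moments from sqrt N. *)
Lemma near_saddle : \forall n \near \oo, 0 < moment R n.+1 /\
  forall p k, `|rootS R n ^+ p * iter p (@fdiff R) (moment_ratio n) k| <=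
    4 * pi * expR 2 * tailC R (p + (p + 2 * k) + 2) * Num.sqrt (2^-1 * (ln (saddle n))^-1) ^+ p.
Proof.
have /cvgryPge/(_ 1) nl1 := cvg_ln_saddle.
near=> n; have l1 : 1 <= ln (saddle n) by near: n; exact: nl1.
have [X1 sad] := saddleP n; have X0 : 0 < saddle n by exact: lt_le_trans X1.
have m0 := moment_gt0 mfin X0 l1 sad.
split=> // p k; have h := moment_diff mfin X0 l1 sad p k.
have -> : iter p (@fdiff R) (moment_ratio n) k = (moment R n.+1)^-1 *
    iter p (@fdiff R) (fun k => moment R (n.+1 + k) * (ln (saddle n) ^+ 2) ^- k) k.
  by rewrite -iter_fdiffZ.
set C := 4 * pi * expR 2 * _ in h *.
have q : Num.sqrt (2^-1 * (ln (saddle n))^-1) = rootS R n / (Num.sqrt (pi * saddle n) * ln (saddle n)).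
  have l0 := ln_saddle_gt0 n.
  rewrite -[RHS]ger0_norm -?sqrtr_sqr; last by rewrite divr_ge0 ?mulr_ge0 ?sqrtr_ge0 // ltW.
  congr (Num.sqrt _); rewrite expr_div_n exprMn !sqr_sqrtr //; last by rewrite mulr_ge0 ?pi_ge0 ?ltW.
  have -> : n.+1%:R = pi * saddle n * ln (saddle n) / 2 :> R by rewrite -sad natrM mulrC mulKf.
  have gen (a c : R) : a != 0 -> c != 0 -> 2^-1 * c^-1 = a * c / 2 / (a * c ^+ 2).
    by move=> a0 c0; field; rewrite a0 c0.
  by apply: gen; rewrite gt_eqF // mulr_gt0 // pi_gt0.
rewrite q normrM normrX ger0_norm ?(ltW (rootS_gt0 _ _)) // normrM ger0_norm ?invr_ge0 ?(ltW m0) //.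
have rp : 0 <= rootS R n ^+ p by rewrite exprn_ge0 // ltW // rootS_gt0.
have mi : 0 <= (moment R n.+1)^-1 by rewrite invr_ge0 ltW.
apply: le_trans (ler_wpM2l rp (ler_wpM2l mi h)) _.
rewrite mulKf ?gt_eqF // expr_div_n le_eqVlt; apply/orP; left; apply/eqP.
by rewrite mulrCA.
Unshelve. all: by end_near. Qed.

Lemma moment_ratio_scaled : scaled_cvg (@rootS R) moment_ratio (fun p => (p == 0%N)%:R).
Proof.
have [N0 _ HN] := near_saddle.
have S p k : (fun n => rootS R n ^+ p.+1 * iter p.+1 (@fdiff R) (moment_ratio n) k) @ \oo --> 0.
  have q0 : (fun n => Num.sqrt (2^-1 * (ln (saddle n))^-1)) @ \oo --> 0.
    rewrite -[X in _ --> X]sqrtr0; apply: continuous_cvg; first exact: sqrt_continuous.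
    by rewrite -[X in _ --> X](mulr0 2^-1); apply: cvgM; [exact: cvg_cst | exact: cvg_ln_saddleV].
  set K := 4 * pi * expR 2 * tailC R (p.+1 + (p.+1 + 2 * k) + 2).
  have B0 : (fun n => K * Num.sqrt (2^-1 * (ln (saddle n))^-1) ^+ p.+1) @ \oo --> 0.
    rewrite -[X in _ --> X](mulr0 K) -[X in _ --> K * X](expr0n R p.+1).
    apply: cvgM; first exact: cvg_cst.
    exact: (cvg_comp _ _ q0 (@exprn_continuous R p.+1 0)).
  apply/cvgr0Pnorm_lt => e e0; near=> n.
  have nN : (N0 <= n)%N by near: n; exact: nbhs_infty_ge.
  have [_ h] := HN n nN.
  apply: le_lt_trans (h p.+1 k) _.
  near: n; have /cvgr_lt/(_ e) := B0; exact.
case=> [|p] k; last exact: S.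
elim: k => [|k IH].
  apply: cvg_near_cst; near=> n.
  have nN : (N0 <= n)%N by near: n; exact: nbhs_infty_ge.
  have [m0 _] := HN n nN.
  by rewrite /= mul1r /moment_ratio addn0 expr0 invr1 mulr1 mulVf // gt_eqF.
have d : (fun n => moment_ratio n k.+1 - moment_ratio n k) @ \oo --> 0.
  have -> : (fun n => moment_ratio n k.+1 - moment_ratio n k) =
      (fun n => (rootS R n)^-1 * (rootS R n ^+ 1 * iter 1 (@fdiff R) (moment_ratio n) k)).
    by apply/funext => n /=; rewrite expr1 mulKf // gt_eqF // rootS_gt0.
  by rewrite -[X in _ --> X](mulr0 0); apply: cvgM; [exact: cvg_rootSV | exact: S].
have -> : (fun n => rootS R n ^+ 0 * iter 0 (@fdiff R) (moment_ratio n) k.+1) =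
   (fun n => rootS R n ^+ 0 * iter 0 (@fdiff R) (moment_ratio n) k + (moment_ratio n k.+1 - moment_ratio n k)).
  by apply/funext => n; rewrite /= !mul1r addrC subrK.
by rewrite -[X in _ --> X]addr0; apply: cvgD.
Unshelve. all: by end_near. Qed.

End MomentRatios.

(** * The Maclaurin coefficients *)

Section AsymptoticPositivity.
Variable R : realType.

(** A consecutive minor starting at row i and column c depends only on its order and on d = N + c -
    i; the orders up to m share a common threshold D. *)
Lemma asymptotically_positive_toeplitz (m : nat) (a : nat -> R) :
  (forall r, exists D, forall d, (D <= d)%N ->
    0 < \det (\matrix_(p < r, q < r) a (d + q - p)%N)) ->
  asymptotically_positive m a.
Proof.
move=> H.
have [D HD] : exists D, forall r d, (r <= m)%N -> (D <= d)%N ->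
    0 < \det (\matrix_(p < r, q < r) a (d + q - p)%N).
  elim: m => [|m [D IH]].
    by exists 0%N => r d; rewrite leqn0 => /eqP -> _; rewrite det_mx00.
  have [D' HD'] := H m.+1; exists (maxn D D') => r d.
  rewrite leq_eqVlt => /orP[/eqP -> hd|rm hd].
    by apply: HD'; apply: leq_trans hd; exact: leq_maxr.
  by apply: IH => //; apply: leq_trans hd; exact: leq_maxl.
(* As every row index is below m, this N gives d >= D for each consecutive block, and no entry falls
   in the zero branch of [shift_matrix]. *)
exists (D + m).+1 => // r row col hrow hcol; set N := (D + m).+1.
have F := @Fekete R (shift_matrix a N) m.
have cons n i c : (i + n <= m)%N -> 0 < minor (shift_matrix a N) n (iota i n) (iota c n).
  move=> inm; rewrite /minor.
  have h := HD n (N + c - i)%N ltac:(lia) ltac:(rewrite /N; lia).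
  rewrite (_ : \matrix_(_, _) _ = \matrix_(p < n, q < n) a ((N + c - i) + q - p)%N) //.
  apply/matrixP => p q; rewrite !mxE !nth_iota // /shift_matrix.
  have := ltn_ord p; have := ltn_ord q => hq hp.
  by rewrite ifT; [congr a; rewrite /N; lia | rewrite /N; lia].
pose rs := [seq (row i : nat) | i <- enum 'I_r]; pose cs := [seq col i | i <- enum 'I_r].
have rsE (i : 'I_r) : nth 0%N rs i = row i by rewrite (nth_map i) ?size_enum_ord // nth_ord_enum.
have csE (i : 'I_r) : nth 0%N cs i = col i by rewrite (nth_map i) ?size_enum_ord // nth_ord_enum.
have inc (s : seq nat) (f : 'I_r -> nat) : size s = r -> (forall i : 'I_r, nth 0%N s i = f i) ->
    {homo f : i j / (i < j)%N} -> sorted ltn s.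
  move=> sz sE hf; apply/(sortedP 0%N) => i; rewrite sz => ir.
  have ir' : (i < r)%N by exact: ltnW.
  by have := @hf (Ordinal ir') (Ordinal ir) (ltnSn i); rewrite -!sE.
have szr : size rs = r by rewrite size_map size_enum_ord.
have szc : size cs = r by rewrite size_map size_enum_ord.
have := F cons r rs cs (inc _ _ szr rsE hrow) _ szr (inc _ _ szc csE hcol) szc.
rewrite /minor (_ : \matrix_(_, _) _ = \matrix_(i < r, j < r) shift_matrix a N (row i) (col j)).
  move=> h; apply: ltW; apply: h; apply/allP => x /mapP[i _ ->]; exact: ltn_ord.
by apply/matrixP => i j; rewrite !mxE rsE csE.
Qed.

Hypothesis mfin : forall k, emoment R k \is a fin_num.

Definition alpha (k : nat) : R := 2 * moment R k / (4 ^+ k * (2 * k)`!%:R).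

(* The coefficients of [1 / 2 + (y - 1 / 4) / 2 * sum_k alpha k y ^ k]. *)
Definition xi_coef (k : nat) : R :=
  (if k is k'.+1 then alpha k' / 2 else 1 / 2) - alpha k / 8.

(** [U n] is the sequence [alpha] from index n + 1 on, with its initial value and its geometric
    growth [rho] divided out; [V n] is the corresponding combination for [xi_coef], where [rho n]
    tends to 0. *)
Let rho n : R := tau R n / (4 * (2 * n.+1)%:R ^+ 2).
Let U n k : R := moment_ratio R n k * factF R n k.
Let V n k : R := U n k - rho n / 4 * U n k.+1.

Let V_scaled : scaled_cvg (@rootS R) V (hermite0 R).
Proof.
apply: scaled_cvg_comb.
  by apply: scaled_cvgM; [exact: factF_scaled | exact: (moment_ratio_scaled mfin)].
have -> : (fun n => rho n / 4) = (fun n => tau R n / (2 * n.+1)%:R ^+ 2 * (16^-1)).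
  apply/funext => n; rewrite /rho.
  have : ((2 * n.+1)%:R : R) != 0 by rewrite pnatr_eq0.
  by move: ((2 * n.+1)%:R : R) (tau R n) => z t z0; field.
by rewrite -[X in _ --> X](mul0r 16^-1); apply: cvgM; [exact: cvg_tau_ratio | exact: cvg_cst].
Qed.

Let rho_gt0 n : 0 < rho n.
Proof. by rewrite divr_gt0 ?tau_gt0 // mulr_gt0 // exprn_gt0 // ltr0n. Qed.

Let alphaU n k : moment R n.+1 != 0 -> alpha (n.+1 + k) = alpha n.+1 * rho n ^+ k * U n k.
Proof.
move=> m0; rewrite /alpha /U /moment_ratio /factF /rho mulnDr.
have f0 j : (j`!%:R : R) != 0 by rewrite pnatr_eq0 -lt0n fact_gt0.
have t0 : tau R n ^+ k != 0 by rewrite expf_neq0 // gt_eqF // tau_gt0.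
have n0 : ((2 * n.+1)%:R : R) != 0 by rewrite pnatr_eq0.
have e : (2 * n.+1)%:R ^+ (2 * k) = ((2 * n.+1)%:R ^+ k) ^+ 2 :> R by rewrite (mulnC 2%N k) exprM.
have d0 : ((2 * n.+1)%:R ^+ k : R) != 0 by rewrite expf_neq0.
have q0 j : (4 ^+ j : R) != 0 by rewrite expf_neq0.
have e2 : (tau R n / (4 * (2 * n.+1)%:R ^+ 2)) ^+ k =
    tau R n ^+ k / (4 ^+ k * ((2 * n.+1)%:R ^+ k) ^+ 2).
  by move: ((2 * n.+1)%:R : R) (tau R n) => z t; rewrite expr_div_n exprMn exprAC.
rewrite e e2 exprD.
move: (f0 (2 * n.+1)%N) (f0 (2 * n.+1 + 2 * k)%N) t0 d0 (q0 n.+1) (q0 k).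
move: (_`!%:R) (_`!%:R) (tau R n ^+ k) (_ ^+ k) (4 ^+ n.+1) (4 ^+ k) => a b c d g h.
move=> a0 b0 c0 d0 g0 h0; field.
by rewrite a0 b0 c0 d0 g0 h0 m0.
Qed.

Lemma xi_coef_toeplitz r : exists D, forall d, (D <= d)%N ->
  0 < \det (\matrix_(p < r, q < r) xi_coef (d + q - p)%N).
Proof.
have [N1 _ H1] := toeplitz_pos (@rootS_gt0 R) V_scaled (leqnSn r).
have [N2 _ H2] := near_saddle mfin.
(* Then d + q - p = (n + 1 + (r - p + q)) + 1, so all entries are values of [V n] at nonnegative
   offsets; the powers of [rho] split into a row factor and a column factor. *)
exists (N1 + N2 + r + 2)%N => d hd; pose n := (d - r - 2)%N.
have n1 : (N1 <= n)%N by rewrite /n; lia.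
have n2 : (N2 <= n)%N by rewrite /n; lia.
have [m0 _] := H2 n n2; have {H1} := H1 n n1 => /= H1.
have alpha_pos : 0 < alpha n.+1.
  by rewrite divr_gt0 ?mulr_gt0 // ?exprn_gt0 // ltr0n fact_gt0.
have xV j : xi_coef (n.+1 + j).+1 = alpha n.+1 / 2 * rho n ^+ j * V n j.
  rewrite /xi_coef -addnS !alphaU ?gt_eqF // /V exprS.
  by move: (rho n ^+ j) (U n j) (U n j.+1) (rho n) => x z w t; field.
have -> : \matrix_(p < r, q < r) xi_coef (d + q - p)%N =
   \matrix_(p < r, q < r) ((alpha n.+1 / 2 * rho n ^+ (r - p)) *
     (\matrix_(i < r, j < r) V n (r - i + j)%N) p q * rho n ^+ q).
  apply/matrixP => p q; rewrite !mxE; have pr := ltn_ord p.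
  have -> : (d + q - p = (n.+1 + (r - p + q)).+1)%N by rewrite /n; lia.
  by rewrite xV exprD; ring.
rewrite det_scale !mulr_gt0 //; apply: prodr_gt0 => i _.
  by rewrite mulr_gt0 ?exprn_gt0 // divr_gt0.
by rewrite exprn_gt0.
Qed.

Lemma xi_coef_positive m : asymptotically_positive m xi_coef.
Proof. exact/asymptotically_positive_toeplitz/xi_coef_toeplitz. Qed.

Lemma cosh_coef_alpha u k : cosh_coef u k * moment R k = alpha k * (u ^+ 2) ^+ k.
Proof.
have f0 : ((2 * k)`!%:R : R) != 0 by rewrite pnatr_eq0 -lt0n fact_gt0.
have q0 : (4 ^+ k : R) != 0 by rewrite expf_neq0.
rewrite /cosh_coef /alpha exprM expr_div_n expr_div_n (_ : 2 ^+ 2 = 4); last by ring.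
by field; rewrite f0 q0.
Qed.

End AsymptoticPositivity.

(** * Identification of the Maclaurin series *)

Section XiSeries.
Import Normc.
Local Open Scope complex_scope.
Variable R : realType.

Lemma cvg_series_shift (x : nat -> R) (c l : R) : series x @ \oo --> l ->
  series (fun k => if k is k'.+1 then x k' else c) @ \oo --> c + l.
Proof.
move=> h; rewrite -(cvg_shiftS (series _)).
have -> : (fun n => series (fun k => if k is k'.+1 then x k' else c) n.+1) =
    (fun n => c + series x n).
  by apply/funext => n; rewrite !seriesEnat /= big_nat_recl.
by apply: cvgD; [exact: cvg_cst | exact: h].
Qed.

Variables (G zeta xi : R[i] -> R[i]).
Hypotheses (hG : is_Gamma G) (hzeta : is_zeta zeta) (hxi : is_xi G zeta xi).

Lemma alpha_ge0 k : 0 <= alpha R k.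
Proof. by rewrite divr_ge0 ?mulr_ge0 // fine_ge0 // emoment_ge0. Qed.

Lemma xi_alpha (u : R) : 2 <= u -> exists2 S,
  series (fun k => alpha R k * (u ^+ 2) ^+ k) @ \oo --> S &
  xi (u + 1 / 2)%:C = (1 / 2 + (u ^+ 2 - 1 / 4) / 2 * S)%:C.
Proof.
move=> u2; have [S hS e] := xi_real hG hzeta hxi u2; exists S => //.
by rewrite [X in series X](_ : _ = (fun k => cosh_coef u k * moment R k)) //; apply/funext => k; rewrite cosh_coef_alpha.
Qed.

Lemma cvg_xi_coef (y S : R) : series (fun k => alpha R k * y ^+ k) @ \oo --> S ->
  series (fun k => xi_coef R k * y ^+ k) @ \oo --> 1 / 2 + (y - 1 / 4) / 2 * S.
Proof.
move=> hS.
have h1 : series (fun k => alpha R k * y ^+ k * (y / 2)) @ \oo --> S * (y / 2).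
  exact: cvg_seriesMr.
have h2 := @cvg_series_shift _ (1 / 2) _ h1.
have -> : series (fun k => xi_coef R k * y ^+ k) = (fun n =>
   series (fun k => if k is k'.+1 then alpha R k' * y ^+ k' * (y / 2) else 1 / 2) n -
   8^-1 * series (fun k => alpha R k * y ^+ k) n).
  apply/funext => n; rewrite !seriesEnat /= big_distrr /= -sumrB; apply: eq_bigr => k _.
  by rewrite /xi_coef; case: k => [|k]; rewrite ?exprS ?expr0; field.
rewrite (_ : 1 / 2 + (y - 1 / 4) / 2 * S = 1 / 2 + S * (y / 2) - 8^-1 * S); last by field.
by apply: cvgB; [exact: h2 | apply: cvgM; [exact: cvg_cst | exact: hS]].
Qed.

Lemma cvg_abs_xi_coef (r : R) : 0 <= r -> cvgn (series (fun k => `|xi_coef R k| * r ^+ k)).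
Proof.
(* Every radius r is at most u^2 for this admissible u, and convergence at u^2 is part of
   [xi_alpha]. *)
move=> r0; pose u := 2 + r; have u2 : 2 <= u by rewrite /u; lra.
have ru : r <= u ^+ 2 by rewrite /u; nra.
have [S hS _] := xi_alpha u2.
set y := u ^+ 2 in ru hS; have y0 : 0 <= y by exact: le_trans ru.
have h1 : series (fun k => alpha R k * y ^+ k * (y / 2)) @ \oo --> S * (y / 2).
  exact: cvg_seriesMr.
pose g k := (if k is k'.+1 then alpha R k' * y ^+ k' * (y / 2) else 1 / 2) + 8^-1 * (alpha R k * y ^+ k).
have hg : cvgn (series g).
  have -> : series g = (fun n =>
   series (fun k => if k is k'.+1 then alpha R k' * y ^+ k' * (y / 2) else 1 / 2) n +
   8^-1 * series (fun k => alpha R k * y ^+ k) n).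
    by apply/funext => n; rewrite !seriesEnat /= big_distrr /= -big_split.
  apply: cvgP; apply: cvgD; first exact: cvg_series_shift h1.
  by apply: cvgM; [exact: cvg_cst | exact: hS].
have g1 k : `|xi_coef R k| * r ^+ k <= g k.
  apply: le_trans (_ : _ <= `|xi_coef R k| * y ^+ k) _.
    by rewrite ler_wpM2l // lerXn2r.
  have a0 := alpha_ge0 k; have yk : 0 <= y ^+ k by rewrite exprn_ge0.
  have gE : g k = ((if k is k'.+1 then alpha R k' / 2 else 1 / 2) + alpha R k / 8) * y ^+ k.
    by rewrite /g; case: (k) => [|j]; rewrite ?exprS ?expr0; field.
  rewrite gE ler_wpM2r // /xi_coef; apply: le_trans (ler_normB _ _) _.
  apply: lerD; last by rewrite ger0_norm // divr_ge0.
  by rewrite ger0_norm //; case: (k) => [|j]; rewrite divr_ge0 // alpha_ge0.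
have b0 k : 0 <= `|xi_coef R k| * r ^+ k by rewrite mulr_ge0 // exprn_ge0.
apply: (series_le_cvg b0 _ g1 hg) => k; exact: le_trans (g1 k).
Qed.

(** The identity xi s = f ((s - 1/2)^2) is continued from the real ray to all s. It contains the
    evenness about 1/2, so the branch taken by [sqrtC] disappears on squaring. *)
Lemma xi1_generating : generating_function (@xi_coef R) (xi1 xi).
Proof.
have [f fE fS] := power_series_entire cvg_abs_xi_coef.
suff H s : xi s = f ((s - 2%:R^-1) ^+ 2).
  by move=> z; rewrite /xi1 H addrK sqrtCK; exact: fS.
pose h s := xi s + (-1) * f ((s - 2%:R^-1) * (s - 2%:R^-1)).
suff : h s = 0 by rewrite /h mulN1r => /eqP; rewrite subr_eq0 => /eqP.
(* From 5/2 on, u = x - 1/2 is at least 2, the range of [xi_alpha]. *)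
apply: (@entire_zero_ray R h (5 / 2)).
  have cs : centire (fun s : R[i] => s - 2%:R^-1) by apply: centireD; [exact: centire_id | exact: centire_cst].
  apply: centireD; first exact: entire_centire hxi.1.
  apply: centireM; first exact: centire_cst.
  exact: (centire_comp (centireM cs cs) fE).
move=> x x2; pose u := x - 1 / 2.
have u2 : 2 <= u by rewrite /u; lra.
have [S hS e] := xi_alpha u2.
have xu : x = u + 1 / 2 by rewrite /u; lra.
have xC : x%:C - 2%:R^-1 = u%:C.
  rewrite -[2%:R : R[i]](rmorph_nat (real_complex R)) -fmorphV -rmorphB; congr (_%:C).
  by rewrite /u div1r.
rewrite /h {1}xu e xC -rmorphM -expr2 mulN1r; apply/eqP; rewrite subr_eq0; apply/eqP.
apply: cvgC_unique (fS _).
have -> : (fun n => \sum_(0 <= k < n) (xi_coef R k)%:C * (u ^+ 2)%:C ^+ k) =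
   (fun n => (series (fun k => xi_coef R k * (u ^+ 2) ^+ k) n)%:C).
  apply/funext => n; rewrite seriesEnat /= rmorph_sum /=; apply: eq_bigr => k _.
  by rewrite -rmorphXn -rmorphM.
by apply: cvgC_ReIm => /=; [exact: cvg_xi_coef | exact: cvg_cst].
Qed.

End XiSeries.

Theorem theorem2 (R : realType) (G zeta xi : R[i] -> R[i])
    (hG : is_Gamma G) (hzeta : is_zeta zeta) (hxi : is_xi G zeta xi)
    (m : nat) (hm : (0 < m)%N) :
  APF m (xi1 xi).
Proof.
exists (@xi_coef R); first exact: xi1_generating hG hzeta hxi.
exact/xi_coef_positive/(emoment_fin_num hzeta).
Qed.
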